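(* Let $\varsigma\in M^1(\mathbb{Z}^n\times\mathbb{T}^n)$ and $g_1,g_2\in M^1(\mathbb{Z}^n)\cap\ell^\infty(\mathbb{Z}^n)$. Then there exists a bounded linear operator $\mathfrak{L}^{g_1,g_2}_\varsigma:M^p(\mathbb{Z}^n)\to M^p(\mathbb{Z}^n)$, $1\le p\le\infty$, such that $$\|\mathfrak{L}^{g_1,g_2}_\varsigma\|_{\mathcal{B}(M^p(\mathbb{Z}^n))}\le\max\big(\|g_1\|_{M^1(\mathbb{Z}^n)}\|g_2\|_{\ell^\infty(\mathbb{Z}^n)},\ \|g_1\|_{\ell^\infty(\mathbb{Z}^n)}\|g_2\|_{M^1(\mathbb{Z}^n)}\big)\,\|\varsigma\|_{M^1(\mathbb{Z}^n\times\mathbb{T}^n)}.$$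
   Context: $\mathbb{T}^n$ is the torus with normalized Haar measure $dw$; $\mathbb{Z}^n\times\mathbb{T}^n$ carries the product of counting measure and $dw$. $T_mf(k)=f(k-m)$, $M_wf(k)=e^{2\pi i w\cdot k}f(k)$, and the short-time Fourier transform is $V_gf(m,w)=\langle f,M_wT_mg\rangle=\sum_{k\in\mathbb{Z}^n}f(k)\overline{g(k-m)}e^{-2\pi i w\cdot k}$. $\mathcal{S}(\mathbb{Z}^n)$ is the space of rapidly decreasing functions on $\mathbb{Z}^n$, $\mathcal{S}'(\mathbb{Z}^n)$ its dual (tempered distributions); $\mathcal{S}(\mathbb{Z}^n\times\mathbb{T}^n)$ and $\mathcal{S}'(\mathbb{Z}^n\times\mathbb{T}^n)$ are the Schwartz functions and tempered distributions on the group $\mathbb{Z}^n\times\mathbb{T}^n$. Modulation spaces: fix a non-zero window $g\in\mathcal{S}(\mathbb{Z}^n)$; for $1\le p\le\infty$, $M^p(\mathbb{Z}^n)=\{f\in\mathcal{S}'(\mathbb{Z}^n): V_gf\in L^p(\mathbb{Z}^n\times\mathbb{T}^n)\}$ with $\|f\|_{M^p(\mathbb{Z}^n)}=\|V_gf\|_{L^p}$. Similarly, fix a non-zero $g\in\mathcal{S}(\mathbb{Z}^n\times\mathbb{T}^n)$ and set $$V_gF(m,\omega,\xi,k)=\sum_{j\in\mathbb{Z}^n}\int_{\mathbb{T}^n}e^{-2\pi i j\xi}e^{-2\pi i\eta k}F(j,\eta)\overline{g(j-m,\eta-\omega)}\,d\eta,\quad m,k\in\mathbb{Z}^n,\ \omega,\xi\in\mathbb{T}^n;$$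 $M^p(\mathbb{Z}^n\times\mathbb{T}^n)$ is the space of $F\in\mathcal{S}'(\mathbb{Z}^n\times\mathbb{T}^n)$ with $\|F\|_{M^p(\mathbb{Z}^n\times\mathbb{T}^n)}=\|V_gF\|_{L^p((\mathbb{Z}^n\times\mathbb{T}^n)\times(\mathbb{T}^n\times\mathbb{Z}^n))}<\infty$. Different windows give equivalent norms. $\mathfrak{L}^{g_1,g_2}_\varsigma$ denotes the localization operator $$\mathfrak{L}^{g_1,g_2}_\varsigma f(k)=\sum_{m\in\mathbb{Z}^n}\int_{\mathbb{T}^n}\varsigma(m,w)V_{g_1}f(m,w)\,M_wT_mg_2(k)\,dw,\qquad k\in\mathbb{Z}^n.$$ $\mathcal{B}(X)$ denotes the bounded linear operators on $X$ with operator norm.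
   Formalization: The norm bound carries a constant C>0 depending only on the windows g, G that define the modulation norms; C=1 if ‖g‖_1 ≤ ‖g‖_2^2‖G‖_∞. With constant 1 it fails for arbitrary windows, since scaling G by c scales ‖ς‖_{M^1} by |c|. *)

(* Defs.v *)
From HB Require Import structures.
From mathcomp Require Import all_boot all_order all_algebra.
From mathcomp Require Import all_classical all_reals all_analysis.
From mathcomp Require Import complex.

Set Implicit Arguments.
Unset Strict Implicit.
Unset Printing Implicit Defensive.

Import Order.TTheory GRing.Theory Num.Theory.
Import numFieldNormedType.Exports.

Local Open Scope classical_set_scope.
Local Open Scope complex_scope.
Local Open Scope ring_scope.

(* The lattice Z^n with the discrete sigma-algebra and the counting measure. *)
Definition Zn (n : nat) := 'rV[int]_n.

HB.instance Definition _ n := Countable.copy (Zn n) 'rV[int]_n.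
HB.instance Definition _ n := GRing.Zmodule.copy (Zn n) 'rV[int]_n.
HB.instance Definition _ n := isPointed.Build (Zn n) 0.
HB.instance Definition _ n := @isMeasurable.Build default_measure_display
  (Zn n) discrete_measurable discrete_measurable0
  discrete_measurableC discrete_measurableU.

Lemma sigma_finite_counting_Zn (R : realType) (n : nat) :
  sigma_finite [set: Zn n] (@counting (Zn n) R).
Proof.
exists (fun m => [set k : Zn n | (pickle k < m)%N]).
  by apply/seteqP; split => // k _; exists (pickle k).+1 => //=.
move=> m; split => //; rewrite /counting asboolT ?ltry//.
apply: (@sub_finite_set _ _
  ((fun i => odflt 0 (unpickle i : option (Zn n))) @` `I_m)).
  by move=> k /= km; exists (pickle k) => //=; rewrite pickleK.
exact/finite_image/finite_II.
Qed.

Definition countZ (R : realType) (n : nat) : set (Zn n) -> \bar R :=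
  @counting (Zn n) R.

HB.instance Definition _ (R : realType) (n : nat) :=
  Measure.copy (@countZ R n) (@counting (Zn n) R).
HB.instance Definition _ (R : realType) (n : nat) :=
  @Measure_isSigmaFinite.Build _ _ _ (@countZ R n)
    (@sigma_finite_counting_Zn R n).

(* Points of the torus T^n = R^n / Z^n are given by representatives in R^n:
   functions on T^n are the functions on R^n that are 1-periodic in each
   variable. The sigma-algebra on R^n is generated by the coordinates. *)
Definition Rn (R : realType) (n : nat) := 'rV[R]_n.

HB.instance Definition _ (R : realType) n := NormedModule.copy (Rn R n) 'rV[R]_n.

Definition Rn_coord (R : realType) (n : nat) (i : 'I_n) (w : Rn R n) : R :=
  w ord0 i.

Section Rn_measurable.
Variables (R : realType) (n : nat).

Let Rn_set0 : g_sigma_preimage (@Rn_coord R n) set0.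
Proof. exact: sigma_algebra0. Qed.

Let Rn_setC A : g_sigma_preimage (@Rn_coord R n) A ->
  g_sigma_preimage (@Rn_coord R n) (~` A).
Proof. exact: sigma_algebraC. Qed.

Let Rn_bigcup (F : (set (Rn R n))^nat) :
  (forall i, g_sigma_preimage (@Rn_coord R n) (F i)) ->
  g_sigma_preimage (@Rn_coord R n) (\bigcup_i (F i)).
Proof. exact: sigma_algebra_bigcup. Qed.

HB.instance Definition _ := @isMeasurable.Build default_measure_display
  (Rn R n) (g_sigma_preimage (@Rn_coord R n)) Rn_set0 Rn_setC Rn_bigcup.

End Rn_measurable.

Definition Rn_e (R : realType) (n : nat) (i : 'I_n) : Rn R n := delta_mx ord0 i.

Definition Rn_cons (R : realType) (n : nat) (x : measurableTypeR R * Rn R n) : Rn R n.+1 :=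
  \row_i oapp (fun j => x.2 ord0 j) x.1 (unlift ord0 i).

Lemma measurable_Rn_coord (R : realType) (n : nat) (i : 'I_n) :
  measurable_fun [set: Rn R n] (@Rn_coord R n i).
Proof.
move=> _ Y mY; rewrite setTI; apply: sub_sigma_algebra => /=.
rewrite -bigcup_seq/=; exists i => /=; first by rewrite mem_index_enum.
by exists Y => //; rewrite setTI.
Qed.

Lemma measurable_Rn_cons (R : realType) (n : nat) :
  measurable_fun [set: measurableTypeR R * Rn R n] (@Rn_cons R n).
Proof.
have : g_sigma_preimage (fun i : 'I_n.+1 => @Rn_coord R n.+1 i \o @Rn_cons R n)
    `<=` measurable.
  apply: smallest_sub; first exact: sigma_algebra_measurable.
  rewrite -bigcup_mkord_ord; apply: bigcup_sub => i Ii A [B mB <-].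
  suff mf : measurable_fun [set: measurableTypeR R * Rn R n]
      (@Rn_coord R n.+1 (inord i) \o @Rn_cons R n) by exact: mf.
  case: (unliftP ord0 (inord i : 'I_n.+1)) => [j|] ->.
    rewrite (_ : _ \o _ = @Rn_coord R n j \o snd).
      exact: (measurableT_comp (@measurable_Rn_coord R n j)).
    by apply/funext => x; rewrite /Rn_coord/= mxE liftK.
  rewrite (_ : _ \o _ = fst)//.
  by apply/funext => x; rewrite /Rn_coord/= mxE unlift_none.
rewrite g_sigma_preimage_comp => sub _ A mA.
by apply: sub; exists A.
Qed.

HB.instance Definition _ (R : realType) (n : nat) :=
  isMeasurableFun.Build _ _ _ _ (@Rn_cons R n) (@measurable_Rn_cons R n).

(* Normalized Haar measure of T^n: the n-fold product of the uniform
   probability on [0, 1], carried by the cube of representatives. *)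
Fixpoint haar (R : realType) (n : nat) : probability (Rn R n) R :=
  match n with
  | 0 => dirac (0 : Rn R 0)
  | m.+1 => distribution (uniform_prob (@ltr01 R) \x haar R m)%E (@Rn_cons R m)
  end.

(* The measures of Z^n x T^n, of its dual group T^n x Z^n, and of the
   phase space (Z^n x T^n) x (T^n x Z^n). *)
Definition muZT (R : realType) (n : nat) :
    {measure set (Zn n * Rn R n)%type -> \bar R} :=
  (@countZ R n \x haar R n)%E.

Definition muTZ (R : realType) (n : nat) : set (Rn R n * Zn n)%type -> \bar R :=
  (haar R n \x @countZ R n)%E.

Lemma sigma_finite_muTZ (R : realType) (n : nat) :
  sigma_finite [set: Rn R n * Zn n] (@muTZ R n).
Proof.
have [F TF Foo] := @sigma_finite_counting_Zn R n.
exists (fun m => setT `*` F m).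
  apply/seteqP; split => // -[w k] _.
  by have : [set: Zn n] k by []; rewrite TF => -[m _ Fmk]; exists m.
move=> m; have [mF Fmoo] := Foo m; split; first exact: measurableX.
rewrite /muTZ product_measure1E// [X in (X * _)%E](_ : _ = 1%E) ?mul1e//.
exact: probability_setT.
Qed.

HB.instance Definition _ (R : realType) (n : nat) :=
  Measure.copy (@muTZ R n) (haar R n \x @countZ R n)%E.
HB.instance Definition _ (R : realType) (n : nat) :=
  @Measure_isSigmaFinite.Build _ _ _ (@muTZ R n) (@sigma_finite_muTZ R n).

Definition muZTTZ (R : realType) (n : nat) :
    {measure set ((Zn n * Rn R n) * (Rn R n * Zn n))%type -> \bar R} :=
  (muZT R n \x @muTZ R n)%E.

Section complex_functions.
Variables (d : measure_display) (T : measurableType d) (R : realType).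
Variable mu : {measure set T -> \bar R}.
Implicit Types F : T -> R[i].

Definition cintegrable F : Prop :=
  mu.-integrable [set: T] (fun x => (complex.Re (F x))%:E) /\
  mu.-integrable [set: T] (fun x => (complex.Im (F x))%:E).

Definition cintegral F : R[i] :=
  (\int[mu]_x complex.Re (F x)) +i* (\int[mu]_x complex.Im (F x)).

Definition Lpnorm (p : \bar R) F : \bar R :=
  Lnorm mu p (fun x => (Normc.normc (F x))%:E).

Definition in_Lp (p : \bar R) F : Prop :=
  [/\ measurable_fun [set: T] (fun x => complex.Re (F x)),
      measurable_fun [set: T] (fun x => complex.Im (F x)) &
      (Lpnorm p F < +oo)%E].

End complex_functions.

Section phase_space.
Variables (R : realType) (n : nat).
Implicit Types (k m j : Zn n) (w xi omega eta : Rn R n).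

(* e2pi t = e^(2 pi i t) *)
Definition e2pi (t : R) : R[i] := cos (2 * pi * t) +i* sin (2 * pi * t).

Definition zdot k w : R := \sum_(i < n) (k ord0 i)%:~R * w ord0 i.

Definition zabs k : R := \sum_(i < n) `|(k ord0 i)%:~R|.

Definition seminormZ (N : nat) (phi : Zn n -> R[i]) : \bar R :=
  ereal_sup [set ((1 + zabs k) ^+ N * Normc.normc (phi k))%:E | k in [set: Zn n]].

Definition schwartzZ (phi : Zn n -> R[i]) : Prop :=
  forall N : nat, (seminormZ N phi < +oo)%E.

(* S'(Z^n): as u = sum_k u(delta_k) delta_k for a continuous functional u, a
   tempered distribution is given by the function f(k) = u(delta_k), and acts
   by phi |-> sum_k f(k) phi(k). *)
Definition temperedZ (f : Zn n -> R[i]) : Prop :=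
  exists (N : nat) (B : R), forall phi, schwartzZ phi ->
    cintegrable (@countZ R n) (fun k => f k * phi k) /\
    ((Normc.normc (cintegral (@countZ R n) (fun k => f k * phi k)))%:E
       <= B%:E * seminormZ N phi)%E.

(* M_w T_m g *)
Definition tfshiftZ (m : Zn n) (w : Rn R n) (g : Zn n -> R[i]) : Zn n -> R[i] :=
  fun k => e2pi (zdot k w) * g (k - m).

Definition stftZ (g f : Zn n -> R[i]) (x : Zn n * Rn R n) : R[i] :=
  cintegral (@countZ R n) (fun k => f k * (tfshiftZ x.1 x.2 g k)^*).

Definition normMZ (g : Zn n -> R[i]) (p : \bar R) (f : Zn n -> R[i]) : \bar R :=
  Lpnorm (muZT R n) p (stftZ g f).

Definition modspaceZ (g : Zn n -> R[i]) (p : \bar R) : set (Zn n -> R[i]) :=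
  [set f | temperedZ f /\ in_Lp (muZT R n) p (stftZ g f)].

Definition periodic (h : Rn R n -> R[i]) : Prop :=
  forall (i : 'I_n) w, h (w + Rn_e R i) = h w.

Definition pderiv (i : 'I_n) (h : Rn R n -> R[i]) : Rn R n -> R[i] :=
  fun w => ('D_(Rn_e R i) (fun v => complex.Re (h v)) w) +i*
           ('D_(Rn_e R i) (fun v => complex.Im (h v)) w).

Definition pderivs (s : seq 'I_n) (h : Rn R n -> R[i]) : Rn R n -> R[i] :=
  foldr pderiv h s.

Definition smooth (h : Rn R n -> R[i]) : Prop :=
  forall (s : seq 'I_n),
    let hs := pderivs s h in
    [/\ continuous (fun v => complex.Re (hs v)),
        continuous (fun v => complex.Im (hs v)) &
        forall (i : 'I_n) w,
          derivable (fun v => complex.Re (hs v)) w (Rn_e R i) /\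
          derivable (fun v => complex.Im (hs v)) w (Rn_e R i)].

Definition seminormZT (N : nat) (phi : Zn n * Rn R n -> R[i]) : \bar R :=
  ereal_sup [set ((1 + zabs x.1.1) ^+ N *
                  Normc.normc (pderivs x.2 (fun w => phi (x.1.1, w)) x.1.2))%:E
            | x in [set x : (Zn n * Rn R n) * seq 'I_n | (size x.2 <= N)%N]].

Definition schwartzZT (phi : Zn n * Rn R n -> R[i]) : Prop :=
  [/\ forall k, periodic (fun w => phi (k, w)),
      forall k, smooth (fun w => phi (k, w)) &
      forall N : nat, (seminormZT N phi < +oo)%E].

Definition temperedZT (u : (Zn n * Rn R n -> R[i]) -> R[i]) : Prop :=
  (forall a phi psi, schwartzZT phi -> schwartzZT psi ->
     u (fun x => a * phi x + psi x) = a * u phi + u psi) /\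
  exists (N : nat) (B : R), forall phi, schwartzZT phi ->
    ((Normc.normc (u phi))%:E <= B%:E * seminormZT N phi)%E.

(* (j, eta) |-> e^(2 pi i j . xi) e^(2 pi i eta . k) g(j - m, eta - omega),
   with x = (m, omega) and y = (xi, k) *)
Definition tfshiftZT (x : Zn n * Rn R n) (y : Rn R n * Zn n)
    (g : Zn n * Rn R n -> R[i]) : Zn n * Rn R n -> R[i] :=
  fun z => e2pi (zdot z.1 y.1) * e2pi (zdot y.2 z.2) *
           g (z.1 - x.1, z.2 - x.2).

Definition stftZT (g : Zn n * Rn R n -> R[i])
    (u : (Zn n * Rn R n -> R[i]) -> R[i])
    (z : (Zn n * Rn R n) * (Rn R n * Zn n)) : R[i] :=
  u (fun x => (tfshiftZT z.1 z.2 g x)^*).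

Definition normMZT (g : Zn n * Rn R n -> R[i]) (p : \bar R)
    (u : (Zn n * Rn R n -> R[i]) -> R[i]) : \bar R :=
  Lpnorm (muZTTZ R n) p (stftZT g u).

Definition modspaceZT (g : Zn n * Rn R n -> R[i]) (p : \bar R) :
    set ((Zn n * Rn R n -> R[i]) -> R[i]) :=
  [set u | temperedZT u /\ in_Lp (muZTTZ R n) p (stftZT g u)].

(* The distribution u is given by the integrable function s, which is then
   unique almost everywhere. *)
Definition represents (s : Zn n * Rn R n -> R[i])
    (u : (Zn n * Rn R n -> R[i]) -> R[i]) : Prop :=
  [/\ forall k, periodic (fun w => s (k, w)),
      cintegrable (muZT R n) s &
      forall phi, schwartzZT phi ->
        u phi = cintegral (muZT R n) (fun x => s x * phi x)].

Definition locop (s : Zn n * Rn R n -> R[i]) (g1 g2 f : Zn n -> R[i]) :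
    Zn n -> R[i] :=
  fun k => cintegral (muZT R n)
             (fun x => s x * stftZ g1 f x * tfshiftZ x.1 x.2 g2 k).

(* Library integrals are total functions; this says that the sums and integrals that
   define locop s g1 g2 f converge absolutely. *)
Definition locop_converges (s : Zn n * Rn R n -> R[i])
    (g1 g2 f : Zn n -> R[i]) : Prop :=
  (forall x : Zn n * Rn R n,
     cintegrable (@countZ R n) (fun k => f k * (tfshiftZ x.1 x.2 g1 k)^*)) /\
  (forall k : Zn n,
     cintegrable (muZT R n)
       (fun x => s x * stftZ g1 f x * tfshiftZ x.1 x.2 g2 k)).

Definition bounded_linear_op (g : Zn n -> R[i]) (p : \bar R)
    (L : (Zn n -> R[i]) -> Zn n -> R[i]) : Prop :=
  [/\ forall f, modspaceZ g p f -> modspaceZ g p (L f),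
      forall a f h, modspaceZ g p f -> modspaceZ g p h ->
        L (fun k => a * f k + h k) = (fun k => a * L f k + L h k) &
      exists B : R, forall f, modspaceZ g p f ->
        (normMZ g p (L f) <= B%:E * normMZ g p f)%E].

Definition opnorm (g : Zn n -> R[i]) (p : \bar R)
    (L : (Zn n -> R[i]) -> Zn n -> R[i]) : \bar R :=
  ereal_sup [set normMZ g p (L f)
            | f in [set f | modspaceZ g p f /\ (normMZ g p f <= 1)%E]].

(* Replacing the window G of M^1(Z^n x T^n) by c G multiplies the norm of a
   symbol by |c| and leaves the operator norm on M^p(Z^n) unchanged, so a norm
   bound with constant 1 presupposes a normalization of the windows. This one
   holds for g = delta_0 and sup |G| = 1, and any two non-zero windows satisfy
   it once G is multiplied by a large enough constant. *)
Definition normalized_windows (g : Zn n -> R[i]) (G : Zn n * Rn R n -> R[i]) :=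
  (Lpnorm (@countZ R n) 1%E g <=
     Lpnorm (@countZ R n) 2%:E g ^+ 2 * Lpnorm (muZT R n) +oo%E G)%E.

End phase_space.

(* Main.v *)
(** For a distribution u in M^1(Z^n x T^n), averaging V_G u against characters
    isolates the Fourier coefficients of u in the torus variable, so these are
    summable and u is an integrable function s. For fixed x = (m, omega) the
    numbers V_G u(x, (xi, k)) are, up to averaging in xi, the Fourier
    coefficients of eta |-> s(j, eta) conj(G(j - m, eta - omega)), and an
    absolutely convergent Fourier series is bounded by the sum of the moduli of
    its coefficients; integrating the resulting bound
    |s(x + z)| |G(z)| <= int |V_G u(x, y)| dy over x gives
    |s|_1 sup|G| <= |u|_{M^1}.

    On the lattice, V_g(L f)(y) = int s(x) V_{g1} f(x) V_g(pi(x) g2)(y) dx, and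
    the inversion formula gives
    |g|_2^2 |V_{g1} f(x)| <= int |V_g f(z)| |V_g(pi(x) g1)(z)| dz. Hence
    |V_g(L f)| is dominated by a positive integral operator applied to |V_g f|.
    By covariance both marginals of its kernel are at most |s|_1 |g|_1 / |g|_2^2
    times max(|g1|_{M^1} |g2|_oo, |g1|_oo |g2|_{M^1}), and Schur's test bounds the
    operator on every L^p at once. *)

Require Import Defs.
From mathcomp Require finmap.
From HB Require Import structures.
From mathcomp Require Import all_boot all_order all_algebra.
From mathcomp Require Import all_classical all_reals all_analysis.
From mathcomp Require Import zify measurable_realfun ess_sup_inf complex ring lra.

Set Implicit Arguments.
Unset Strict Implicit.
Unset Printing Implicit Defensive.

Import Order.TTheory GRing.Theory Num.Theory.
Import numFieldNormedType.Exports.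
Import Normc.

Local Open Scope classical_set_scope.
Local Open Scope complex_scope.
Local Open Scope ring_scope.

(** * Complex-valued integrals *)

(** The distribution [u] is an abstract functional, and nothing allows it to be exchanged with an
    integral over parameters of its argument. Test functions are therefore replaced by finite
    trigonometric sums, where linearity suffices. This needs an approximation whose threshold does
    not depend on the test function, since the shifts of the window vary while averages are taken
    over them. Fejer means fit: their kernel is positive of mass one, they commute with derivatives
    and they have an explicit concentration rate; the price is one order of the seminorm. They serve
    again for the bound by absolutely summable coefficients. There s is a sum of characters with no
    smoothness, so the means are taken of each character times the smooth window and then summed by
    dominated convergence, which gives an estimate at every point and keeps |s|_1 sup|G| <= |u| free
    of constants. On the lattice, elements of M^p are bounded and windows in M^1 are summable, so
    every series in sight converges absolutely, whatever p is. *)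

Section complex_facts.
Variable R : realType.
Implicit Types x y : R[i].

Lemma normc_ge0 x : 0 <= normc x.
Proof. by case: x => a b /=; exact: sqrtr_ge0. Qed.

Lemma normc_sqr x : normc x ^+ 2 = complex.Re x ^+ 2 + complex.Im x ^+ 2.
Proof. by case: x => a b /=; rewrite sqr_sqrtr// addr_ge0// sqr_ge0. Qed.

Lemma normc_conj x : normc x^* = normc x.
Proof. by case: x => a b /=; rewrite sqrrN. Qed.

Lemma normc_real (r : R) : normc r%:C = `|r|.
Proof. by rewrite /= expr0n addr0 sqrtr_sqr. Qed.

Lemma normr_Re_le x : `|complex.Re x| <= normc x.
Proof.
rewrite -(ler_pXn2r (ltn0Sn 1)) ?nnegrE ?normr_ge0 ?normc_ge0//.
by rewrite real_normK ?num_real// normc_sqr lerDl sqr_ge0.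
Qed.

Lemma normr_Im_le x : `|complex.Im x| <= normc x.
Proof.
rewrite -(ler_pXn2r (ltn0Sn 1)) ?nnegrE ?normr_ge0 ?normc_ge0//.
by rewrite real_normK ?num_real// normc_sqr lerDr sqr_ge0.
Qed.

Lemma normc_le_ReIm x : normc x <= `|complex.Re x| + `|complex.Im x|.
Proof.
rewrite -(ler_pXn2r (ltn0Sn 1)) ?nnegrE ?normc_ge0 ?addr_ge0//.
rewrite normc_sqr sqrrD !real_normK ?num_real// lerD2r lerDl.
by rewrite mulrn_wge0// mulr_ge0.
Qed.

Lemma cReM x y : complex.Re (x * y) =
  complex.Re x * complex.Re y - complex.Im x * complex.Im y.
Proof. by case: x; case: y. Qed.

Lemma cImM x y : complex.Im (x * y) =
  complex.Re x * complex.Im y + complex.Im x * complex.Re y.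
Proof. by case: x => a b; case: y => c d /=; rewrite mulrC [d * _]mulrC [X in _ + X]mulrC. Qed.

Lemma cReD x y : complex.Re (x + y) = complex.Re x + complex.Re y.
Proof. by case: x; case: y. Qed.

Lemma cImD x y : complex.Im (x + y) = complex.Im x + complex.Im y.
Proof. by case: x; case: y. Qed.

Lemma cReN x : complex.Re (- x) = - complex.Re x. Proof. by case: x. Qed.
Lemma cImN x : complex.Im (- x) = - complex.Im x. Proof. by case: x. Qed.
Lemma cRe_conj x : complex.Re x^* = complex.Re x. Proof. by case: x. Qed.
Lemma cIm_conj x : complex.Im x^* = - complex.Im x. Proof. by case: x. Qed.

Lemma complex_eqP x y :
  complex.Re x = complex.Re y -> complex.Im x = complex.Im y -> x = y.
Proof. by case: x => a b; case: y => c d /= -> ->. Qed.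

Lemma mul_conjc x : x * x^* = (normc x ^+ 2)%:C.
Proof.
by apply: complex_eqP; rewrite ?(cReM, cImM) cRe_conj cIm_conj ?normc_sqr/=; ring.
Qed.

Lemma normc_sum (I : Type) (r : seq I) (P : pred I) (F : I -> R[i]) :
  normc (\sum_(i <- r | P i) F i) <= \sum_(i <- r | P i) normc (F i).
Proof.
elim/big_ind2 : _ => [|x1 x2 y1 y2 h1 h2|//]; first by rewrite normc0.
by rewrite (le_trans (le_normcD _ _))// lerD.
Qed.

Lemma normcB x y : normc (x - y) = normc (y - x).
Proof. by rewrite -opprB normcN. Qed.

Lemma normc_eq0 x : (normc x == 0) = (x == 0).
Proof. by apply/eqP/eqP => [/eq0_normc//|->]; rewrite normc0. Qed.

Lemma normc_gt0 x : (0 < normc x) = (x != 0).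
Proof. by rewrite lt_def normc_ge0 andbT normc_eq0. Qed.

End complex_facts.

Section complex_measurability.
Context d (T : measurableType d) (R : realType).
Implicit Types F G : T -> R[i].

Definition cmeasurable F : Prop :=
  measurable_fun [set: T] (fun x => complex.Re (F x)) /\
  measurable_fun [set: T] (fun x => complex.Im (F x)).

Lemma cmeasurable_cst c : cmeasurable (fun=> c).
Proof. by split; exact: measurable_cst. Qed.

Lemma cmeasurableD F G : cmeasurable F -> cmeasurable G ->
  cmeasurable (fun x => F x + G x).
Proof.
move=> [F1 F2] [G1 G2]; split.
  by under eq_fun do rewrite cReD; exact: measurable_funD.
by under eq_fun do rewrite cImD; exact: measurable_funD.
Qed.

Lemma cmeasurableM F G : cmeasurable F -> cmeasurable G ->
  cmeasurable (fun x => F x * G x).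
Proof.
move=> [F1 F2] [G1 G2]; split.
  under eq_fun do rewrite cReM; apply: measurable_funB; exact: measurable_funM.
under eq_fun do rewrite cImM; apply: measurable_funD; exact: measurable_funM.
Qed.

Lemma cmeasurable_conj F : cmeasurable F -> cmeasurable (fun x => (F x)^*).
Proof.
move=> [F1 F2]; split; first by under eq_fun do rewrite cRe_conj.
by under eq_fun do rewrite cIm_conj; exact: measurableT_comp.
Qed.

Lemma cmeasurable_normc F : cmeasurable F ->
  measurable_fun [set: T] (fun x => normc (F x)).
Proof.
move=> [F1 F2].
rewrite (_ : (fun x => _) =
  fun x => (complex.Re (F x) ^+ 2 + complex.Im (F x) ^+ 2) `^ 2^-1).
  apply: (measurableT_comp (measurable_powR _)).
  by apply: measurable_funD; exact: measurable_funX.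
apply/funext => x; rewrite -normc_sqr powR12_sqrt ?sqr_ge0//.
by rewrite sqrtr_sqr ger0_norm// normc_ge0.
Qed.

Lemma cmeasurable_normcE F : cmeasurable F ->
  measurable_fun [set: T] (fun x => (normc (F x))%:E).
Proof. by move=> mF; apply/measurable_EFinP; exact: cmeasurable_normc. Qed.

Lemma cmeasurable_sum (I : Type) (r : seq I) (P : pred I) (F : I -> T -> R[i]) :
  (forall i, P i -> cmeasurable (F i)) ->
  cmeasurable (fun x => \sum_(i <- r | P i) F i x).
Proof.
move=> mF; elim: r => [|i r ih].
  by under eq_fun do rewrite big_nil; exact: cmeasurable_cst.
under eq_fun do rewrite big_cons.
by case Pi: (P i) => //; exact: cmeasurableD (mF _ Pi) ih.
Qed.

End complex_measurability.

Lemma cmeasurable_comp d1 d2 (T1 : measurableType d1) (T2 : measurableType d2)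
    (R : realType) (F : T2 -> R[i]) (h : T1 -> T2) :
  measurable_fun [set: T1] h -> cmeasurable F -> cmeasurable (F \o h).
Proof.
move=> mh [F1 F2]; split.
  exact: (measurableT_comp F1 mh).
exact: (measurableT_comp F2 mh).
Qed.

Section complex_integrals.
Context d (T : measurableType d) (R : realType) (mu : {measure set T -> \bar R}).
Implicit Types F G : T -> R[i].
Local Open Scope ereal_scope.

(** The modulus dominates both parts and is dominated by the sum of their absolute values. All later
    integrability proofs therefore bound one nonnegative integral. *)
Lemma cintegrableP F :
  cintegrable mu F <-> cmeasurable F /\ \int[mu]_x (normc (F x))%:E < +oo.
Proof.
split=> [[iR iI]|[mF iF]].
  have mF : cmeasurable F.
    by split; apply/measurable_EFinP; [have := measurable_int _ iR|
      have := measurable_int _ iI].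
  split=> //.
  have [_ ] := integrableP _ _ _ (integrableD measurableT (integrable_abse iR) (integrable_abse iI)).
  apply: le_lt_trans; apply: ge0_le_integral => //.
  - by move=> x _; rewrite lee_fin normc_ge0.
  - exact: cmeasurable_normcE.
  - by case: mF => ? ?; apply: measurableT_comp => //; apply: emeasurable_funD;
      apply: measurableT_comp => //; exact/measurable_EFinP.
  - move=> x _ /=; rewrite lee_fin [leRHS]ger0_norm ?addr_ge0//.
    exact: normc_le_ReIm.
have iN : mu.-integrable setT (fun x => (normc (F x))%:E).
  apply/integrableP; split; first exact: cmeasurable_normcE.
  by under eq_integral do rewrite /= ger0_norm ?normc_ge0//.
case: mF => mR mI; split.
  apply: le_integrable iN => //; first exact/measurable_EFinP.
  by move=> x _ /=; rewrite lee_fin (ger0_norm (normc_ge0 _)) normr_Re_le.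
apply: le_integrable iN => //; first exact/measurable_EFinP.
by move=> x _ /=; rewrite lee_fin (ger0_norm (normc_ge0 _)) normr_Im_le.
Qed.

Lemma cintegrable_le F (h : T -> \bar R) : cmeasurable F ->
  measurable_fun setT h -> (forall x, (normc (F x))%:E <= h x) ->
  \int[mu]_x h x < +oo -> cintegrable mu F.
Proof.
move=> mF mh Fh hoo; apply/cintegrableP; split=> //.
apply: le_lt_trans hoo; apply: ge0_le_integral => //.
- by move=> x _; rewrite lee_fin normc_ge0.
- exact: cmeasurable_normcE.
Qed.

Lemma eq_cintegral F G : F =1 G -> cintegral mu F = cintegral mu G.
Proof. by move=> /funext ->. Qed.

Lemma cintegralD F G : cintegrable mu F -> cintegrable mu G ->
  cintegral mu (fun x => F x + G x)%R = (cintegral mu F + cintegral mu G)%R.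
Proof.
move=> [F1 F2] [G1 G2]; rewrite /cintegral; apply: complex_eqP => /=.
  by under eq_Rintegral do rewrite cReD; rewrite RintegralD.
by under eq_Rintegral do rewrite cImD; rewrite RintegralD.
Qed.

Lemma cintegrableD F G : cintegrable mu F -> cintegrable mu G ->
  cintegrable mu (fun x => F x + G x)%R.
Proof.
move=> [F1 F2] [G1 G2]; split.
  by under eq_fun do rewrite cReD EFinD; exact: integrableD.
by under eq_fun do rewrite cImD EFinD; exact: integrableD.
Qed.

Lemma cintegrableZ c F : cintegrable mu F -> cintegrable mu (fun x => c * F x)%R.
Proof.
move=> [F1 F2]; split.
  under eq_fun do rewrite cReM EFinB !EFinM.
  by apply: integrableB => //; exact: integrableZl.
under eq_fun do rewrite cImM EFinD !EFinM.
by apply: integrableD => //; exact: integrableZl.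
Qed.

Lemma cintegralZ c F : cintegrable mu F ->
  cintegral mu (fun x => c * F x)%R = (c * cintegral mu F)%R.
Proof.
move=> [F1 F2]; rewrite /cintegral; apply: complex_eqP => /=.
  under eq_Rintegral do rewrite cReM.
  rewrite RintegralB//=; last 2 first.
  - by apply: (integrableZl _ _ F1).
  - by apply: (integrableZl _ _ F2).
  by rewrite !RintegralZl// cReM.
under eq_Rintegral do rewrite cImM.
rewrite RintegralD//=; last 2 first.
- by apply: (integrableZl _ _ F2).
- by apply: (integrableZl _ _ F1).
by rewrite !RintegralZl// cImM.
Qed.

Lemma cintegralZr c F : cintegrable mu F ->
  cintegral mu (fun x => F x * c)%R = (cintegral mu F * c)%R.
Proof.
by move=> iF; rewrite mulrC -cintegralZ//; apply: eq_cintegral => x; rewrite mulrC.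
Qed.

Lemma cintegrable0 : cintegrable mu (fun=> 0%R).
Proof. by split; exact: integrable0. Qed.

Lemma cintegral0 : cintegral mu (fun=> 0%R) = 0%R.
Proof. by rewrite /cintegral /Rintegral /= !integral0. Qed.

Lemma cintegralN F : cintegrable mu F ->
  cintegral mu (fun x => - F x)%R = (- cintegral mu F)%R.
Proof.
move=> iF; rewrite -mulN1r -cintegralZ//.
by apply: eq_cintegral => x; rewrite mulN1r.
Qed.

Lemma cintegrableN F : cintegrable mu F -> cintegrable mu (fun x => - F x)%R.
Proof. by move=> /(cintegrableZ (-1)); under eq_fun do rewrite mulN1r. Qed.

Lemma cintegralB F G : cintegrable mu F -> cintegrable mu G ->
  cintegral mu (fun x => F x - G x)%R = (cintegral mu F - cintegral mu G)%R.
Proof.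
by move=> iF iG; rewrite cintegralD ?cintegralN//; exact: cintegrableN.
Qed.

Lemma cintegrableB F G : cintegrable mu F -> cintegrable mu G ->
  cintegrable mu (fun x => F x - G x)%R.
Proof. by move=> iF iG; exact/cintegrableD/cintegrableN. Qed.

Lemma cintegrable_sum (I : Type) (r : seq I) (F : I -> T -> R[i]) :
  (forall i, cintegrable mu (F i)) -> cintegrable mu (fun x => \sum_(i <- r) F i x)%R.
Proof.
move=> iF; elim: r => [|i r ih].
  by under eq_fun do rewrite big_nil; exact: cintegrable0.
by under eq_fun do rewrite big_cons; exact: cintegrableD.
Qed.

Lemma cintegral_sum (I : Type) (r : seq I) (F : I -> T -> R[i]) :
  (forall i, cintegrable mu (F i)) ->
  cintegral mu (fun x => \sum_(i <- r) F i x)%R = (\sum_(i <- r) cintegral mu (F i))%R.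
Proof.
move=> iF; elim: r => [|i r ih].
  by under eq_cintegral do rewrite big_nil; rewrite cintegral0 big_nil.
under eq_cintegral do rewrite big_cons.
by rewrite cintegralD// ?ih ?big_cons//; exact: cintegrable_sum.
Qed.

Lemma cintegral_conj F : cintegrable mu F ->
  cintegral mu (fun x => (F x)^*)%R = (cintegral mu F)^*%R.
Proof.
move=> [F1 F2]; rewrite /cintegral; apply: complex_eqP => /=.
  by under eq_Rintegral do rewrite cRe_conj.
under eq_Rintegral do rewrite cIm_conj -mulN1r.
by rewrite RintegralZl// mulN1r.
Qed.

(* Rotating the integral onto the positive axis reduces this to the bound by
   the integral of the real part. *)
Lemma le_normc_cintegral F : cintegrable mu F ->
  (normc (cintegral mu F))%:E <= \int[mu]_x (normc (F x))%:E.
Proof.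
move=> iF; have [mF Foo] := (cintegrableP F).1 iF.
set c := cintegral mu F.
have [c0|cn0] := eqVneq c 0%R.
  by rewrite c0 normc0; apply: integral_ge0 => x _; rewrite lee_fin normc_ge0.
pose t := (c^* / (normc c)%:C)%R.
have cpos : (0 < normc c)%R by rewrite normc_gt0.
have nt : normc t = 1%R.
  by rewrite normcM normcV normc_real normc_conj ger0_norm ?normc_ge0// divff// gt_eqF.
have tc : (t * c)%R = (normc c)%:C.
  rewrite /t mulrAC [(_^* * _)%R]mulrC mul_conjc rmorphXn expr2 mulfK//.
  by rewrite eq_complex/= eqxx andbT gt_eqF.
have := cintegralZ t iF; rewrite -/c tc => /(congr1 (@complex.Re R))/= tcE.
rewrite -tcE.
have [itF _] := cintegrableZ t iF.
rewrite /Rintegral/= fineK; last exact: integrable_fin_num.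
apply: le_integral => //.
  apply/integrableP; split; first exact: cmeasurable_normcE.
  by under eq_integral do rewrite /= ger0_norm ?normc_ge0//.
move=> x _; rewrite lee_fin (le_trans (ler_norm _))//.
by rewrite (le_trans (normr_Re_le _))// normcM nt mul1r.
Qed.

End complex_integrals.

(** * Fubini and Tonelli for complex-valued functions *)

Section complex_fubini.
Context d1 d2 (T1 : measurableType d1) (T2 : measurableType d2) (R : realType).
Variable m1 : {sigma_finite_measure set T1 -> \bar R}.
Variable m2 : {sigma_finite_measure set T2 -> \bar R}.
Implicit Types F : T1 * T2 -> R[i].
Local Open Scope ereal_scope.

Lemma cmeasurable_pair1 F (x : T1) : cmeasurable F -> cmeasurable (fun y => F (x, y)).
Proof.
move=> mF; apply: (@cmeasurable_comp _ _ _ _ _ _ (fun y => (x, y))) => //.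
exact: measurable_pair1.
Qed.

Lemma cmeasurable_pair2 F (y : T2) : cmeasurable F -> cmeasurable (fun x => F (x, y)).
Proof.
move=> mF; apply: (@cmeasurable_comp _ _ _ _ _ _ (fun x => (x, y))) => //.
Qed.

Lemma measurable_integral2 (f : T1 * T2 -> \bar R) : measurable_fun setT f ->
  (forall z, 0 <= f z) -> measurable_fun setT (fun x => \int[m2]_y f (x, y)).
Proof. by move=> mf f0; exact: (measurable_fun_fubini_tonelli_F f mf f0). Qed.

Lemma measurable_integral1 (f : T1 * T2 -> \bar R) : measurable_fun setT f ->
  (forall z, 0 <= f z) -> measurable_fun setT (fun y => \int[m1]_x f (x, y)).
Proof. by move=> mf f0; exact: (measurable_fun_fubini_tonelli_G f mf f0). Qed.

(** No integrability is assumed: the inner integral is the difference of the integrals of the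
    positive and negative parts, each measurable by Tonelli, and [fine] is measurable. *)
Let measurable_fine_integral (f : T1 * T2 -> R) :
  measurable_fun setT f ->
  measurable_fun setT (fun x => \int[m2]_y f (x, y))%R.
Proof.
move=> mf; apply: (measurableT_comp (@fine_measurable _ setT measurableT)).
have mEf : measurable_fun setT (EFin \o f) by exact/measurable_EFinP.
rewrite (_ : (fun x => _) = (fun x => \int[m2]_y (EFin \o f)^\+ (x, y)) \-
    (fun x => \int[m2]_y (EFin \o f)^\- (x, y))); last first.
  apply/funext => x; rewrite integralE; congr (_ - _);
    by apply: eq_integral => y _; rewrite !(funeposE, funenegE).
apply: emeasurable_funB.
  apply: (@measurable_integral2 (EFin \o f)^\+) => //.
  exact: measurable_funepos.
apply: (@measurable_integral2 (EFin \o f)^\-) => //.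
exact: measurable_funeneg.
Qed.

Lemma cmeasurable_cintegral F : cmeasurable F ->
  cmeasurable (fun x => cintegral m2 (fun y => F (x, y))).
Proof.
move=> [F1 F2]; split.
  exact: (measurable_fine_integral (f := fun z => complex.Re (F z))).
exact: (measurable_fine_integral (f := fun z => complex.Im (F z))).
Qed.

(** Inner integrals in Fubini may be infinite on a null set, where [fine] replaces them by 0; this
    changes neither integrability nor the integral. *)
Let integrable_fine d (T : measurableType d) (m : {measure set T -> \bar R})
    (f : T -> \bar R) : m.-integrable setT f ->
  m.-integrable setT (fun x => (fine (f x))%:E) /\
  \int[m]_x (fine (f x))%:E = \int[m]_x f x.
Proof.
move=> intf; have mf := measurable_int _ intf.
have mff : measurable_fun setT (fun x => (fine (f x))%:E).
  by apply/measurable_EFinP; apply: measurableT_comp => //; exact: fine_measurable.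
split.
  apply: le_integrable intf => // x _.
  by case: (f x) => [r| |]//=; rewrite normr0// leey.
apply: ae_eq_integral => //.
apply: filterS (integrable_ae measurableT intf) => x /= + _ => /(_ I).
by move=> ?; rewrite fineK.
Qed.

Let integrable_fubini (f : T1 * T2 -> R) :
  (m1 \x m2).-integrable setT (EFin \o f) ->
  m1.-integrable setT (fun x => (\int[m2]_y f (x, y))%R%:E) /\
  (\int[m1]_x \int[m2]_y f (x, y) = \int[m1 \x m2]_z f z)%R.
Proof.
move=> intf; have [h1 h2] := integrable_fine (integrable_fubini_F intf).
by split=> //; rewrite /Rintegral -integral12_prod_meas1//= h2.
Qed.

(** For this order of integration the marginal is shown integrable directly, by Tonelli applied to
    the absolute value of [f]. *)
Let integrable_fubini2 (f : T1 * T2 -> R) :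
  (m1 \x m2).-integrable setT (EFin \o f) ->
  m2.-integrable setT (fun y => (\int[m1]_x f (x, y))%R%:E) /\
  (\int[m2]_y \int[m1]_x f (x, y) = \int[m1 \x m2]_z f z)%R.
Proof.
move=> intf.
have iG : m2.-integrable setT (fubini_G m1 (EFin \o f)).
  apply/integrableP; split; first exact: (measurable_fubini_G intf).
  have [mf foo] := integrableP _ _ _ intf; apply: le_lt_trans foo.
  have mnf : measurable_fun setT (abse \o (EFin \o f)) by exact: measurableT_comp.
  have nf0 z : 0 <= (abse \o (EFin \o f)) z by exact: abse_ge0.
  rewrite (fubini_tonelli2 (abse \o (EFin \o f)))//.
  apply: ge0_le_integral => //.
  - by apply: measurableT_comp => //; exact: (measurable_fubini_G intf).
  - by apply: (@measurable_integral1 (abse \o (EFin \o f))).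
  - move=> y _; apply: le_abse_integral => //; exact: measurableT_comp.
have [h1 h2] := integrable_fine iG.
by split=> //; rewrite /Rintegral -integral21_prod_meas1//= h2.
Qed.

Lemma cintegrable_fubini1 F : cintegrable (m1 \x m2) F ->
  cintegrable m1 (fun x => cintegral m2 (fun y => F (x, y))).
Proof.
by move=> [F1 F2]; split; [exact: (integrable_fubini F1).1|exact: (integrable_fubini F2).1].
Qed.

Lemma cintegral_fubini1 F : cintegrable (m1 \x m2) F ->
  cintegral m1 (fun x => cintegral m2 (fun y => F (x, y))) = cintegral (m1 \x m2) F.
Proof.
move=> [F1 F2]; rewrite /cintegral/=.
by rewrite (integrable_fubini F1).2 (integrable_fubini F2).2.
Qed.

Lemma cintegral_fubini2 F : cintegrable (m1 \x m2) F ->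
  cintegral m2 (fun y => cintegral m1 (fun x => F (x, y))) = cintegral (m1 \x m2) F.
Proof.
move=> [F1 F2]; rewrite /cintegral/=.
by rewrite (integrable_fubini2 F1).2 (integrable_fubini2 F2).2.
Qed.

Lemma cintegrable_prod F : cmeasurable F ->
  \int[m1]_x \int[m2]_y (normc (F (x, y)))%:E < +oo -> cintegrable (m1 \x m2) F.
Proof.
move=> mF Foo; apply/cintegrableP; split=> //.
rewrite fubini_tonelli1//; first exact: cmeasurable_normcE.
by move=> x; rewrite lee_fin normc_ge0.
Qed.

End complex_fubini.

(** * Dominated convergence for complex-valued functions *)

Section complex_dominated_convergence.
Context d (T : measurableType d) (R : realType) (mu : {measure set T -> \bar R}).

Lemma cintegral_dominated (F_ : nat -> T -> R[i]) (F : T -> R[i]) (h : T -> R) :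
  (forall k, cmeasurable (F_ k)) -> cmeasurable F ->
  (forall x, (fun k => normc (F_ k x - F x)) @ \oo --> (0 : R)) ->
  mu.-integrable setT (EFin \o h) ->
  (forall k x, normc (F_ k x) <= h x) ->
  cintegrable mu F /\
  (fun k => normc (cintegral mu (F_ k) - cintegral mu F)) @ \oo --> (0 : R).
Proof.
move=> mF_ mF cF ih Fh.
have iF_ k : cintegrable mu (F_ k).
  apply: (cintegrable_le (h := EFin \o h)) => //.
  - exact: measurable_int ih.
  - by move=> x; rewrite /= lee_fin.
  - exact: integrable_lty.
(* Here and in [domF], [f] stands for the real or the imaginary part: only compatibility with
   subtraction and the bound by the modulus matter. *)
have cvgF x (f : R[i] -> R) : (forall z w, f (z - w) = f z - f w)%R ->
    (forall z, `|f z| <= normc z)%R ->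
    (fun k => (f (F_ k x))%:E) @ \oo --> (f (F x))%:E.
  move=> fB fn; apply: cvg_EFin; first by near=> k.
  apply/cvgrPdist_le => e e0.
  have /cvgrPdist_le /(_ _ e0) := cF x; apply: filterS => k.
  rewrite sub0r normrN ger0_norm ?normc_ge0// => /(le_trans _); apply.
  by rewrite -fB normcB fn.
have domF (f : R[i] -> R) : (forall z w, f (z - w) = f z - f w)%R ->
    (forall z, `|f z| <= normc z)%R ->
    (forall k, measurable_fun setT (fun x => f (F_ k x))) ->
    measurable_fun setT (fun x => f (F x)) ->
    mu.-integrable setT (fun x => (f (F x))%:E) /\
    [sequence (\int[mu]_x `|(f (F_ k x))%:E - (f (F x))%:E|)%E]_k @ \oo --> (0 : \bar R).
  move=> fB fn mf_ mf.
  have [] := @dominated_convergence _ _ _ mu setT measurableT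
    (fun k x => (f (F_ k x))%:E) (fun x => (f (F x))%:E) (EFin \o h).
  - by move=> k; exact/measurable_EFinP.
  - exact/measurable_EFinP.
  - by apply: aeW => x _; exact: cvgF.
  - exact: ih.
  - by apply: aeW => x k _ /=; rewrite lee_fin (le_trans (fn _)).
  by [].
have [iR cR] := domF (@complex.Re R) (fun z w => etrans (cReD _ _) (congr1 _ (cReN _)))
  (@normr_Re_le R) (fun k => (mF_ k).1) mF.1.
have [iI cI] := domF (@complex.Im R) (fun z w => etrans (cImD _ _) (congr1 _ (cImN _)))
  (@normr_Im_le R) (fun k => (mF_ k).2) mF.2.
have iF : cintegrable mu F by split.
split => //.
have : (fun k => \int[mu]_x `|(complex.Re (F_ k x))%:E - (complex.Re (F x))%:E| +
   \int[mu]_x `|(complex.Im (F_ k x))%:E - (complex.Im (F x))%:E|)%E @ \oo -->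
   (0 + 0 : \bar R)%E.
  exact: cvgeD.
rewrite adde0 => /fine_cvgP [_] /cvgrPdist_le cv.
apply/cvgrPdist_le => e e0.
near=> k.
have : `|0 - fine (\int[mu]_x `|(complex.Re (F_ k x))%:E - (complex.Re (F x))%:E| +
   \int[mu]_x `|(complex.Im (F_ k x))%:E - (complex.Im (F x))%:E|)%E| <= e.
  by near: k; exact: cv.
rewrite !sub0r !normrN (ger0_norm (normc_ge0 _)); apply: le_trans.
rewrite -cintegralB// -lee_fin.
have [iR' iI'] := cintegrableB (iF_ k) iF.
rewrite (le_trans (le_normc_cintegral (cintegrableB (iF_ k) iF)))//.
have fR : (\int[mu]_x `|(complex.Re (F_ k x))%:E - (complex.Re (F x))%:E|)%E \is a fin_num.
  apply: integrable_fin_num => //.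
  by apply: integrable_abse; apply: integrableB => //; case: (iF_ k).
have fI : (\int[mu]_x `|(complex.Im (F_ k x))%:E - (complex.Im (F x))%:E|)%E \is a fin_num.
  apply: integrable_fin_num => //.
  by apply: integrable_abse; apply: integrableB => //; case: (iF_ k).
rewrite ger0_norm; last by rewrite fine_ge0// adde_ge0// integral_ge0.
rewrite fineK; last by rewrite fin_numD fR fI.
rewrite -ge0_integralD//; last 2 first.
- apply: measurableT_comp => //; apply/emeasurable_funB; apply/measurable_EFinP;
  [exact: (mF_ k).1|exact: mF.1].
- apply: measurableT_comp => //; apply/emeasurable_funB; apply/measurable_EFinP;
  [exact: (mF_ k).2|exact: mF.2].
apply: ge0_le_integral => //.
- by move=> x _; rewrite lee_fin normc_ge0.
- by have /cintegrableP[/cmeasurable_normcE] := cintegrableB (iF_ k) iF.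
- apply: emeasurable_funD; (apply: measurableT_comp => //;
  apply/emeasurable_funB; apply/measurable_EFinP);
  [exact: (mF_ k).1|exact: mF.1|exact: (mF_ k).2|exact: mF.2].
- move=> x _ /=; rewrite lee_fin (le_trans (normc_le_ReIm _))//.
  by rewrite cReD cReN cImD cImN.
Unshelve. all: by end_near. Qed.

End complex_dominated_convergence.

(** * Sums over the lattice *)

Section counting_lattice.
Context (R : realType) (n : nat).
Implicit Types (k m : Zn n) (f : Zn n -> \bar R).
Local Notation cnt := (@countZ R n).

Lemma measurable_fun_Zn d (T : measurableType d) (D : set (Zn n)) (f : Zn n -> T) :
  measurable_fun D f.
Proof. by []. Qed.

Lemma cmeasurable_Zn (F : Zn n -> R[i]) : cmeasurable F.
Proof. by []. Qed.

(** The lattice is countable, so a preimage is a countable union of slices, indexed through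
    [pickle]; joint measurability reduces to the fibers. *)
Lemma measurable_Zn_prod d d' (T : measurableType d) (T' : measurableType d')
    (f : Zn n * T -> T') :
  (forall k, measurable_fun setT (fun x => f (k, x))) -> measurable_fun setT f.
Proof.
move=> mf _ Y mY; rewrite setTI.
rewrite (_ : _ @^-1` _ = \bigcup_i
   (if unpickle i is Some k then [set k] `*` ((fun x => f (k, x)) @^-1` Y) else set0)).
  apply: bigcup_measurable => i _; case: unpickle => [k|//].
  by apply: measurableX => //; rewrite -[X in measurable X]setTI; exact: mf.
apply/seteqP; split=> [[k x] Yf|[k x] [i _]].
  by exists (pickle k) => //; rewrite pickleK.
by case: unpickle => // k' [/= -> ].
Qed.

Lemma cmeasurable_Zn_prod d (T : measurableType d) (F : Zn n * T -> R[i]) :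
  (forall k, cmeasurable (fun x => F (k, x))) -> cmeasurable F.
Proof. by move=> mF; split; apply: measurable_Zn_prod => k; case: (mF k). Qed.

Lemma countZ1 k : cnt [set k] = 1%E.
Proof. by rewrite /cnt /counting asboolT// fset_set1 finmap.cardfs1. Qed.

Local Open Scope ereal_scope.

Lemma integral_countZ1 f k : \int[cnt]_(x in [set k]) f x = f k.
Proof.
rewrite (eq_integral (cst (f k))); last by move=> x /[!inE] ->.
by rewrite integral_cst//= countZ1 mule1.
Qed.

Lemma integral_countZ_single f k : (forall x, x != k -> f x = 0) ->
  \int[cnt]_x f x = f k.
Proof.
move=> f0; rewrite -(integral_countZ1 f k) [RHS]integral_mkcond.
apply: eq_integral => x _; rewrite patchE; case: ifPn => //.
by rewrite notin_setE => /= /eqP /f0.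
Qed.

Lemma ge0_integral_countZ_ge f k : (forall x, 0 <= f x) -> f k <= \int[cnt]_x f x.
Proof.
by move=> f0; rewrite -(integral_countZ1 f k); apply: ge0_subset_integral.
Qed.

Lemma cintegral_countZ_single (F : Zn n -> R[i]) k :
  (forall x, x != k -> F x = 0%R) -> cintegral cnt F = F k.
Proof.
move=> F0; rewrite /cintegral /Rintegral.
rewrite (@integral_countZ_single (fun x => (complex.Re (F x))%:E) k); last first.
  by move=> x /F0 ->.
rewrite (@integral_countZ_single (fun x => (complex.Im (F x))%:E) k); last first.
  by move=> x /F0 ->.
by case: (F k).
Qed.

Let counting_bij (h g : Zn n -> Zn n) (A : set (Zn n)) :
  cancel h g -> cancel g h -> cnt (h @^-1` A) = cnt A.
Proof.
move=> hg gh.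
have hA : h @^-1` A = g @` A.
  apply/seteqP; split=> [x Ax|_ [x Ax <-]]; last by rewrite /= gh.
  by exists (h x) => //; rewrite hg.
rewrite /cnt /counting hA.
have [finA|infA] := pselect (finite_set A).
  rewrite !asboolT//; last exact: finite_image.
  rewrite fset_set_image// finmap.card_imfset//=; exact: can_inj gh.
rewrite !asboolF// => fin; apply: infA.
have -> : A = h @` (g @` A).
  by apply/seteqP; split=> [x Ax|_ [_ [x Ax <-] <-]];
    [exists (g x); rewrite ?gh//; exists x|rewrite gh].
exact: finite_image.
Qed.

Lemma ge0_integral_countZ_bij f (h g : Zn n -> Zn n) :
  cancel h g -> cancel g h -> (forall x, 0 <= f x) ->
  \int[cnt]_x f (h x) = \int[cnt]_x f x.
Proof.
move=> hg gh f0.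
have mh : measurable_fun [set: Zn n] h by [].
rewrite -[LHS]/(\int[cnt]_(x in h @^-1` setT) (f \o h) x).
rewrite -(ge0_integral_pushforward mh)//.
by apply: eq_measure_integral => A mA _; exact: counting_bij hg gh.
Qed.

Lemma integral_countZ_bij f (h g : Zn n -> Zn n) :
  cancel h g -> cancel g h -> \int[cnt]_x f (h x) = \int[cnt]_x f x.
Proof.
move=> hg gh; rewrite integralE [RHS]integralE; congr (_ - _).
  rewrite -[RHS](ge0_integral_countZ_bij hg gh)//.
  by apply: eq_integral => x _; rewrite !funeposE.
rewrite -[RHS](ge0_integral_countZ_bij hg gh)//.
by apply: eq_integral => x _; rewrite !funenegE.
Qed.

Lemma integral_countZ_shift f m : \int[cnt]_x f (x + m)%R = \int[cnt]_x f x.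
Proof.
by apply: (@integral_countZ_bij f (fun x => x + m) (fun x => x - m))%R => x; rewrite ?addrK ?subrK.
Qed.

Lemma integral_countZ_reflect f m : \int[cnt]_x f (m - x)%R = \int[cnt]_x f x.
Proof.
by apply: (@integral_countZ_bij f (fun x => m - x) (fun x => m - x))%R => x; rewrite subKr.
Qed.

Lemma cintegral_countZ_shift (F : Zn n -> R[i]) m :
  cintegral cnt (fun x => F (x + m)%R) = cintegral cnt F.
Proof.
rewrite /cintegral /Rintegral.
by rewrite (integral_countZ_shift (fun x => (complex.Re (F x))%:E))
  (integral_countZ_shift (fun x => (complex.Im (F x))%:E)).
Qed.

End counting_lattice.

Section lattice_box.
Context (R : realType) (n : nat).
Implicit Types (k m : Zn n) (f : Zn n -> \bar R) (r : nat).
Local Notation cnt := (@countZ R n).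

(** Parametrizes the cube [[-r, r]^n] by finite functions, so that sums over it of products over
    coordinates can be factored. *)
Definition boxpt r (a : {ffun 'I_n -> 'I_(r.*2.+1)}) : Zn n :=
  \row_i ((a i)%:Z - r%:Z).

Definition inbox r k : bool := [forall i, `|k ord0 i|%N <= r]%N.

Lemma boxpt_inj r : injective (@boxpt r).
Proof.
move=> a b ab; apply/ffunP => i; apply/val_inj/eqP.
have /rowP/(_ i) := ab; rewrite !mxE => /(congr1 (fun z => z + r%:Z)).
by rewrite !subrK => /eqP; rewrite eqz_nat.
Qed.

Lemma inbox_boxpt r a : inbox r (@boxpt r a).
Proof.
apply/forallP => i; rewrite mxE; have := ltn_ord (a i).
by move: (nat_of_ord _) => c; rewrite -addnn; lia.
Qed.

Lemma inboxP r k : inbox r k -> exists a, k = @boxpt r a.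
Proof.
move=> /forallP kr.
exists [ffun i => inord (absz (k ord0 i + r%:Z))].
apply/rowP => i; rewrite mxE ffunE; have := kr i; move: (k ord0 i) => z zr.
by rewrite inordK; [lia|rewrite -addnn; lia].
Qed.

Lemma inbox_mono r r' k : (r <= r')%N -> inbox r k -> inbox r' k.
Proof. by move=> rr' /forallP kr; apply/forallP => i; exact: leq_trans rr'. Qed.

Lemma inbox_exists k : exists r, inbox r k.
Proof.
exists (\sum_i `|k ord0 i|)%N; apply/forallP => i.
by rewrite (bigD1 i)//= leq_addr.
Qed.

Lemma zabs_ge0 k : 0 <= zabs R k.
Proof. by apply: sumr_ge0 => i _. Qed.

Lemma zabs_coord k i : `|(k ord0 i)%:~R| <= zabs R k.
Proof. by rewrite /zabs (bigD1 i)//= lerDl sumr_ge0. Qed.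

Lemma inbox_zabs r k : ~~ inbox r k -> r%:R <= zabs R k.
Proof.
apply: contraNT; rewrite -ltNge => kr; apply/forallP => i; rewrite leqNgt.
apply: contraTN kr => ri; rewrite -leNgt.
apply: le_trans (zabs_coord k i); rewrite -intr_norm.
by rewrite -[r%:R]/(r%:~R) ler_int; lia.
Qed.

Lemma zabsD k m : zabs R (k + m) <= zabs R k + zabs R m.
Proof.
rewrite /zabs -big_split/=; apply: ler_sum => i _.
by rewrite mxE intrD ler_normD.
Qed.

Local Open Scope ereal_scope.

Lemma ge0_integral_inbox r f : (forall x, 0 <= f x) ->
  \int[cnt]_(k in [set k | inbox r k]) f k =
    \sum_(a : {ffun 'I_n -> 'I_(r.*2.+1)}) f (boxpt a).
Proof.
move=> f0; rewrite integral_mkcond.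
under eq_bigr do rewrite -(integral_countZ1 f) integral_mkcond.
rewrite -ge0_integral_sum//; last first.
  by move=> a k _; exact: erestrict_ge0.
apply: eq_integral => k _; rewrite patchE; case: ifPn => [/[!inE]/=|].
  move=> /inboxP[a ->]; rewrite (bigD1 a)//= patchE mem_set// big1 ?adde0// => b ba.
  rewrite patchE memNset//= => /boxpt_inj /esym/eqP.
  by rewrite (negbTE ba).
rewrite notin_setE/= => /negP kr.
rewrite big1// => b _; rewrite patchE memNset//= => kb.
by rewrite kb inbox_boxpt in kr.
Qed.

(** The boxes increase to the whole lattice, so monotone convergence passes a uniform bound on
    finite sums to the full sum. *)
Lemma ge0_integral_countZ_le f S : (forall x, 0 <= f x) ->
  (forall r, \sum_(a : {ffun 'I_n -> 'I_(r.*2.+1)}) f (boxpt a) <= S) ->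
  \int[cnt]_k f k <= S.
Proof.
move=> f0 fS.
have TE : [set: Zn n] = \bigcup_r [set k | inbox r k].
  by apply/seteqP; split=> // k _; have [r kr] := inbox_exists k; exists r.
rewrite [X in integral _ X _]TE.
have cv : \int[cnt]_(k in [set k | inbox r k]) f k @[r --> \oo] -->
    \int[cnt]_(k in \bigcup_r [set k | inbox r k]) f k.
  apply: ge0_nondecreasing_set_cvg_integral => //.
  by move=> r r' rr'; apply/subsetPset => k; exact: inbox_mono.
rewrite -(cvg_lim _ cv)//; apply: lime_le; first exact: cvgP cv.
by near=> r; rewrite ge0_integral_inbox.
Unshelve. all: by end_near. Qed.

Lemma ge0_sum_le_countZ (I : finType) (h : I -> Zn n) f : injective h ->
  (forall x, 0 <= f x) -> \sum_i f (h i) <= \int[cnt]_k f k.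
Proof.
move=> hinj f0.
under eq_bigr do rewrite -(integral_countZ1 f) integral_mkcond.
rewrite -ge0_integral_sum//; last first.
  by move=> a k _; exact: erestrict_ge0.
apply: ge0_le_integral => //.
- by move=> k _; apply: sume_ge0 => i _; exact: erestrict_ge0.
- move=> k _; have [[i ->]|nk] := pselect (exists i, k = h i).
    rewrite (bigD1 i)//= patchE mem_set// big1 ?adde0// => b bi.
    by rewrite patchE memNset//= => /hinj/esym/eqP; rewrite (negbTE bi).
  by rewrite big1// => i _; rewrite patchE memNset// => ki; apply: nk; exists i.
Qed.

End lattice_box.

Section lattice_weight.
Context (R : realType).

(** The subtracted term makes the induction telescope: going from [r] to [r + 1] adds 2/(r+2)^2 on
    the left, while the right side grows by 2/((r+1)(r+2)). *)
Let sum_inv_square r :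
  \sum_(c < r.*2.+1) ((1 + `|(c%:Z - r%:Z)%:~R| : R) ^+ 2)^-1 <= 4 - 2 / r.+1%:R.
Proof.
elim: r => [|r ih].
  by rewrite big_ord_recl big_ord0 /= subrr normr0 !addr0 expr1n; lra.
rewrite doubleS big_ord_recl big_ord_recr/=.
have -> : \sum_(i < r.*2.+1) ((1 + `|((bump 0 i)%:Z - r.+1%:Z)%:~R| : R) ^+ 2)^-1 =
   \sum_(c < r.*2.+1) ((1 + `|(c%:Z - r%:Z)%:~R| : R) ^+ 2)^-1.
  by apply: eq_bigr => c _; rewrite /bump leq0n add1n; do 5 f_equal; lia.
have -> : `|((0%N)%:Z - r.+1%:Z)%:~R| = r.+1%:R :> R.
  by rewrite sub0r intrN normrN normr_nat.
have -> : `|((bump 0 r.*2.+1)%:Z - r.+1%:Z)%:~R| = r.+1%:R :> R.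
  rewrite /bump leq0n add1n (_ : _ - _ = r.+1%:Z)%R ?normr_nat//.
  by rewrite -addnn; lia.
rewrite addrA addrAC -[leRHS](subrK (4 - 2 / r.+1%:R)) lerD//.
have r1 : (0 : R) < r.+1%:R by rewrite ltr0n.
rewrite (natrD _ 1 r.+1 : r.+2%:R = 1 + r.+1%:R :> R).
move: (r.+1%:R : R) r1 => x x0.
have -> : 4 - 2 / (1 + x) - (4 - 2 / x) = 2 / (x * (1 + x)).
  by field; rewrite !gt_eqF//; lra.
rewrite -mulr2n -[leLHS]mulr_natl ler_pM2l// lef_pV2 ?posrE; [|nra|nra].
by nra.
Qed.

(** Each factor [1 + zabs R k] is at least 1 + |k_i|, so over a box the sum is at most the n-th
    power of a one-dimensional sum, which [sum_inv_square] keeps below 4. *)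
Lemma integral_weight_le n :
  (\int[@countZ R n]_k (((1 + zabs R k) ^+ (2 * n))^-1)%:E <= (4 ^+ n)%:E)%E.
Proof.
apply: ge0_integral_countZ_le => [k|r].
  by rewrite lee_fin invr_ge0 exprn_ge0// addr_ge0// zabs_ge0.
rewrite sumEFin lee_fin.
pose w (c : 'I_(r.*2.+1)) : R := ((1 + `|(c%:Z - r%:Z)%:~R| : R) ^+ 2)^-1.
apply: (@le_trans _ _ (\sum_(a : {ffun 'I_n -> 'I_(r.*2.+1)}) \prod_(i < n) w (a i))).
  apply: ler_sum => a _; rewrite prodfV lef_pV2 ?posrE; last 2 first.
  - by rewrite exprn_gt0// ltr_wpDr// zabs_ge0.
  - by apply: prodr_gt0 => i _; rewrite exprn_gt0// ltr_wpDr.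
  rewrite exprM (_ : _ ^+ n = \prod_(i < n) (1 + zabs R (boxpt a)) ^+ 2); last first.
    by rewrite prodr_const card_ord.
  apply: ler_prod => i _; rewrite exprn_ge0 ?addr_ge0//=.
  rewrite lerXn2r ?nnegrE ?addr_ge0 ?zabs_ge0// lerD2l.
  by have := zabs_coord R (boxpt a) i; rewrite mxE.
rewrite -(bigA_distr_bigA (fun _ : 'I_n => w)) prodr_const card_ord.
rewrite lerXn2r ?nnegrE//; last first.
  by apply: le_trans (sum_inv_square r) _; rewrite gerBl divr_ge0.
by apply: sumr_ge0 => c _; rewrite invr_ge0 exprn_ge0// addr_ge0.
Qed.

(* Taking the exponent [2 * n] makes the weight dominate the product of the
   one-dimensional weights. *)
Lemma integrable_of_decay n (F : Zn n -> R[i]) (M : R) :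
  (forall k, (1 + zabs R k) ^+ (2 * n) * normc (F k) <= M) ->
  (\int[@countZ R n]_k (normc (F k))%:E <= (M * 4 ^+ n)%:E)%E.
Proof.
move=> FM.
have w0 k : 0 < (1 + zabs R k) ^+ (2 * n) by rewrite exprn_gt0// ltr_wpDr// zabs_ge0.
have M0 : 0 <= M by apply: le_trans (FM 0); rewrite mulr_ge0 ?normc_ge0// ltW.
apply: (@le_trans _ _ (M%:E * \int[@countZ R n]_k (((1 + zabs R k) ^+ (2 * n))^-1)%:E)%E).
  rewrite -ge0_integralZl//; last by move=> k _; rewrite lee_fin invr_ge0 ltW.
  apply: ge0_le_integral => //.
  - by move=> k _; rewrite lee_fin normc_ge0.
  - by move=> k _; rewrite -EFinM lee_fin ler_pdivlMr// mulrC.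
by rewrite EFinM lee_wpmul2l// integral_weight_le.
Qed.

End lattice_weight.

(** * Translation invariance on the torus *)

Section translation_line.
Variable R : realType.
Local Notation mu := (@lebesgue_measure R).
Local Notation RR := (measurableTypeR R).

Let measurable_shift (a : R) : measurable_fun [set: RR] (fun x : RR => x + a : RR).
Proof. by apply: measurable_funD => //; exact: measurable_cst. Qed.

Let shift_lebesgue (a : R) (A : set RR) : measurable A ->
  mu A = pushforward mu (fun x : RR => x + a : RR) A.
Proof.
apply: lebesgue_measure_unique => X [[u v] /= _ <-].
rewrite /pushforward (_ : _ @^-1` _ = `]u - a, v - a]%classic); last first.
  by apply/seteqP; split=> x /=; rewrite !in_itv/= ltrBlDr lerBrDr.
rewrite !lebesgue_measure_itv/= !lte_fin ltrD2r; case: ifPn => // _.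
by rewrite -!EFinD; congr (_%:E); lra.
Qed.

Lemma ge0_integral_lebesgue_shift (f : RR -> \bar R) (a u v : R) :
  measurable_fun setT f -> (forall x, 0 <= f x)%E ->
  (\int[mu]_(x in `]u, v]) f (x + a)%R = \int[mu]_(x in `](u + a)%R, (v + a)%R]) f x)%E.
Proof.
move=> mf f0.
rewrite [RHS](eq_measure_integral (pushforward mu (fun x : RR => (x + a)%R : RR))); last first.
  by move=> A mA _; exact: shift_lebesgue.
rewrite (ge0_integral_pushforward (measurable_shift a))//; last first.
  exact: measurable_funTS.
rewrite [X in (_ = integral _ X _)%E](_ : _ = `]u, v]%classic)//.
by apply/seteqP; split=> x /=; rewrite !in_itv/= ltrD2r lerD2r.
Qed.

Lemma periodic_int (T : Type) (f : R -> T) (z : int) x :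
  (forall x, f (x + 1) = f x) -> f (x + z%:~R) = f x.
Proof.
move=> pf; have pn k y : f (y + k%:R) = f y.
  by elim: k y => [|k ih] y; rewrite ?addr0// -natr1 addrA pf ih.
case: z => k; first exact: pn.
by rewrite NegzE mulrNz -[LHS](pn k.+1) -pmulrn subrK.
Qed.

(** Dropping the null endpoint 0 gives half-open intervals, which can be cut and reassembled without
    overlap. *)
Let uniform01E (f : RR -> \bar R) : measurable_fun setT f -> (forall x, 0 <= f x)%E ->
  (\int[uniform_prob (@ltr01 R)]_x f x = \int[mu]_(x in `]0%R, 1%R]) f x)%E.
Proof.
move=> mf f0; rewrite integral_uniform// subr0 invr1 mul1e integral_itv_obnd_cbnd//.
exact: measurable_funTS.
Qed.

Lemma ge0_integral_uniform01_shift (f : RR -> \bar R) (a : R) :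
  measurable_fun setT f -> (forall x, 0 <= f x)%E -> (forall x, f (x + 1)%R = f x) ->
  (\int[uniform_prob (@ltr01 R)]_x f (x + a)%R =
   \int[uniform_prob (@ltr01 R)]_x f x)%E.
Proof.
move=> mf f0 pf.
(* Periodicity absorbs the integer part of [a]. *)
wlog /andP[a0 a1] : a / 0 <= a < 1.
  move=> h; have [lea lta] := (floor_le_tmp a, floorD1_gt a).
  rewrite -(h (a - (Num.floor a)%:~R)); last first.
    by rewrite subr_ge0 lea/= ltrBlDl -[X in _ < _ + X]/(1%:~R) -intrD.
  apply: eq_integral => x _.
  by rewrite -[x + a in LHS](subrK (Num.floor a)%:~R) periodic_int// addrA.
rewrite !uniform01E//; last first.
  exact: (measurableT_comp mf (measurable_shift a)).
rewrite ge0_integral_lebesgue_shift// add0r.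
(* The translated period is cut at 1; its part beyond 1, moved back by one period, is the missing
   piece []0, a]]. *)
have -> : `]a, (1 + a)%R]%classic = `]a, 1] `|` `]1, (1 + a)%R]%classic.
  by rewrite -itv_bndbnd_setU// bnd_simp; lra.
have -> : `]0 : R, 1]%classic = `]0, a] `|` `]a, 1]%classic.
  by rewrite -itv_bndbnd_setU// bnd_simp; lra.
rewrite !ge0_integral_setU//=; last 4 first.
- exact: measurable_funTS.
- by apply/disj_setPLR => x /=; rewrite !in_itv/= => /andP[? ?] /andP[? ?]; lra.
- exact: measurable_funTS.
- by apply/disj_setPLR => x /=; rewrite !in_itv/= => /andP[? ?] /andP[? ?]; lra.
rewrite addeC; congr (_ + _)%E.
have -> : `]1 : R, 1 + a]%classic = `]0 + 1, a + 1]%classic by rewrite add0r addrC.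
rewrite -ge0_integral_lebesgue_shift//.
by apply: eq_integral => x _; rewrite pf.
Qed.

End translation_line.

(** The condition [periodic] with an arbitrary codomain, so that it also covers extended real
    integrands. *)
Definition periodicT (R : realType) (n : nat) (T : Type) (h : Rn R n -> T) :=
  forall (i : 'I_n) w, h (w + Rn_e R i) = h w.

Section torus_measurability.
Context (R : realType).

Lemma measurable_fun_Rn n d (T : measurableType d) (f : T -> Rn R n) :
  (forall i, measurable_fun setT (fun x => f x ord0 i)) -> measurable_fun setT f.
Proof.
(* The argument for positive dimension picks coordinates with [inord], which needs an index to
   exist; in dimension 0 the space is one point. *)
case: n f => [|n] f mf.
  move=> _ Y mY; rewrite setTI.
  have [Y0|Y0] := pselect (Y 0).
    rewrite (_ : _ @^-1` _ = setT)//; apply/seteqP; split=> // x _ /=.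
    by rewrite (_ : f x = 0)//; apply/rowP => -[].
  rewrite (_ : _ @^-1` _ = set0)//; apply/seteqP; split=> // x /=.
  by rewrite (_ : f x = 0)//; apply/rowP => -[].
have : g_sigma_preimage (fun i : 'I_n.+1 => @Rn_coord R n.+1 i \o f) `<=` measurable.
  apply: smallest_sub; first exact: sigma_algebra_measurable.
  rewrite -bigcup_mkord_ord; apply: bigcup_sub => i Ii A [B mB <-].
  have mfi : measurable_fun setT (@Rn_coord R n.+1 (inord i) \o f) by exact: mf.
  exact: mfi.
by rewrite g_sigma_preimage_comp => sub _ A mA; apply: sub; exists A.
Qed.

Lemma measurable_Rn_translate n (a : Rn R n) :
  measurable_fun [set: Rn R n] (fun w => w + a).
Proof.
apply: measurable_fun_Rn => i; under eq_fun do rewrite mxE.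
by apply: measurable_funD => //; exact: measurable_Rn_coord.
Qed.

End torus_measurability.

Section translation_torus.
Context (R : realType).
Local Open Scope ereal_scope.

Lemma ge0_integral_haar_recl n (h : Rn R n.+1 -> \bar R) :
  measurable_fun setT h -> (forall w, 0 <= h w) ->
  \int[haar R n.+1]_w h w =
  \int[haar R n]_w \int[uniform_prob (@ltr01 R)]_x h (Rn_cons (x, w)).
Proof.
move=> mh h0 /=.
rewrite ge0_integral_distribution//.
rewrite (fubini_tonelli2 (h \o @Rn_cons R n) (measurableT_comp mh (@measurable_Rn_cons R n)))//.
by move=> z; exact: h0.
Qed.

Lemma Rn_consD n (x : measurableTypeR R) (w : Rn R n) (a : Rn R n.+1) :
  (Rn_cons (x, w) + a)%R =
  Rn_cons (x + a ord0 ord0, w + \row_j a ord0 (lift ord0 j))%R.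
Proof.
apply/rowP => i; rewrite !mxE/=; case: unliftP => [j ->|->] /=; by rewrite ?mxE.
Qed.

(** Induction on the dimension: the first coordinate is translated inside the circle integral, the
    others by the induction hypothesis applied to that integral as a function. Periodicity is
    essential, since [haar] is carried by one cube of representatives. *)
Lemma ge0_integral_haar_translate n (h : Rn R n -> \bar R) (a : Rn R n) :
  measurable_fun setT h -> (forall w, 0 <= h w) -> periodicT h ->
  \int[haar R n]_w h (w + a)%R = \int[haar R n]_w h w.
Proof.
elim: n h a => [|n ih] h a mh h0 ph.
  by apply: eq_integral => w _; congr h; apply/rowP => -[].
have mha : measurable_fun setT (fun w : Rn R n.+1 => h (w + a)%R).
  by apply: measurableT_comp => //; exact: measurable_Rn_translate.
rewrite !ge0_integral_haar_recl//.
have ma : measurable_fun setT (fun w : Rn R n => w + \row_j a ord0 (lift ord0 j))%R.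
  exact: measurable_Rn_translate.
have mhc := measurableT_comp mh (@measurable_Rn_cons R n).
have mx w : measurable_fun [set: measurableTypeR R] (fun x => h (Rn_cons (x, w))).
  apply: (measurableT_comp mhc); exact: measurable_pair2.
transitivity (\int[haar R n]_w \int[uniform_prob (@ltr01 R)]_x
    h (Rn_cons (x, w + \row_j a ord0 (lift ord0 j)))%R).
  apply: eq_integral => w _.
  under eq_integral do rewrite Rn_consD.
  apply: (ge0_integral_uniform01_shift
     (f := fun x => h (Rn_cons (x, (w + \row_j a ord0 (lift ord0 j))%R)))) => // x.
  rewrite -[RHS](ph ord0 (Rn_cons _)) Rn_consD; congr (h (Rn_cons (_, _))).
    by rewrite mxE !eqxx.
  by apply/rowP => j; rewrite !mxE /= addr0.
apply: (ih (fun w => \int[uniform_prob (@ltr01 R)]_x h (Rn_cons (x, w)))).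
- by apply: (@measurable_integral1 _ _ _ _ _ _ (h \o @Rn_cons R n)) => // z; exact: h0.
- by move=> w; exact: integral_ge0.
- move=> i w; apply: eq_integral => x _.
  rewrite -[RHS](ph (lift ord0 i) (Rn_cons _)) Rn_consD; congr (h (Rn_cons (_, _))).
    by rewrite mxE /= addr0.
  by apply/rowP => j; rewrite !mxE /= (inj_eq lift_inj).
Qed.

Lemma integral_haar_translate n (h : Rn R n -> \bar R) (a : Rn R n) :
  measurable_fun setT h -> periodicT h ->
  \int[haar R n]_w h (w + a)%R = \int[haar R n]_w h w.
Proof.
move=> mh ph; rewrite integralE [RHS]integralE; congr (_ - _).
  rewrite -[RHS](ge0_integral_haar_translate a)//.
  - by apply: eq_integral => x _; rewrite !funeposE.
  - exact: measurable_funepos.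
  - by move=> i w; rewrite !funeposE ph.
rewrite -[RHS](ge0_integral_haar_translate a)//.
- by apply: eq_integral => x _; rewrite !funenegE.
- exact: measurable_funeneg.
- by move=> i w; rewrite !funenegE ph.
Qed.

Lemma cintegral_haar_translate n (h : Rn R n -> R[i]) (a : Rn R n) :
  cmeasurable h -> periodicT h ->
  cintegral (haar R n) (fun w => h (w + a)%R) = cintegral (haar R n) h.
Proof.
move=> [mR mI] ph; rewrite /cintegral /Rintegral.
rewrite (@integral_haar_translate _ (fun w => (complex.Re (h w))%:E)); last 2 first.
- exact/measurable_EFinP.
- by move=> i w; rewrite ph.
rewrite (@integral_haar_translate _ (fun w => (complex.Im (h w))%:E))//.
- exact/measurable_EFinP.
- by move=> i w; rewrite ph.
Qed.

End translation_torus.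

(** * Characters and Fourier series *)

Section exponentials.
Variable R : realType.
Implicit Types s t : R.

Lemma e2piD s t : e2pi (s + t) = e2pi s * e2pi t :> R[i].
Proof.
rewrite /e2pi mulrDr cosD sinD; apply: complex_eqP; rewrite ?cReM ?cImM//=; ring.
Qed.

Lemma e2pi0 : e2pi 0 = 1 :> R[i].
Proof. by rewrite /e2pi mulr0 cos0 sin0. Qed.

Lemma normc_e2pi t : normc (e2pi t) = 1 :> R.
Proof. by rewrite /e2pi/= cos2Dsin2 sqrtr1. Qed.

Lemma e2pi_conj t : (e2pi t)^* = e2pi (- t) :> R[i].
Proof. by rewrite /e2pi mulrN cosN sinN. Qed.

Lemma e2pi1 : e2pi 1 = 1 :> R[i].
Proof. by rewrite /e2pi mulr1 mulr_natl cos2pi sin2pi. Qed.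

Lemma e2pi_nat k : e2pi k%:R = 1 :> R[i].
Proof. by elim: k => [|k ih]; rewrite ?e2pi0// -natr1 e2piD ih e2pi1 mulr1. Qed.

Lemma e2pi_int (z : int) : e2pi z%:~R = 1 :> R[i].
Proof.
case: z => k; first exact: e2pi_nat.
rewrite NegzE mulrNz -e2pi_conj -pmulrn e2pi_nat.
by apply: complex_eqP => /=; rewrite ?oppr0.
Qed.

Lemma e2pi_half : e2pi 2^-1 = -1 :> R[i].
Proof.
rewrite /e2pi mulrC mulrA mulVf// mul1r cospi sinpi.
by apply: complex_eqP => /=; rewrite ?oppr0.
Qed.

Lemma cmeasurable_e2pi d (T : measurableType d) (f : T -> R) :
  measurable_fun setT f -> cmeasurable (fun x => e2pi (f x)).
Proof.
move=> mf; have m2 : measurable_fun setT (fun x => 2 * pi * f x).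
  by apply: measurable_funM => //; exact: measurable_cst.
split.
  apply: (measurableT_comp (f := @cos R)) => //.
  by apply: continuous_measurable_fun; exact: continuous_cos.
apply: (measurableT_comp (f := @sin R)) => //.
by apply: continuous_measurable_fun; exact: continuous_sin.
Qed.

End exponentials.

Section characters.
Context (R : realType) (n : nat).
Implicit Types (k l : Zn n) (w v : Rn R n).

Definition chi k w : R[i] := e2pi (zdot k w).

Lemma zdotDl k l w : zdot (k + l) w = zdot k w + zdot l w.
Proof. by rewrite /zdot -big_split/=; apply: eq_bigr => i _; rewrite mxE intrD mulrDl. Qed.

Lemma zdotNl k w : zdot (- k) w = - zdot k w.
Proof. by rewrite /zdot -sumrN; apply: eq_bigr => i _; rewrite mxE intrN mulNr. Qed.

Lemma zdotDr k w v : zdot k (w + v) = zdot k w + zdot k v.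
Proof. by rewrite /zdot -big_split/=; apply: eq_bigr => i _; rewrite mxE mulrDr. Qed.

Lemma zdotNr k w : zdot k (- w) = - zdot k w.
Proof. by rewrite /zdot -sumrN; apply: eq_bigr => i _; rewrite mxE mulrN. Qed.

Lemma zdotZr k a w : zdot k (a *: w) = a * zdot k w.
Proof. by rewrite /zdot mulr_sumr; apply: eq_bigr => i _; rewrite mxE mulrCA. Qed.

Lemma zdot_e k i : zdot k (Rn_e R i) = (k ord0 i)%:~R.
Proof.
rewrite /zdot (bigD1 i)//= mxE !eqxx mulr1 big1 ?addr0// => j ji.
by rewrite mxE (negbTE ji) andbF mulr0.
Qed.

Lemma chiDl k l w : chi (k + l) w = chi k w * chi l w.
Proof. by rewrite /chi zdotDl e2piD. Qed.

Lemma chiDr k w v : chi k (w + v) = chi k w * chi k v.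
Proof. by rewrite /chi zdotDr e2piD. Qed.

Lemma chi_conj k w : (chi k w)^* = chi (- k) w.
Proof. by rewrite /chi zdotNl e2pi_conj. Qed.

Lemma chiNr k w : chi k (- w) = chi (- k) w.
Proof. by rewrite /chi zdotNl zdotNr. Qed.

Lemma chi0 w : chi 0 w = 1.
Proof.
by rewrite /chi /zdot big1 ?e2pi0// => i _; rewrite mxE mul0r.
Qed.

Lemma chi0r k : chi k 0 = 1.
Proof.
by rewrite /chi /zdot big1 ?e2pi0// => i _; rewrite mxE mulr0.
Qed.

Lemma normc_chi k w : normc (chi k w) = 1.
Proof. exact: normc_e2pi. Qed.

Lemma chi_mulN k w : chi (- k) w * chi k w = 1.
Proof. by rewrite -chiDl addNr chi0. Qed.

Lemma periodic_chi k : periodicT (chi k).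
Proof. by move=> i w; rewrite chiDr /chi zdot_e e2pi_int mulr1. Qed.

Lemma measurable_zdot k : measurable_fun setT (fun w : Rn R n => zdot k w).
Proof.
rewrite /zdot; apply: (@measurable_sum _ (Rn R n) R setT _ (index_enum 'I_n)
  (fun i w => (k ord0 i)%:~R * w ord0 i)) => i.
apply: measurable_funM => //; exact: measurable_Rn_coord.
Qed.

Lemma cmeasurable_chi k : cmeasurable (chi k).
Proof. by have := cmeasurable_e2pi (measurable_zdot k). Qed.

End characters.

Section finite_measure_integrals.
Context d (T : measurableType d) (R : realType) (P : probability T R).

Lemma integral_bounded_le (F : T -> R[i]) (M : R) : cmeasurable F ->
  (forall x, normc (F x) <= M) -> (\int[P]_x (normc (F x))%:E <= M%:E)%E.
Proof.
move=> mF FM; apply: (@le_trans _ _ (\int[P]_x M%:E)%E).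
  apply: ge0_le_integral => //.
  - by move=> x _; rewrite lee_fin normc_ge0.
  - exact: cmeasurable_normcE.
  - by move=> x _; rewrite lee_fin.
rewrite integral_cst// [X in (_ * X)%E](_ : _ = 1%E) ?mule1//.
exact: probability_setT.
Qed.

Lemma cintegrable_bounded (F : T -> R[i]) (M : R) : cmeasurable F ->
  (forall x, normc (F x) <= M) -> cintegrable P F.
Proof.
move=> mF FM; apply/cintegrableP; split=> //.
by rewrite (le_lt_trans (integral_bounded_le mF FM))// ltry.
Qed.

Lemma cintegral_cst c : cintegral P (fun=> c) = c.
Proof.
have P1 : fine (P setT) = 1 by rewrite (_ : P setT = 1%E)//; exact: probability_setT.
by apply: complex_eqP => /=; rewrite Rintegral_cst//= [X in _ * X](_ : _ = 1) ?mulr1.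
Qed.

End finite_measure_integrals.

Section fourier_series.
Context (R : realType) (n : nat).
Implicit Types (k l : Zn n) (w v : Rn R n).
Local Notation cnt := (@countZ R n).
Local Notation haarn := (haar R n).

Lemma cintegrable_chi k : cintegrable haarn (chi k).
Proof.
apply: (@cintegrable_bounded _ _ _ _ _ 1); first exact: cmeasurable_chi.
by move=> w; rewrite normc_chi.
Qed.

(** Orthogonality without computing any integral: for [k != 0] there is a translation [v] with
    [chi k v = -1], which both preserves and negates the integral. *)
Lemma cintegral_chi k : cintegral haarn (chi k) = (k == 0)%:R.
Proof.
have [->|kn0] := eqVneq k 0.
  by rewrite (eq_cintegral _ (@chi0 R n)) cintegral_cst.
have [i kin0] : exists i, k ord0 i != 0.
  apply: contrapT => h; move/eqP: kn0; apply; apply/rowP => i; rewrite [RHS]mxE.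
  by apply/eqP; apply: contrapT => ki; apply: h; exists i; exact/negP.
pose v : Rn R n := (2 * (k ord0 i)%:~R)^-1 *: Rn_e R i.
have chiv : chi k v = -1.
  rewrite /chi zdotZr zdot_e -e2pi_half; congr e2pi.
  by field; rewrite intr_eq0.
have := @cintegral_haar_translate R n _ v (@cmeasurable_chi R n k) (@periodic_chi R n k).
under eq_cintegral do rewrite chiDr chiv.
rewrite cintegralZr; last exact: cintegrable_chi.
rewrite mulrN1 => /eqP; rewrite eq_sym -subr_eq0 opprK -mulr2n.
by rewrite mulrn_eq0/= => /eqP.
Qed.

Lemma cintegral_chiM k l : cintegral haarn (fun w => chi k w * chi l w) = (k + l == 0)%:R.
Proof. by rewrite -cintegral_chi; apply: eq_cintegral => w; rewrite chiDl. Qed.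

(** The minus sign matches the short-time Fourier transforms: both are of this form, [stftZ] in the
    torus variable and [stftZT] in [xi]. *)
Definition fseries (a : Zn n -> R[i]) w := cintegral cnt (fun k => a k * chi (- k) w).

Lemma cintegrable_fseries (a : Zn n -> R[i]) (b : Zn n -> R[i]) :
  cintegrable cnt a -> (forall k, normc (b k) = 1) -> cintegrable cnt (fun k => a k * b k).
Proof.
move=> /cintegrableP[_ ia] b1; apply/cintegrableP; split=> //.
by under eq_integral do rewrite normcM b1 mulr1.
Qed.

Lemma normc_fseries_le (a : Zn n -> R[i]) w : cintegrable cnt a ->
  ((normc (fseries a w))%:E <= \int[cnt]_k (normc (a k))%:E)%E.
Proof.
move=> ia; apply: le_trans (le_normc_cintegral _) _.
  by apply: cintegrable_fseries => // k; exact: normc_chi.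
by under eq_integral do rewrite normcM normc_chi mulr1.
Qed.

Lemma cmeasurable_fseries (a : Zn n -> R[i]) : cmeasurable (fseries a).
Proof.
apply: (@cmeasurable_cintegral _ _ (Rn R n) (Zn n) R _ (fun z => a z.2 * chi (- z.2) z.1)).
rewrite (_ : (fun _ => _) = (fun z : Zn n * Rn R n => a z.1 * chi (- z.1) z.2) \o
   (fun z : Rn R n * Zn n => (z.2, z.1)))//.
apply: cmeasurable_comp; first exact: measurable_fun_pair.
apply: cmeasurable_Zn_prod => k; apply: cmeasurableM => /=; first exact: cmeasurable_cst.
exact: cmeasurable_chi.
Qed.

(** Summability of [a] allows Fubini, after which orthogonality of the characters keeps one term. *)
Lemma fseries_coef (a : Zn n -> R[i]) l : cintegrable cnt a ->
  cintegral haarn (fun w => fseries a w * chi l w) = a l.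
Proof.
move=> ia; pose F (z : Zn n * Rn R n) := a z.1 * chi (- z.1) z.2 * chi l z.2.
have iF : cintegrable (cnt \x haarn)%E F.
  apply: cintegrable_prod.
    apply: cmeasurable_Zn_prod => k; apply: cmeasurableM; last exact: cmeasurable_chi.
    by apply: cmeasurableM => /=; [exact: cmeasurable_cst|exact: cmeasurable_chi].
  have /cintegrableP[_] := ia; apply: le_lt_trans; apply: ge0_le_integral => //.
  - by move=> k _; apply: integral_ge0 => w _; rewrite lee_fin normc_ge0.
  - move=> k _; apply: integral_bounded_le => [|w].
      apply: cmeasurableM; last exact: cmeasurable_chi.
      by apply: cmeasurableM => /=; [exact: cmeasurable_cst|exact: cmeasurable_chi].
    by rewrite /F !normcM !normc_chi !mulr1.
transitivity (cintegral haarn (fun w => cintegral cnt (fun k => F (k, w)))).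
  apply: eq_cintegral => w; rewrite -cintegralZr//.
  by apply: cintegrable_fseries => // k; exact: normc_chi.
rewrite (cintegral_fubini2 iF) -(cintegral_fubini1 iF).
rewrite (_ : a l = (fun k => a k * (- k + l == 0)%:R) l); last first.
  by rewrite /= addNr eqxx mulr1.
rewrite -(@cintegral_countZ_single R n (fun k => a k * (- k + l == 0)%:R) l); last first.
  by move=> k kl; rewrite addrC subr_eq0 eq_sym (negbTE kl) mulr0.
apply: eq_cintegral => k; rewrite /F/= -cintegral_chiM -cintegralZ.
  by apply: eq_cintegral => w; rewrite mulrA.
by under eq_fun do rewrite -chiDl; exact: cintegrable_chi.
Qed.

End fourier_series.

Lemma is_derive_congr (R : numFieldType) (V W : normedModType R) (f g : V -> W)
    (x v : V) (df dg : W) :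
  f =1 g -> df = dg -> is_derive x v f df -> is_derive x v g dg.
Proof. by move=> /funext -> ->. Qed.

(** * Smooth functions on the torus *)

Section directional_derivatives.
Context (R : realType) (n : nat).
Implicit Types (f g : Rn R n -> R) (h : Rn R n -> R[i]) (w v a : Rn R n) (i : 'I_n).

(** Restricting to a line brings directional derivatives down to one variable, where those of [cos]
    and [sin] are known. *)
Lemma is_derive_line f w v (df : R) :
  is_derive (0 : R) 1 (fun t : R => f (t *: v + w)) df -> is_derive w v f df.
Proof.
move=> [df1 df2].
have E : (fun t : R => t^-1 *: ((f \o shift w) (t *: v) - f w)) =
  (fun t : R => t^-1 *: (((fun t : R => f (t *: v + w)) \o shift 0) (t *: 1) -
     (fun t : R => f (t *: v + w)) 0)).
  by apply/funext => t /=; rewrite scale0r add0r addr0 [t *: 1]mulr1.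
split; first exact/derivable1P.
by rewrite /derive E.
Qed.

Lemma is_derive_lineP f w v (df : R) (t : R) :
  is_derive (t *: v + w) v f df -> is_derive t 1 (fun t : R => f (t *: v + w)) df.
Proof.
move=> [df1 df2].
have E : (fun s : R => s^-1 *: (((fun t : R => f (t *: v + w)) \o shift t) (s *: 1) -
     f (t *: v + w))) =
  (fun s : R => s^-1 *: ((f \o shift (t *: v + w)) (s *: v) - f (t *: v + w))).
  by apply/funext => s /=; rewrite [s *: 1]mulr1 scalerDl addrA.
split; first by rewrite /derivable E.
by rewrite /derive E.
Qed.

Lemma is_derive_translate f w v a (df : R) :
  is_derive (w + a) v f df -> is_derive w v (fun u => f (u + a)) df.
Proof.
move=> [df1 df2].
have E : (fun s : R => s^-1 *: (((fun u => f (u + a)) \o shift w) (s *: v) - f (w + a))) =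
   (fun s : R => s^-1 *: ((f \o shift (w + a)) (s *: v) - f (w + a))).
  by apply/funext => s /=; rewrite addrA.
split; first by rewrite /derivable E.
by rewrite /derive E.
Qed.

(** Ties differentiability to the value; [pderiv] is total and says nothing by itself about
    differentiability. *)
Definition is_cderive w i h (dh : R[i]) :=
  is_derive w (Rn_e R i) (fun v => complex.Re (h v)) (complex.Re dh) /\
  is_derive w (Rn_e R i) (fun v => complex.Im (h v)) (complex.Im dh).

Lemma pderiv_val w i h dh : is_cderive w i h dh -> pderiv i h w = dh.
Proof. by move=> [[_ d1] [_ d2]]; rewrite /pderiv d1 d2; case: dh {d1 d2}. Qed.

Lemma is_cderive_pderiv w i h :
  derivable (fun v => complex.Re (h v)) w (Rn_e R i) ->
  derivable (fun v => complex.Im (h v)) w (Rn_e R i) ->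
  is_cderive w i h (pderiv i h w).
Proof. by move=> d1 d2; split. Qed.

Lemma is_cderive_cst w i c : is_cderive w i (fun=> c) 0.
Proof. by split; exact: is_derive_cst. Qed.

Lemma is_cderiveD w i h1 h2 d1 d2 : is_cderive w i h1 d1 -> is_cderive w i h2 d2 ->
  is_cderive w i (fun v => h1 v + h2 v) (d1 + d2).
Proof.
move=> [R1 I1] [R2 I2]; split.
  under eq_fun do rewrite cReD; rewrite cReD; exact: is_deriveD.
under eq_fun do rewrite cImD; rewrite cImD; exact: is_deriveD.
Qed.

Lemma is_cderiveM w i h1 h2 d1 d2 : is_cderive w i h1 d1 -> is_cderive w i h2 d2 ->
  is_cderive w i (fun v => h1 v * h2 v) (d1 * h2 w + h1 w * d2).
Proof.
move=> [R1 I1] [R2 I2]; split.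
  have := is_deriveB (is_deriveM R1 R2) (is_deriveM I1 I2).
  apply: is_derive_congr => [v|]; rewrite ?cReM// cReD !cReM /GRing.scale/=; ring.
have := is_deriveD (is_deriveM R1 I2) (is_deriveM I1 R2).
apply: is_derive_congr => [v|]; rewrite ?cImM// cImD !cImM /GRing.scale/=; ring.
Qed.

Lemma is_cderiveZ w i c h d : is_cderive w i h d ->
  is_cderive w i (fun v => c * h v) (c * d).
Proof.
by move=> dh; have := is_cderiveM (is_cderive_cst w i c) dh; rewrite mul0r add0r.
Qed.

Lemma is_cderive_conj w i h d : is_cderive w i h d ->
  is_cderive w i (fun v => (h v)^*) d^*.
Proof.
move=> [R1 I1]; split.
  by move: R1; apply: is_derive_congr => [v|]; rewrite cRe_conj.
by have := is_deriveN I1; apply: is_derive_congr => [v|]; rewrite cIm_conj.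
Qed.

Lemma is_cderive_translate w i h a d : is_cderive (w + a) i h d ->
  is_cderive w i (fun v => h (v + a)) d.
Proof.
move=> [R1 I1]; split.
  exact: (is_derive_translate (f := fun v => complex.Re (h v))).
exact: (is_derive_translate (f := fun v => complex.Im (h v))).
Qed.

(** The eigenvalue 2 pi i k_i of the i-th partial derivative on the character [chi k]. *)
Definition dchi (k : Zn n) i : R[i] := Complex 0 (2 * pi * (k ord0 i)%:~R).

Lemma is_cderive_chi w i (k : Zn n) : is_cderive w i (chi k) (dchi k i * chi k w).
Proof.
have zl t : zdot k (t *: Rn_e R i + w) = t * (k ord0 i)%:~R + zdot k w :> R.
  by rewrite zdotDr zdotZr zdot_e.
have aff : is_derive (0 : R) 1
    (fun t : R => 2 * pi * (t * (k ord0 i)%:~R + zdot k w)) (2 * pi * (k ord0 i)%:~R).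
  apply: is_derive_eq; rewrite /GRing.scale/= ; ring.
split; rewrite ?cReM ?cImM /= ?mul0r ?add0r ?sub0r.
  apply: is_derive_line.
  have := @is_derive1_comp R (@cos R)
    (fun t : R => 2 * pi * (t * (k ord0 i)%:~R + zdot k w)) 0 _ _ (is_derive_cos _) aff.
  apply: is_derive_congr => [t|]; first by rewrite /= zl.
  by rewrite mul0r add0r mulNr mulrC.
apply: is_derive_line.
have := @is_derive1_comp R (@sin R)
    (fun t : R => 2 * pi * (t * (k ord0 i)%:~R + zdot k w)) 0 _ _ (is_derive_sin _) aff.
apply: is_derive_congr => [t|]; first by rewrite /= zl.
by rewrite mul0r add0r mulrC.
Qed.

Lemma pderiv_translate i h a : pderiv i (fun v => h (v + a)) = (fun v => pderiv i h (v + a)).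
Proof.
have dE (f : Rn R n -> R) w : 'D_(Rn_e R i) (fun v => f (v + a)) w = 'D_(Rn_e R i) f (w + a).
  rewrite /derive.
  suff -> : (fun s : R => s^-1 *: (((fun v => f (v + a)) \o shift w) (s *: Rn_e R i) -
       f (w + a))) =
    (fun s : R => s^-1 *: ((f \o shift (w + a)) (s *: Rn_e R i) - f (w + a))) by [].
  by apply/funext => s /=; rewrite addrA.
apply/funext => w; rewrite /pderiv (dE (fun v => complex.Re (h v))).
by rewrite (dE (fun v => complex.Im (h v))).
Qed.

Lemma pderivs_translate s h a :
  pderivs s (fun v => h (v + a)) = (fun v => pderivs s h (v + a)).
Proof. by elim: s => [//|i s ih] /=; rewrite ih pderiv_translate. Qed.

Lemma periodic_pderivs s h : periodicT h -> periodicT (pderivs s h).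
Proof.
move=> ph i w; rewrite -[LHS](congr1 (@^~ w) (pderivs_translate s h (Rn_e R i))).
by congr (pderivs s _ w); apply/funext => v; exact: ph.
Qed.

End directional_derivatives.

Section continuity.
Context (R : realType) (n : nat).
Implicit Types (h : Rn R n -> R[i]) (w : Rn R n).

Definition ccontinuous h :=
  continuous (fun v => complex.Re (h v)) /\ continuous (fun v => complex.Im (h v)).

Lemma ccontinuous_cst c : ccontinuous (fun=> c).
Proof. by split; exact: cst_continuous. Qed.

Lemma ccontinuousD h1 h2 : ccontinuous h1 -> ccontinuous h2 ->
  ccontinuous (fun v => h1 v + h2 v).
Proof.
move=> [R1 I1] [R2 I2]; split=> w.
  by under eq_fun do rewrite cReD; apply: continuousD; [exact: R1|exact: R2].
by under eq_fun do rewrite cImD; apply: continuousD; [exact: I1|exact: I2].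
Qed.

Lemma ccontinuousM h1 h2 : ccontinuous h1 -> ccontinuous h2 ->
  ccontinuous (fun v => h1 v * h2 v).
Proof.
move=> [R1 I1] [R2 I2]; split=> w.
  rewrite (_ : (fun v => _) = (fun v => complex.Re (h1 v) * complex.Re (h2 v) -
    complex.Im (h1 v) * complex.Im (h2 v))); last by apply/funext => v; rewrite cReM.
  exact: cvgB (cvgM (R1 w) (R2 w)) (cvgM (I1 w) (I2 w)).
rewrite (_ : (fun v => _) = (fun v => complex.Re (h1 v) * complex.Im (h2 v) +
    complex.Im (h1 v) * complex.Re (h2 v))); last by apply/funext => v; rewrite cImM.
exact: cvgD (cvgM (R1 w) (I2 w)) (cvgM (I1 w) (R2 w)).
Qed.

Lemma ccontinuous_conj h : ccontinuous h -> ccontinuous (fun v => (h v)^*).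
Proof.
move=> [R1 I1]; split=> w.
  rewrite (_ : (fun v => _) = (fun v => complex.Re (h v))); first exact: R1.
  by apply/funext => v; rewrite cRe_conj.
rewrite (_ : (fun v => _) = (fun v => - complex.Im (h v))).
  by apply: continuousN; exact: I1.
by apply/funext => v; rewrite cIm_conj.
Qed.

Lemma ccontinuous_translate h (a : Rn R n) : ccontinuous h -> ccontinuous (fun v => h (v + a)).
Proof.
have ca : continuous (fun v : Rn R n => v + a).
  by move=> w; apply: continuousD; [exact: cvg_id|exact: cst_continuous].
move=> [R1 I1]; split=> w.
  exact: (continuous_comp (ca w) (R1 _)).
exact: (continuous_comp (ca w) (I1 _)).
Qed.

Lemma continuous_zdot (k : Zn n) : continuous (fun w : Rn R n => zdot k w : R).
Proof.
move=> w; rewrite /zdot; elim: (index_enum _) => [|i r ih].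
  by under eq_fun do rewrite big_nil; exact: cst_continuous.
under eq_fun do rewrite big_cons; apply: cvgD ih.
by apply: cvgM; [exact: cvg_cst|exact: coord_continuous].
Qed.

Lemma ccontinuous_chi (k : Zn n) : ccontinuous (chi k : Rn R n -> R[i]).
Proof.
have cz w : {for w, continuous (fun w : Rn R n => 2 * pi * zdot k w : R)}.
  by apply: continuousM; [exact: cst_continuous|exact: continuous_zdot].
split=> w.
  exact: (continuous_comp (cz w) (@continuous_cos R _)).
exact: (continuous_comp (cz w) (@continuous_sin R _)).
Qed.

(** The sigma-algebra is generated by coordinates, not by open sets. Rounding to a lattice links it
    to continuity: there are countably many values, each taken on a cube given by coordinate
    conditions. *)
Lemma measurable_floorK (K : nat) :
  measurable_fun [set: Rn R n]
    (fun w => \row_i Num.floor (K.+1%:R * w ord0 i) : Zn n).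
Proof.
move=> _ A _; rewrite setTI.
rewrite (_ : _ @^-1` _ = \bigcup_m
   (if unpickle m is Some k then
     [set w : Rn R n | A k /\ k = \row_i Num.floor (K.+1%:R * w ord0 i)] else set0)); last first.
  apply/seteqP; split=> [w Aw|w [m _]].
    by exists (pickle (\row_i Num.floor (K.+1%:R * w ord0 i) : Zn n)) => //; rewrite pickleK.
  by case: unpickle => // k [Ak /= <-].
apply: bigcup_measurable => m _; case: unpickle => [k|//].
have [Ak|nAk] := pselect (A k); last first.
  by rewrite (_ : mkset _ = set0)//; apply/seteqP; split=> // w [].
rewrite (_ : mkset _ = \bigcap_(i in [set: 'I_n])
   ((fun w : Rn R n => K.+1%:R * w ord0 i) @^-1`
     `[(k ord0 i)%:~R, (k ord0 i + 1)%:~R[%classic)); last first.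
  apply/seteqP; split=> [w [_ ->] i _|w kw].
    by rewrite /= mxE in_itv/= floor_le/= floorD1_gt.
  split=> //; apply/rowP => i; rewrite mxE; apply/esym/floor_def.
  by have := kw i I; rewrite /= in_itv.
apply: fin_bigcap_measurable => // i _.
rewrite -[X in measurable X]setTI.
have mi : measurable_fun [set: Rn R n] (fun w : Rn R n => K.+1%:R * w ord0 i).
  by apply: measurable_funM => //; exact: measurable_Rn_coord.
exact: mi.
Qed.

(* A continuous function is the pointwise limit of its values on finer and
   finer lattices, each of which takes countably many values. *)
Lemma continuous_measurable_Rn (f : Rn R n -> R) : continuous f -> measurable_fun setT f.
Proof.
move=> cf.
pose g K (w : Rn R n) : Rn R n := \row_i (K.+1%:R^-1 * (Num.floor (K.+1%:R * w ord0 i))%:~R).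
apply: (@measurable_fun_cvg _ _ _ _ (fun K w => f (g K w))).
  move=> K; pose q (k : Zn n) : Rn R n := \row_i (K.+1%:R^-1 * (k ord0 i)%:~R).
  rewrite (_ : (fun w => _) =
     (f \o q) \o (fun w => \row_i Num.floor (K.+1%:R * w ord0 i) : Zn n)).
    apply: measurableT_comp; first exact: measurable_fun_Zn.
    exact: measurable_floorK.
  by apply/funext => w /=; congr f; apply/rowP => i; rewrite !mxE.
move=> w _; apply: cvg_comp; last exact: cf.
apply/cvgrPdist_le => e e0; near=> K.
rewrite /Num.norm/= mx_normrE; apply/bigmax_leP; split=> [|[i j] _]; first exact: ltW.
rewrite (ord1 i) !mxE/=.
have K0 : (0 : R) < K.+1%:R by [].
have [fl fu] := (floor_le (K.+1%:R * w ord0 j), floorD1_gt (K.+1%:R * w ord0 j)).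
rewrite -(ler_pM2l K0) -[X in X * `|_|](ger0_norm (ltW K0)) -normrM mulrBr mulVKf ?gt_eqF//.
rewrite ger0_norm ?subr_ge0// (@le_trans _ _ 1)//.
  by move: fu; rewrite intrD; lra.
rewrite mulrC -ler_pdivrMl// mulr1.
near: K; apply: filterS (nbhs_infty_ger e^-1) => K /le_trans; apply.
by rewrite ler_nat.
Unshelve. all: by end_near. Qed.

Lemma ccontinuous_measurable h : ccontinuous h -> cmeasurable h.
Proof. by move=> [R1 I1]; split; exact: continuous_measurable_Rn. Qed.

End continuity.

Section smooth_functions.
Context (R : realType) (n : nat).
Implicit Types (h : Rn R n -> R[i]) (w a : Rn R n) (i : 'I_n) (k l : Zn n) (s : seq 'I_n).

(** A coinduction principle: if a class of functions is stable under every [pderiv], continuity and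
    differentiability have to be checked only once, on the class, instead of for all iterated
    derivatives. *)
Lemma smooth_coind (P : (Rn R n -> R[i]) -> Prop) :
  (forall h, P h -> ccontinuous h /\
     forall i, (forall w, exists dh, is_cderive w i h dh) /\ P (pderiv i h)) ->
  forall h, P h -> smooth h.
Proof.
move=> hP h Ph s /=.
have /hP[[cR cI] hi] : P (pderivs s h) by elim: s => [//|i s /hP[_ /(_ i)[]]].
split=> // i w; have [/(_ w)[dh [[dR _] [dI _]]] _] := hi i.
by split.
Qed.

Lemma pderivs_rcons s i h : pderivs (rcons s i) h = pderivs s (pderiv i h).
Proof. by rewrite /pderivs foldr_rcons. Qed.

Lemma smooth_pderiv h i : smooth h -> smooth (pderiv i h).
Proof. by move=> sh s; have := sh (rcons s i); rewrite pderivs_rcons. Qed.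

Lemma smooth_continuous h : smooth h -> ccontinuous h.
Proof. by move=> /(_ [::])[]. Qed.

Lemma smooth_cderive h w i : smooth h -> is_cderive w i h (pderiv i h w).
Proof. by move=> /(_ [::])[_ _ /(_ i w)[]]; exact: is_cderive_pderiv. Qed.

Lemma smooth_pderivs h s : smooth h -> smooth (pderivs s h).
Proof. by move=> sh; elim: s => //= i s; exact: smooth_pderiv. Qed.

Lemma pderivD i h1 h2 : smooth h1 -> smooth h2 ->
  pderiv i (fun w => h1 w + h2 w) = (fun w => pderiv i h1 w + pderiv i h2 w).
Proof.
move=> s1 s2; apply/funext => w; apply: pderiv_val.
by apply: is_cderiveD; exact: smooth_cderive.
Qed.

Lemma pderivZ i c h : smooth h -> pderiv i (fun w => c * h w) = (fun w => c * pderiv i h w).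
Proof.
move=> sh; apply/funext => w; apply: pderiv_val.
by apply: is_cderiveZ; exact: smooth_cderive.
Qed.

Lemma pderiv_conj i h : smooth h -> pderiv i (fun w => (h w)^*) = (fun w => (pderiv i h w)^*).
Proof.
move=> sh; apply/funext => w; apply: pderiv_val.
by apply: is_cderive_conj; exact: smooth_cderive.
Qed.

Lemma pderiv_chiM i k h : smooth h ->
  pderiv i (fun w => chi k w * h w) = (fun w => chi k w * (dchi R k i * h w + pderiv i h w)).
Proof.
move=> sh; apply/funext => w; apply: pderiv_val.
have := is_cderiveM (is_cderive_chi w i k) (smooth_cderive w i sh).
suff -> : dchi R k i * chi k w * h w + chi k w * pderiv i h w =
  chi k w * (dchi R k i * h w + pderiv i h w) by [].
by rewrite mulrDr; congr (_ + _); rewrite [dchi _ _ _ * _]mulrC mulrA.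
Qed.

Lemma smoothD h1 h2 : smooth h1 -> smooth h2 -> smooth (fun w => h1 w + h2 w).
Proof.
move=> s1 s2.
apply: (@smooth_coind (fun h => exists f1 f2,
  [/\ smooth f1, smooth f2 & h = fun w => f1 w + f2 w])); last by exists h1, h2.
move=> _ [f1 [f2 [sf1 sf2 ->]]]; split.
  by apply: ccontinuousD; exact: smooth_continuous.
move=> i; split=> [w|].
  by eexists; apply: is_cderiveD; exact: smooth_cderive.
by exists (pderiv i f1), (pderiv i f2); split; [exact: smooth_pderiv..|exact: pderivD].
Qed.

Lemma smoothZ c h : smooth h -> smooth (fun w => c * h w).
Proof.
move=> sh.
apply: (@smooth_coind (fun h => exists2 f, smooth f & h = fun w => c * f w)); last by exists h.
move=> _ [f sf ->]; split.
  by apply: ccontinuousM; [exact: ccontinuous_cst|exact: smooth_continuous].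
move=> i; split=> [w|]; first by eexists; apply: is_cderiveZ; exact: smooth_cderive.
by exists (pderiv i f); [exact: smooth_pderiv|exact: pderivZ].
Qed.

Lemma smooth_conj h : smooth h -> smooth (fun w => (h w)^*).
Proof.
move=> sh.
apply: (@smooth_coind (fun h => exists2 f, smooth f & h = fun w => (f w)^*)); last by exists h.
move=> _ [f sf ->]; split; first exact/ccontinuous_conj/smooth_continuous.
move=> i; split=> [w|]; first by eexists; apply: is_cderive_conj; exact: smooth_cderive.
by exists (pderiv i f); [exact: smooth_pderiv|exact: pderiv_conj].
Qed.

Lemma smooth_translate a h : smooth h -> smooth (fun w => h (w + a)).
Proof.
move=> sh.
apply: (@smooth_coind (fun h => exists2 f, smooth f & h = fun w => f (w + a))); last by exists h.
move=> _ [f sf ->]; split; first exact/ccontinuous_translate/smooth_continuous.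
move=> i; split=> [w|].
  by eexists; apply: is_cderive_translate; exact: smooth_cderive.
by exists (pderiv i f); [exact: smooth_pderiv|exact: pderiv_translate].
Qed.

Lemma smooth_chiM k h : smooth h -> smooth (fun w => chi k w * h w).
Proof.
move=> sh.
apply: (@smooth_coind (fun h => exists2 f, smooth f & h = fun w => chi k w * f w));
  last by exists h.
move=> _ [f sf ->]; split.
  by apply: ccontinuousM; [exact: ccontinuous_chi|exact: smooth_continuous].
move=> i; split=> [w|].
  by eexists; apply: is_cderiveM; [exact: is_cderive_chi|exact: smooth_cderive].
(* The invariant class keeps the character fixed and lets only the smooth factor change. *)
exists (fun w => dchi R k i * f w + pderiv i f w); last exact: pderiv_chiM.
by apply: smoothD; [exact: smoothZ|exact: smooth_pderiv].
Qed.

Lemma smooth0 : smooth (fun _ : Rn R n => 0 : R[i]).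
Proof.
apply: (@smooth_coind (fun h => h = (fun=> 0))) => // h ->; split.
  exact: ccontinuous_cst.
move=> i; split=> [w|]; first by eexists; exact: is_cderive_cst.
by apply/funext => w; apply: pderiv_val; exact: is_cderive_cst.
Qed.

Lemma smooth_cst c : smooth (fun _ : Rn R n => c : R[i]).
Proof.
apply: (@smooth_coind (fun h => exists c, h = (fun=> c))); last by exists c.
move=> _ [b ->]; split; first exact: ccontinuous_cst.
move=> i; split=> [w|]; first by eexists; exact: is_cderive_cst.
by exists 0; apply/funext => w; apply: pderiv_val; exact: is_cderive_cst.
Qed.

Lemma smooth_chi k : smooth (chi k : Rn R n -> R[i]).
Proof.
have := smooth_chiM k (smooth_cst 1).
by rewrite (_ : (fun w => _) = chi k)//; apply/funext => w; rewrite mulr1.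
Qed.

Lemma pderivs_lin s c h1 h2 : smooth h1 -> smooth h2 ->
  pderivs s (fun w => c * h1 w + h2 w) = (fun w => c * pderivs s h1 w + pderivs s h2 w).
Proof.
move=> s1 s2; elim: s => [//|i s ih] /=; rewrite ih.
rewrite pderivD ?pderivZ//; try exact: smooth_pderivs.
exact/smoothZ/smooth_pderivs.
Qed.

Lemma pderivsZ s c h : smooth h -> pderivs s (fun w => c * h w) = (fun w => c * pderivs s h w).
Proof.
by move=> sh; elim: s => [//|i s ih] /=; rewrite ih pderivZ//; exact: smooth_pderivs.
Qed.

Lemma pderivs0 s : pderivs s (fun=> 0 : R[i]) = (fun=> 0).
Proof.
have := pderivsZ s 0 (@smooth0); rewrite (_ : (fun w => 0 * 0) = (fun=> 0)).
  by move=> ->; apply/funext => w; rewrite mul0r.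
by apply/funext => w; rewrite mul0r.
Qed.

Lemma pderivs_conj s h : smooth h ->
  pderivs s (fun w => (h w)^*) = (fun w => (pderivs s h w)^*).
Proof.
by move=> sh; elim: s => [//|i s ih] /=; rewrite ih pderiv_conj//; exact: smooth_pderivs.
Qed.

Definition dbound (N : nat) h (M : R) :=
  forall s w, (size s <= N)%N -> normc (pderivs s h w) <= M.

Lemma dbound_ge0 N h M : dbound N h M -> 0 <= M.
Proof. by move=> /(_ [::] 0 erefl); apply: le_trans; exact: normc_ge0. Qed.

(** The cost of one derivative of [chi k * h]: the sum pays for differentiating the character, the 1
    for differentiating [h]. *)
Definition chi_growth k : R := \sum_i normc (dchi R k i) + 1.

Lemma dbound_chiM N k h M : smooth h -> dbound N h M ->
  dbound N (fun w => chi k w * h w) (chi_growth k ^+ N * M).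
Proof.
have g1 : 1 <= chi_growth k.
  by rewrite lerDr sumr_ge0// => i _; exact: normc_ge0.
elim: N h M => [|N ih] h M sh bh s w sN.
  move: sN; rewrite leqn0 => /nilP ->.
  by rewrite /= normcM normc_chi mul1r expr0 mul1r; exact: (bh [::]).
have M0 := dbound_ge0 bh.
(* The derivative applied first is peeled off, so that the induction hypothesis is used for the
   smooth factor [dchi R k i * h + pderiv i h]. *)
case/lastP: s sN => [_|s i]; last rewrite size_rcons ltnS => sN.
  rewrite /= normcM normc_chi mul1r (le_trans (bh [::] w isT))//.
  by rewrite ler_peMl// exprn_ege1.
rewrite pderivs_rcons pderiv_chiM// exprSr -mulrA.
apply: ih => //; first by apply: smoothD; [exact: smoothZ|exact: smooth_pderiv].
move=> t v tN; rewrite pderivs_lin//; last exact: smooth_pderiv.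
rewrite (le_trans (le_normcD _ _))// /chi_growth mulrDl mul1r lerD//.
  rewrite normcM ler_pM ?normc_ge0//; last by apply: bh; exact: ltnW.
  by rewrite (bigD1 i)//= lerDl sumr_ge0// => j _; exact: normc_ge0.
by rewrite -pderivs_rcons; apply: bh; rewrite size_rcons.
Qed.

Let lipschitz_real (f df : Rn R n -> R) i M :
  (forall w, is_derive w (Rn_e R i) f (df w)) -> (forall w, `|df w| <= M) ->
  forall w t, 0 <= t -> `|f (t *: Rn_e R i + w) - f w| <= M * t.
Proof.
move=> fd dM w t t0.
have fd1 (s : R) : is_derive s 1 (fun t : R => f (t *: Rn_e R i + w)) (df (s *: Rn_e R i + w)).
  exact: is_derive_lineP.
have [|c _] := @MVT_segment R (fun t => f (t *: Rn_e R i + w))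
    (fun r : R => df (r *: Rn_e R i + w)) 0 t t0 (fun x _ => fd1 x).
  by apply: derivable_within_continuous => x _; case: (fd1 x).
rewrite scale0r add0r subr0 => ->.
by rewrite normrM (ger0_norm t0) ler_wpM2r.
Qed.

(** The factor 2 comes from using the mean value theorem separately on the real and the imaginary
    part. *)
Lemma smooth_lipschitz h i M : smooth h -> (forall w, normc (pderiv i h w) <= M) ->
  forall w t, normc (h (w + t *: Rn_e R i) - h w) <= 2 * M * `|t|.
Proof.
move=> sh dM.
have pos w t : 0 <= t -> normc (h (w + t *: Rn_e R i) - h w) <= 2 * M * t.
  move=> t0; rewrite [w + _]addrC (le_trans (normc_le_ReIm _))// cReD cImD cReN cImN.
  rewrite -mulrA mulr_natl mulr2n lerD//.
    apply: (lipschitz_real (f := fun v => complex.Re (h v))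
       (df := fun v => complex.Re (pderiv i h v))) => // v.
      by have [] := smooth_cderive v i sh.
    exact: le_trans (normr_Re_le _) (dM _).
  apply: (lipschitz_real (f := fun v => complex.Im (h v))
       (df := fun v => complex.Im (pderiv i h v))) => // v.
    by have [] := smooth_cderive v i sh.
  exact: le_trans (normr_Im_le _) (dM _).
move=> w t; have [t0|t0] := leP 0 t; first by rewrite ger0_norm// pos.
rewrite normcB ltr0_norm//.
have := pos (w + t *: Rn_e R i) (- t); rewrite scaleNr addrK; apply.
by rewrite oppr_ge0 ltW.
Qed.

End smooth_functions.

Section fourier_coefficients.
Context (R : realType) (n : nat).
Implicit Types (h : Rn R n -> R[i]) (w a : Rn R n) (i : 'I_n) (k l : Zn n) (s : seq 'I_n).
Local Notation haarn := (haar R n).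

Definition tsmooth h := smooth h /\ periodicT h.

Lemma tsmooth_cmeasurable h : smooth h -> cmeasurable h.
Proof. by move=> /smooth_continuous/ccontinuous_measurable. Qed.

Lemma dbound_cintegrable N h M : smooth h -> dbound N h M -> cintegrable haarn h.
Proof.
move=> sh bh; apply: (@cintegrable_bounded _ _ _ _ _ M); first exact: tsmooth_cmeasurable.
by move=> w; exact: (bh [::]).
Qed.

Lemma periodicT_int h i w (z : int) : periodicT h -> h (w + z%:~R *: Rn_e R i) = h w.
Proof.
move=> ph.
have := @periodic_int R R[i] (fun t => h (w + t *: Rn_e R i)) z 0.
by rewrite add0r scale0r addr0; apply=> t; rewrite scalerDl scale1r addrA ph.
Qed.

(** Difference quotients along a sequence of steps, the form required by dominated convergence. *)
Lemma is_derive_cvg (f : Rn R n -> R) w v (df : R) : is_derive w v f df ->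
  (fun k : nat => k.+1%:R * (f (w + k.+1%:R^-1 *: v) - f w)) @ \oo --> df.
Proof.
move=> [cf <-].
have hc : (fun k : nat => (k.+1%:R : R)^-1) @ \oo --> 0^'.
  move=> A A0.
  have h : \forall k \near \oo, (fun x : R => x != 0 -> A x) (harmonic k).
    exact: (@cvg_harmonic R _ A0).
  apply: (@filterS _ \oo _ _ _ _ h) => k /=; apply.
  by rewrite invr_eq0 pnatr_eq0.
have := cvg_comp _ _ hc cf.
apply: cvg_trans; apply: near_eq_cvg; near=> k => /=.
by rewrite invrK [_ *: v + w]addrC.
Unshelve. all: by end_near. Qed.

Lemma is_cderive_cvg h w i (dh : R[i]) : is_cderive w i h dh ->
  (fun k : nat => normc ((k.+1%:R)%:C * (h (w + k.+1%:R^-1 *: Rn_e R i) - h w) - dh))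
    @ \oo --> (0 : R).
Proof.
move=> [/is_derive_cvg cR /is_derive_cvg cI].
apply/cvgrPdist_lt => e e0; have e2 : 0 < e / 2 by rewrite divr_gt0.
have /cvgrPdist_lt /(_ _ e2) hR := cR; have /cvgrPdist_lt /(_ _ e2) hI := cI.
near=> k; rewrite sub0r normrN ger0_norm ?normc_ge0//.
rewrite (le_lt_trans (normc_le_ReIm _))// [ltRHS]splitr.
rewrite !(cReD, cImD, cReM, cImM, cReN, cImN)/= !mul0r subr0 addr0.
by rewrite ltrD// distrC; near: k.
Unshelve. all: by end_near. Qed.

(* The integrals of the difference quotients vanish by translation invariance. *)
Lemma cintegral_pderiv h i M : tsmooth h -> dbound 1 h M ->
  cintegral haarn (pderiv i h) = 0.
Proof.
move=> [sh ph] bh.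
have mh := tsmooth_cmeasurable sh.
have ih := dbound_cintegrable sh bh.
have iht a : cintegrable haarn (fun w => h (w + a)).
  apply: (@cintegrable_bounded _ _ _ _ _ M).
    exact: (cmeasurable_comp (measurable_Rn_translate a) mh).
  by move=> w; exact: (bh [::]).
pose q (k : nat) w := (k.+1%:R)%:C * (h (w + k.+1%:R^-1 *: Rn_e R i) - h w).
have iq (k : nat) : cintegral haarn (q k) = 0.
  rewrite /q cintegralZ; last exact: cintegrableB.
  by rewrite cintegralB// cintegral_haar_translate// subrr mulr0.
have M0 := dbound_ge0 bh.
have [||w||k w|_] := @cintegral_dominated _ _ _ haarn q (pderiv i h) (fun=> 2 * M).
- move=> k; apply: cmeasurableM => /=; first exact: cmeasurable_cst.
  apply: cmeasurableD; first exact: (cmeasurable_comp (measurable_Rn_translate _) mh).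
  by have /cintegrableP[] := cintegrableN ih.
- exact/tsmooth_cmeasurable/smooth_pderiv.
- exact/is_cderive_cvg/smooth_cderive.
- exact: finite_measure_integrable_cst.
- rewrite normcM normc_real ger0_norm//.
  have := smooth_lipschitz (M := M) sh (fun w => bh [:: i] w isT) w (k.+1%:R^-1).
  by rewrite normfV ger0_norm// ler_pdivlMr// mulrC.
under eq_fun do rewrite iq sub0r normcN.
move=> /(cvg_lim (@Rhausdorff R)); rewrite lim_cst; last exact: Rhausdorff.
by move=> /eqP; rewrite normc_eq0 => /eqP.
Qed.

Definition fcoef h l := cintegral haarn (fun w => h w * chi (- l) w).

(** Integration by parts: the derivative of [chi (- l) * h] has integral zero, and the product rule
    moves the derivative from [h] to the character. *)
Lemma fcoef_pderiv h i l M : tsmooth h -> dbound 1 h M ->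
  fcoef (pderiv i h) l = dchi R l i * fcoef h l.
Proof.
move=> [sh ph] bh.
have sc := smooth_chiM (- l) sh.
have pc : periodicT (fun w => chi (- l) w * h w).
  by move=> j w; rewrite ph periodic_chi.
have bc := dbound_chiM (- l) sh bh.
have := cintegral_pderiv i (conj sc pc) bc.
rewrite pderiv_chiM// => h0.
have mh := tsmooth_cmeasurable sh.
have i1 : cintegrable haarn (fun w => h w * chi (- l) w).
  under eq_fun do rewrite mulrC; exact: dbound_cintegrable bc.
have i2 : cintegrable haarn (fun w => pderiv i h w * chi (- l) w).
  have mp := tsmooth_cmeasurable (smooth_pderiv i sh).
  apply: (@cintegrable_bounded _ _ _ _ _ M).
    by apply: cmeasurableM => //; exact: cmeasurable_chi.
  by move=> w; rewrite normcM normc_chi mulr1; exact: (bh [:: i]).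
have E : (fun w => chi (- l) w * (dchi R (- l) i * h w + pderiv i h w)) =
   (fun w => - dchi R l i * (h w * chi (- l) w) + pderiv i h w * chi (- l) w).
  apply/funext => w; rewrite mulrDr mulrC [X in _ + X]mulrC -mulrA; congr (_ * _ + _).
  by apply: complex_eqP => /=; rewrite ?oppr0// mxE intrN mulrN.
move: h0; rewrite E cintegralD//; last exact: cintegrableZ.
rewrite cintegralZ// mulNr => /eqP; rewrite addrC subr_eq0 => /eqP.
exact.
Qed.

End fourier_coefficients.

(** * Fejer summation *)

Section fejer.
Context (R : realType) (n : nat).
Implicit Types (h : Rn R n -> R[i]) (w v t a : Rn R n) (i : 'I_n) (k l : Zn n) (s : seq 'I_n).
Local Notation haarn := (haar R n).
Variable K : nat.
Local Notation cube := {ffun 'I_n -> 'I_K.+1}.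

Definition cubept (a : cube) : Zn n := \row_i (a i)%:Z.

Lemma cubept_inj : injective cubept.
Proof.
move=> a b ab; apply/ffunP => i; apply/val_inj/eqP.
by have /rowP/(_ i) := ab; rewrite !mxE => /eqP; rewrite eqz_nat.
Qed.

Definition cubevol : R := K.+1%:R ^+ n.

Lemma cubevol_gt0 : 0 < cubevol.
Proof. exact: exprn_gt0. Qed.

Lemma card_cube : #|{: cube}|%:R = cubevol.
Proof. by rewrite card_ffun !card_ord natrX. Qed.

(** The frequency l arises from as many pairs of cube points as have difference l, so this is the
    usual Fejer mean with weights given by the product of the max(0, 1 - |l_i|/(K+1)). *)
Definition fejer_sum h w : R[i] :=
  (cubevol^-1)%:C * \sum_(a : cube) \sum_(b : cube)
    fcoef h (cubept a - cubept b) * chi (cubept a - cubept b) w.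

(** The Fejer kernel as a normalized squared modulus, which makes positivity evident;
    [fejer_kernelE] recovers the double sum. *)
Definition fejer_kernel t : R := cubevol^-1 * normc (\sum_(a : cube) chi (cubept a) t) ^+ 2.

Lemma fejer_kernel_ge0 t : 0 <= fejer_kernel t.
Proof. by rewrite mulr_ge0// ?sqr_ge0// invr_ge0 ltW// cubevol_gt0. Qed.

Lemma fejer_kernelE t : (fejer_kernel t)%:C =
  (cubevol^-1)%:C * \sum_(a : cube) \sum_(b : cube) chi (cubept a - cubept b) t.
Proof.
rewrite /fejer_kernel rmorphM/= -mul_conjc; congr (_ * _).
rewrite rmorph_sum/= mulr_suml; apply: eq_bigr => a _; rewrite mulr_sumr.
by apply: eq_bigr => b _; rewrite chiDl chi_conj.
Qed.

Lemma cintegral_chi_reflect l w : cintegral haarn (fun t => chi l (w - t)) = (l == 0)%:R.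
Proof.
under eq_cintegral do rewrite chiDr chiNr.
rewrite cintegralZ; last exact: cintegrable_chi.
rewrite cintegral_chi oppr_eq0; case: eqP => [->|]; last by rewrite mulr0.
by rewrite chi0 mulr1.
Qed.

Lemma cintegrable_chi_reflect l w : cintegrable haarn (fun t => chi l (w - t)).
Proof.
by under eq_fun do rewrite chiDr chiNr; apply: cintegrableZ; exact: cintegrable_chi.
Qed.

Lemma cintegral_fejer_chi l w :
  cintegral haarn (fun t => (fejer_kernel (w - t))%:C * chi l (w - t)) =
  (cubevol^-1)%:C * (\sum_(a : cube) \sum_(b : cube) (cubept a - cubept b + l == 0)%:R).
Proof.
transitivity (cintegral haarn (fun t => (cubevol^-1)%:C *
  \sum_(a : cube) \sum_(b : cube) chi (cubept a - cubept b + l) (w - t))).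
  apply: eq_cintegral => t; rewrite fejer_kernelE -mulrA; congr (_ * _).
  rewrite mulr_suml; apply: eq_bigr => a _; rewrite mulr_suml.
  by apply: eq_bigr => b _; rewrite [RHS]chiDl.
rewrite cintegralZ; last first.
  by apply: cintegrable_sum => a; apply: cintegrable_sum => b; exact: cintegrable_chi_reflect.
congr (_ * _); rewrite cintegral_sum; last first.
  by move=> a; apply: cintegrable_sum => b; exact: cintegrable_chi_reflect.
apply: eq_bigr => a _; rewrite cintegral_sum; last first.
  by move=> b; exact: cintegrable_chi_reflect.
by apply: eq_bigr => b _; exact: cintegral_chi_reflect.
Qed.

Lemma cintegral_fejer w : cintegral haarn (fun t => (fejer_kernel (w - t))%:C) = 1.
Proof.
transitivity (cintegral haarn (fun t => (fejer_kernel (w - t))%:C * chi 0 (w - t))).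
  by apply: eq_cintegral => t; rewrite chi0 mulr1.
(* Only the diagonal pairs survive; there are [cubevol] of them. *)
rewrite cintegral_fejer_chi (eq_bigr (fun=> 1)); last first.
  move=> a _; rewrite (bigD1 a)//= subrr addr0 eqxx big1 ?addr0// => b ba.
  by rewrite addr0 subr_eq0 (inj_eq cubept_inj) eq_sym (negbTE ba).
rewrite sumr_const -[_ *+ _]/(#|{: cube}|%:R) -(rmorph_nat (real_complex R)) card_cube.
by rewrite -rmorphM mulVf ?gt_eqF ?cubevol_gt0.
Qed.

(** Gives access to the positivity of the kernel. It asks only for a bounded measurable [h], so it
    also applies to products with a non-smooth [fseries]. *)
Lemma fejer_sum_conv h w : cmeasurable h -> (exists M, forall v, normc (h v) <= M) ->
  fejer_sum h w = cintegral haarn (fun t => h t * (fejer_kernel (w - t))%:C).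
Proof.
move=> mh [M hM].
have ic l : cintegrable haarn (fun t => h t * chi l (w - t)).
  apply: (@cintegrable_bounded _ _ _ _ _ M).
    apply: cmeasurableM => //; under eq_fun do rewrite chiDr chiNr.
    by apply: cmeasurableM; [exact: cmeasurable_cst|exact: cmeasurable_chi].
  by move=> t; rewrite normcM normc_chi mulr1.
rewrite /fejer_sum.
transitivity (cintegral haarn (fun t => (cubevol^-1)%:C *
  \sum_(a : cube) \sum_(b : cube) h t * chi (cubept a - cubept b) (w - t))); last first.
  apply: eq_cintegral => t; rewrite fejer_kernelE mulrCA; congr (_ * _).
  by rewrite mulr_sumr; apply: eq_bigr => a _; rewrite mulr_sumr.
rewrite cintegralZ; last first.
  by apply: cintegrable_sum => a; exact: cintegrable_sum.
congr (_ * _); rewrite cintegral_sum; last by move=> a; exact: cintegrable_sum.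
apply: eq_bigr => a _; rewrite cintegral_sum//.
apply: eq_bigr => b _; set l := (_ - _).
rewrite /fcoef -cintegralZr; last first.
  apply: (@cintegrable_bounded _ _ _ _ _ M).
    by apply: cmeasurableM => //; exact: cmeasurable_chi.
  by move=> t; rewrite normcM normc_chi mulr1.
by apply: eq_cintegral => t; rewrite chiDr chiNr -mulrA [chi (- l) t * _]mulrC.
Qed.

End fejer.

(** * A periodic gauge of distance on the torus *)

Section torus_distance.
Context (R : realType) (n : nat).

Lemma cos2pi_int (x : R) (z : int) : cos (2 * pi * (x - z%:~R)) = cos (2 * pi * x).
Proof.
have : complex.Re (e2pi (x - z%:~R)) = complex.Re (e2pi x).
  by rewrite e2piD -[- _]/(- z%:~R) -mulrNz e2pi_int mulr1.
by [].
Qed.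

(** A periodic stand-in for the distance to the integers. Being built from the first harmonic, its
    integral against the Fejer kernel is a count of lattice pairs. *)
Definition cosgap (d : R) : R := 1 - cos (2 * pi * d).

Lemma cosgap_ge0 d : 0 <= cosgap d.
Proof. by rewrite subr_ge0 cos_le1. Qed.

Lemma cosgap_gt0 d : 0 < d -> d <= 2^-1 -> 0 < cosgap d.
Proof.
move=> d0 d1; rewrite subr_gt0 -[ltRHS](@cos0 R).
have p0 := pi_gt0 R.
have : 2 * pi * d <= 2 * pi * 2^-1 :> R by rewrite ler_wpM2l ?mulr_ge0// ltW.
have -> : 2 * pi * 2^-1 = pi :> R by field.
move=> dp; rewrite ltr_cos ?in_itv/= ?lexx ?dp ?(ltW p0) ?mulr_gt0//.
by rewrite !mulr_ge0// ltW.
Qed.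

(** With z the nearest integer, either |x - z| <= d and the first term is enough, or
    [cosgap x >= cosgap d] by monotonicity of [cos] on [0, pi] and the second term is at least 1. *)
Lemma cosgap_dist (d : R) : 0 < d -> d <= 2^-1 -> forall x : R, exists z : int,
  `|x - z%:~R| <= d + (cosgap d)^-1 * cosgap x.
Proof.
move=> d0 d1 x; exists (Num.floor (x + 2^-1)); set z := Num.floor _.
have xz : `|x - z%:~R| <= 2^-1.
  have := floor_le (x + 2^-1); have := floorD1_gt (x + 2^-1).
  by rewrite -/z intrD ler_norml; lra.
have cd := cosgap_gt0 d0 d1.
have g0 : 0 <= (cosgap d)^-1 * cosgap x by rewrite mulr_ge0 ?cosgap_ge0// invr_ge0 ltW.
have [xd|dx] := leP `|x - z%:~R| d; first by rewrite (le_trans xd)// lerDl.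
apply: (@le_trans _ _ 1); first by rewrite (le_trans xz)//; lra.
suff : 1 <= (cosgap d)^-1 * cosgap x by move=> h; rewrite (le_trans h)// lerDr ltW.
rewrite ler_pdivlMl// mulr1 lerD2l lerN2.
rewrite -(cos2pi_int x z); set y := x - z%:~R in xz dx *.
have -> : cos (2 * pi * y) = cos (2 * pi * `|y|).
  by have [y0|y0] := leP 0 y; [rewrite ger0_norm|rewrite ltr0_norm// mulrN cosN].
have p0 := pi_gt0 R.
have half v : v <= 2^-1 -> 2 * pi * v <= pi :> R.
  move=> v1; have : 2 * pi * v <= 2 * pi * 2^-1 :> R by rewrite ler_wpM2l ?mulr_ge0// ltW.
  by rewrite (_ : 2 * pi * 2^-1 = pi)//; field.
rewrite ltW// ltr_cos ?in_itv/= ?mulr_ge0 ?half ?(ltW d0) ?(ltW p0)//.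
by rewrite ltr_pM2l// mulr_gt0.
Qed.

Implicit Types (h : Rn R n -> R[i]) (w v t a : Rn R n) (i : 'I_n).

Let torus_path w t (m : nat) : Rn R n := \row_i (if (i < m)%N then t ord0 i else w ord0 i).

(** The path from [w] to [t] changes one coordinate at a time, and each change costs the Lipschitz
    constant [2 * M] times a distance modulo 1, which [cosgap_dist] controls. The bound is linear in
    [cosgap], ready to be integrated against the kernel. *)
Lemma smooth_modulus h M (d : R) : tsmooth h ->
  (forall i w, normc (pderiv i h w) <= M) -> 0 < d -> d <= 2^-1 ->
  forall w t, normc (h t - h w) <=
    2 * M * (n%:R * d) + 2 * M * (cosgap d)^-1 * \sum_i cosgap (w ord0 i - t ord0 i).
Proof.
move=> [sh ph] dM d0 d1 w t.
pose B i := 2 * M * (d + (cosgap d)^-1 * cosgap (w ord0 i - t ord0 i)).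
have step (m : nat) : (m <= n)%N ->
    normc (h (torus_path w t m) - h w) <= \sum_(i < n | (i < m)%N) B i.
  elim: m => [_|m ih mn].
    rewrite (_ : torus_path w t 0 = w) ?subrr ?normc0 ?big_pred0//.
    by apply/rowP => i; rewrite mxE.
  pose i0 := Ordinal mn.
  rewrite (bigD1 i0)//= (eq_bigl (fun i : 'I_n => (i < m)%N)); last first.
    move=> i; rewrite ltnS -val_eqE/=; case: ltngtP => //.
  rewrite -(subrK (h (torus_path w t m)) (h (torus_path w t m.+1))) -addrA.
  rewrite (le_trans (le_normcD _ _))// lerD//; last exact/ih/ltnW.
  have [z hz] := cosgap_dist d0 d1 (w ord0 i0 - t ord0 i0).
  (* By periodicity the step may be shortened by the integer [z] nearest to the displacement. *)
  have -> : h (torus_path w t m.+1) =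
      h (torus_path w t m + (t ord0 i0 - w ord0 i0 + z%:~R) *: Rn_e R i0).
    rewrite scalerDl addrA periodicT_int//; congr h; apply/rowP => i; rewrite !mxE eqxx/=.
    rewrite ltnS -val_eqE/=; case: (ltngtP i m) => [im|im|im].
    - by rewrite mulr0 addr0.
    - by rewrite mulr0 addr0.
    - have -> : i = i0 by exact/val_inj.
      by rewrite mulr1 addrCA subrr addr0.
  apply: le_trans (smooth_lipschitz sh (dM i0) _ _) _.
  have M0 : 0 <= M by apply: le_trans (dM i0 0); exact: normc_ge0.
  rewrite ler_wpM2l ?mulr_ge0//.
  by rewrite (_ : _ + _ = - (w ord0 i0 - t ord0 i0 - z%:~R)) ?normrN//; ring.
have := step n (leqnn n).
have -> : torus_path w t n = t by apply/rowP => i; rewrite mxE ltn_ord.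
move=> /le_trans; apply; rewrite (eq_bigl xpredT); last by move=> i; rewrite ltn_ord.
rewrite -mulr_sumr big_split/= sumr_const card_ord -mulr_sumr mulrDr -[d *+ n]mulr_natl.
by rewrite !mulrA.
Qed.

End torus_distance.

(** * Rate of convergence of Fejer means *)

Section fejer_approximation.
Context (R : realType) (n : nat).
Implicit Types (h : Rn R n -> R[i]) (w v t a : Rn R n) (i : 'I_n) (k l : Zn n).
Local Notation haarn := (haar R n).
Variable K : nat.
Local Notation cube := {ffun 'I_n -> 'I_K.+1}.
Local Notation FK := (@fejer_kernel R n K).

Let cmeasurable_kernel w : cmeasurable (fun t => (FK (w - t))%:C).
Proof.
rewrite (_ : (fun t => _) = (fun t => ((cubevol R n K)^-1)%:C * \sum_(a : cube)
    \sum_(b : cube) chi (cubept a - cubept b) w * chi (- (cubept a - cubept b)) t)).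
  apply: cmeasurableM; first exact: cmeasurable_cst.
  apply: cmeasurable_sum => a _; apply: cmeasurable_sum => b _.
  by apply: cmeasurableM; [exact: cmeasurable_cst|exact: cmeasurable_chi].
apply/funext => t; rewrite fejer_kernelE; congr (_ * _).
by apply: eq_bigr => a _; apply: eq_bigr => b _; rewrite chiDr chiNr.
Qed.

Let measurable_kernel w : measurable_fun setT (fun t => FK (w - t)).
Proof. by have [] := cmeasurable_kernel w. Qed.

Lemma kernel_bounded : exists B, forall t, normc ((FK t)%:C) <= B.
Proof.
exists ((cubevol R n K)^-1 * (\sum_(a : cube) 1) ^+ 2) => t.
rewrite normc_real ger0_norm ?fejer_kernel_ge0//.
rewrite ler_wpM2l ?invr_ge0 ?(ltW (cubevol_gt0 _ _ _))//.
rewrite lerXn2r ?nnegrE ?normc_ge0 ?sumr_ge0//.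
rewrite (le_trans (normc_sum _ _ _))//.
by apply: ler_sum => a _; rewrite normc_chi.
Qed.

Lemma cintegrable_kernel w : cintegrable haarn (fun t => (FK (w - t))%:C).
Proof.
have [B hB] := kernel_bounded.
by apply: (@cintegrable_bounded _ _ _ _ _ B).
Qed.

Lemma integral_kernel w : (\int[haarn]_t (FK (w - t))%:E = 1)%E.
Proof.
have := cintegral_fejer K w; rewrite /cintegral/= => -[+ _].
by rewrite /Rintegral; case: integral => [r /= ->//||] /eqP; rewrite eq_sym oner_eq0.
Qed.

Let unitv i : Zn n := delta_mx ord0 i.

Let zdot_unitv i w : zdot (unitv i) w = w ord0 i.
Proof.
rewrite /zdot (bigD1 i)//= mxE !eqxx mul1r big1 ?addr0// => j ji.
by rewrite mxE (negbTE ji) andbF mul0r.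
Qed.

(** The partner of [a] is [a] moved one step up in direction [i]; it lies in the cube unless
    [a i = K], which excludes a fraction 1/(K+1) of the points. *)
Let cube_count i :
  (cubevol R n K) * (1 - K.+1%:R^-1) <=
  \sum_(a : cube) \sum_(b : cube) (cubept a - cubept b + unitv i == 0)%:R.
Proof.
(* The indicator of [a i < K] written as a product over coordinates, so that the sum over the cube
   factors. *)
pose f (j : 'I_n) (c : 'I_K.+1) : R := if j == i then (c < K)%:R else 1.
have K0 : (0 : R) < K.+1%:R by [].
have -> : cubevol R n K * (1 - K.+1%:R^-1) = \sum_(a : cube) \prod_(j < n) f j (a j).
  rewrite -(bigA_distr_bigA f) (bigD1 i)//= [X in _ = _ * X](eq_bigr (fun=> K.+1%:R)); last first.
    move=> j ji; rewrite /f (negbTE ji) sumr_const card_ord.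
    by rewrite -mulr_natr mul1r.
  rewrite prodr_const.
  have -> : \sum_(c < K.+1) f i c = K%:R.
    rewrite big_ord_recr/= /f eqxx ltnn addr0 (eq_bigr (fun=> 1)) ?sumr_const ?card_ord//.
    by move=> c _; rewrite [widen_ord _ _]/= (_ : (_ < _)%N = true)//; exact: (ltn_ord c).
  have -> : cubevol R n K = K.+1%:R * K.+1%:R ^+ #|(fun j : 'I_n => j != i)|.
    rewrite -exprS /cubevol; congr (_ ^+ _).
    rewrite -[LHS](card_ord n) (cardD1 i) inE add1n; congr _.+1.
    by apply: eq_card => j; rewrite !inE andbT.
  rewrite mulrAC; congr (_ * _).
  by rewrite mulrBr mulr1 divff ?gt_eqF// -natr1 addrK.
apply: ler_sum => a _.
have [ai|ai] := ltnP (a i) K; last first.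
  rewrite (bigD1 i)//= /f eqxx ltnNge ai mul0r sumr_ge0//.
pose b : cube := [ffun j => if j == i then inord (a i).+1 else a j].
rewrite (bigD1 b)//= (_ : _ == 0) /=; last first.
  apply/eqP/rowP => j; rewrite !mxE ffunE eqxx/=; case: eqVneq => [->|ji].
    by rewrite inordK//; lia.
  by rewrite addr0 subrr.
rewrite (le_trans (_ : _ <= 1))//; last by rewrite lerDl sumr_ge0.
apply: prodr_ile1 => j _; rewrite /f; case: ifP => _; rewrite ?ler01 ?lexx//.
by case: (_ < _)%N; rewrite ?ler01 ?lexx.
Qed.

(** The kernel has mass one, and by [cube_count] its first coefficient in direction [i] is at least
    1 - 1/(K+1); the integral is the difference of the two. *)
Lemma integral_kernel_cosgap i w :
  (\int[haarn]_t (FK (w - t) * cosgap (w ord0 i - t ord0 i))%:E <= (K.+1%:R^-1)%:E)%E.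
Proof.
have v0 := cubevol_gt0 R n K.
have ik := cintegrable_kernel w.
have [B hB] := kernel_bounded.
have ikc : cintegrable haarn (fun t => (FK (w - t))%:C * chi (unitv i) (w - t)).
  apply: (@cintegrable_bounded _ _ _ _ _ B); last first.
    by move=> t; rewrite normcM normc_chi mulr1.
  apply: cmeasurableM => //; under eq_fun do rewrite chiDr chiNr.
  by apply: cmeasurableM; [exact: cmeasurable_cst|exact: cmeasurable_chi].
have := cintegralB ik ikc.
rewrite cintegral_fejer cintegral_fejer_chi => /(congr1 (@complex.Re R)).
rewrite /cintegral/=.
have -> : (\int[haarn]_t complex.Re ((FK (w - t))%:C - (FK (w - t))%:C * chi (unitv i) (w - t))
   = \int[haarn]_t (FK (w - t) * cosgap (w ord0 i - t ord0 i)))%R.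
  apply: eq_Rintegral => t _; rewrite cReD cReN cReM/= mul0r subr0 /cosgap mulrBr mulr1.
  by rewrite zdot_unitv !mxE.
move=> E.
have iE : haarn.-integrable setT (fun t => (FK (w - t) * cosgap (w ord0 i - t ord0 i))%:E).
  have [+ _] := cintegrableB ik ikc; apply: eq_integrable => // t _.
  rewrite cReD cReN cReM/= mul0r subr0 /cosgap mulrBr mulr1.
  by rewrite zdot_unitv !mxE.
rewrite -[leLHS]fineK; last exact: integrable_fin_num.
rewrite lee_fin; move: E; rewrite /Rintegral => ->.
rewrite cReD cReN cReM/= mul0r subr0 lerBlDl -lerBlDr.
have -> : complex.Re (\sum_(a : cube) \sum_(b : cube) (cubept a - cubept b + unitv i == 0)%:R) =
   \sum_(a : cube) \sum_(b : cube) (cubept a - cubept b + unitv i == 0)%:R :> R.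
  rewrite (_ : \sum_(a : cube) _ = (\sum_(a : cube) \sum_(b : cube)
    (cubept a - cubept b + unitv i == 0)%:R)%:C)//.
  rewrite rmorph_sum; apply: eq_bigr => a _; rewrite rmorph_sum.
  by apply: eq_bigr => b _; rewrite rmorph_nat.
by rewrite mulrC ler_pdivlMr// mulrC cube_count.
Qed.

Lemma normc_fejer_sum_le h w M : cmeasurable h -> (forall v, normc (h v) <= M) ->
  normc (fejer_sum K h w) <= M.
Proof.
move=> mh hM; rewrite fejer_sum_conv//; last by exists M.
have M0 : 0 <= M by apply: le_trans (hM 0); exact: normc_ge0.
have [B hB] := kernel_bounded.
rewrite -lee_fin (le_trans (le_normc_cintegral _))//.
  apply: (@cintegrable_bounded _ _ _ _ _ (M * B)).
    exact: cmeasurableM.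
  by move=> t; rewrite normcM ler_pM ?normc_ge0.
apply: (@le_trans _ _ (\int[haarn]_t (M%:E * (FK (w - t))%:E))%E).
  apply: ge0_le_integral => //.
  - by move=> t _; rewrite lee_fin normc_ge0.
  - by apply: cmeasurable_normcE; exact: cmeasurableM.
  - by apply: measurable_funeM; exact/measurable_EFinP.
  - move=> t _; rewrite -EFinM lee_fin normcM normc_real ger0_norm ?fejer_kernel_ge0//.
    by rewrite ler_wpM2r ?fejer_kernel_ge0.
rewrite ge0_integralZl//.
- by rewrite integral_kernel mule1.
- exact/measurable_EFinP.
- by move=> t _; rewrite lee_fin fejer_kernel_ge0.
Qed.

(** The modulus of continuity at [w] is integrated against the positive kernel: [e] meets mass one,
    and each of the [n] gaps contributes at most 1/(K+1). *)
Lemma fejer_approx h w M e A : cmeasurable h -> (forall v, normc (h v) <= M) ->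
  0 <= e -> 0 <= A ->
  (forall t, normc (h t - h w) <= e + A * \sum_i cosgap (w ord0 i - t ord0 i)) ->
  normc (fejer_sum K h w - h w) <= e + A * (n%:R / K.+1%:R).
Proof.
move=> mh hM e0 A0 hmod; rewrite fejer_sum_conv//; last by exists M.
have M0 : 0 <= M by apply: le_trans (hM 0); exact: normc_ge0.
have [B hB] := kernel_bounded.
have ik := cintegrable_kernel w.
have ihk : cintegrable haarn (fun t => h t * (FK (w - t))%:C).
  apply: (@cintegrable_bounded _ _ _ _ _ (M * B)); first exact: cmeasurableM.
  by move=> t; rewrite normcM ler_pM ?normc_ge0.
rewrite -[h w in X in normc X]mulr1 -[in X in normc X](cintegral_fejer K w).
rewrite -cintegralZ// -cintegralB//; last exact: cintegrableZ.
have icgap i : measurable_fun setT (fun t => (FK (w - t) * cosgap (w ord0 i - t ord0 i))%:E).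
  apply/measurable_EFinP; apply: measurable_funM => //.
  have mc : measurable_fun setT (fun t : Rn R n => 2 * pi * (w ord0 i - t ord0 i)).
    apply: measurable_funM => //; apply: measurable_funB => //.
    exact: measurable_Rn_coord.
  apply: measurable_funB => //.
  apply: (measurableT_comp (f := @cos R)) => //.
  by apply: continuous_measurable_fun; exact: continuous_cos.
have mk : measurable_fun setT (fun t => (FK (w - t))%:E) by exact/measurable_EFinP.
rewrite -lee_fin (le_trans (le_normc_cintegral (cintegrableB ihk (cintegrableZ _ ik))))//.
apply: (@le_trans _ _ (\int[haarn]_t (e%:E * (FK (w - t))%:E +
    A%:E * \sum_i (FK (w - t) * cosgap (w ord0 i - t ord0 i))%:E))%E).
  apply: ge0_le_integral => //.
  - by move=> t _; rewrite lee_fin normc_ge0.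
  - by have /cintegrableP[/cmeasurable_normcE] := cintegrableB ihk (cintegrableZ (h w) ik).
  - apply: emeasurable_funD; first exact: measurable_funeM.
    by apply: measurable_funeM; exact: emeasurable_sum.
  - move=> t _; rewrite sumEFin -!EFinM -EFinD lee_fin -mulrBl normcM normc_real.
    rewrite ger0_norm ?fejer_kernel_ge0// -mulr_sumr.
    rewrite (_ : _ + _ = (e + A * \sum_i cosgap (w ord0 i - t ord0 i)) * FK (w - t)).
      by rewrite ler_wpM2r ?fejer_kernel_ge0.
    by ring.
have kg0 i t : (0 <= (FK (w - t) * cosgap (w ord0 i - t ord0 i))%:E)%E.
  by rewrite lee_fin mulr_ge0 ?fejer_kernel_ge0 ?cosgap_ge0.
rewrite ge0_integralD//; last 4 first.
- by move=> t _; rewrite -EFinM lee_fin mulr_ge0 ?fejer_kernel_ge0.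
- exact: measurable_funeM.
- by move=> t _; rewrite mule_ge0 ?lee_fin// sume_ge0.
- by apply: measurable_funeM; exact: emeasurable_sum.
rewrite ge0_integralZl//; last by move=> t _; rewrite lee_fin fejer_kernel_ge0.
rewrite integral_kernel mule1 ge0_integralZl//; last 2 first.
- exact: emeasurable_sum.
- by move=> t _; exact: sume_ge0.
rewrite ge0_integral_sum// EFinD leeD2l// EFinM lee_wpmul2l ?lee_fin//.
apply: (@le_trans _ _ (\sum_(i < n) (K.+1%:R^-1)%:E)%E).
  by apply: lee_sum => i _; exact: integral_kernel_cosgap.
by rewrite sumEFin lee_fin sumr_const card_ord mulr_natl.
Qed.

End fejer_approximation.

Section fejer_smooth.
Context (R : realType) (n : nat).
Implicit Types (h : Rn R n -> R[i]) (w : Rn R n) (i : 'I_n) (l : Zn n) (s : seq 'I_n).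

Lemma is_cderive_sum (I : Type) (r : seq I) (f : I -> Rn R n -> R[i]) (df : I -> R[i]) w i :
  (forall j, is_cderive w i (f j) (df j)) ->
  is_cderive w i (fun v => \sum_(j <- r) f j v) (\sum_(j <- r) df j).
Proof.
move=> fd; elim: r => [|j r ih].
  rewrite big_nil (_ : (fun v => _) = (fun=> 0)); first exact: is_cderive_cst.
  by apply/funext => v; rewrite big_nil.
rewrite big_cons (_ : (fun v => _) = (fun v => f j v + \sum_(j <- r) f j v)).
  exact: is_cderiveD.
by apply/funext => v; rewrite big_cons.
Qed.

Variable K : nat.

(** Both sides multiply the coefficient at l by [dchi R l i]. Approximating derivatives is thus the
    same as approximating functions. *)
Lemma pderiv_fejer_sum h i M : tsmooth h -> dbound 1 h M ->
  pderiv i (fejer_sum K h) = fejer_sum K (pderiv i h).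
Proof.
move=> th bh; apply/funext => w; apply: pderiv_val.
apply: is_cderiveZ; apply: is_cderive_sum => a; apply: is_cderive_sum => b.
set l := (_ - _); have := is_cderiveZ (fcoef h l) (is_cderive_chi w i l).
by rewrite (fcoef_pderiv i l th bh) mulrA [fcoef h l * _]mulrC.
Qed.

Lemma pderivs_fejer_sum h s : tsmooth h -> (forall N, exists M, dbound N h M) ->
  pderivs s (fejer_sum K h) = fejer_sum K (pderivs s h).
Proof.
move=> [sh ph] bh; elim: s => [//|i s ih] /=; rewrite ih.
have [M hM] := bh (size s).+1.
apply: (@pderiv_fejer_sum _ _ M).
  by split; [exact: smooth_pderivs|exact: periodic_pderivs].
move=> t w t1; rewrite /pderivs -foldr_cat; apply: hM.
by rewrite size_cat -add1n leq_add.
Qed.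

End fejer_smooth.

(** * Schwartz functions and distributions on the product group *)

Section schwartz_functions.
Context (R : realType) (n : nat).
Implicit Types (h : Rn R n -> R[i]) (w : Rn R n) (i : 'I_n) (j l : Zn n) (s : seq 'I_n).
Implicit Types (phi psi : Zn n * Rn R n -> R[i]).

(** A real bound for the seminorm [seminormZT], free of suprema and of finiteness side
    conditions. *)
Definition ztbound (N : nat) phi (M : R) := forall j s w, (size s <= N)%N ->
  (1 + zabs R j) ^+ N * normc (pderivs s (fun w => phi (j, w)) w) <= M.

Lemma zabs1_gt0 j : 0 < 1 + zabs R j.
Proof. by rewrite ltr_wpDr// zabs_ge0. Qed.

Lemma zabs1_ge1 j : 1 <= 1 + zabs R j.
Proof. by rewrite lerDl zabs_ge0. Qed.

Lemma ztbound_ge0 N phi M : ztbound N phi M -> 0 <= M.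
Proof.
move=> /(_ 0 [::] 0 isT); apply: le_trans.
by rewrite mulr_ge0 ?normc_ge0// exprn_ge0// ltW// zabs1_gt0.
Qed.

Lemma ztbound_seminorm N phi M : ztbound N phi M -> (seminormZT N phi <= M%:E)%E.
Proof.
by move=> bphi; apply: ge_ereal_sup => _ [[[j w] s] /= sN <-]; rewrite lee_fin; exact: bphi.
Qed.

Lemma seminorm_ztbound N phi : (seminormZT N phi < +oo)%E -> exists M, ztbound N phi M.
Proof.
move=> soo.
have h j s w : (size s <= N)%N -> (((1 + zabs R j) ^+ N *
   normc (pderivs s (fun w => phi (j, w)) w))%:E <= seminormZT N phi)%E.
  by move=> sN; apply: ereal_sup_ubound; exists ((j, w), s).
exists (fine (seminormZT N phi)) => j s w sN; rewrite -lee_fin fineK; first exact: h.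
rewrite ge0_fin_numE//; apply: le_trans (h 0 [::] 0 isT); rewrite lee_fin.
by rewrite mulr_ge0 ?normc_ge0// exprn_ge0// ltW// zabs1_gt0.
Qed.

Lemma ztbound_dbound N phi M j : ztbound N phi M ->
  dbound N (fun w => phi (j, w)) (M / (1 + zabs R j) ^+ N).
Proof.
move=> bphi s w sN; rewrite ler_pdivlMr ?exprn_gt0 ?zabs1_gt0// mulrC.
exact: bphi.
Qed.

Lemma schwartz_tsmooth phi j : schwartzZT phi -> tsmooth (fun w => phi (j, w)).
Proof. by move=> [pphi sphi _]; split; [exact: sphi|exact: pphi]. Qed.

Lemma schwartz_ztbound N phi : schwartzZT phi -> exists M, ztbound N phi M.
Proof. by move=> [_ _ /(_ N)]; exact: seminorm_ztbound. Qed.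

Lemma schwartzP phi : (forall j, tsmooth (fun w => phi (j, w))) ->
  (forall N, exists M, ztbound N phi M) -> schwartzZT phi.
Proof.
move=> tphi bphi; split=> [j|j|N]; [by have [] := tphi j|by have [] := tphi j|].
by have [M /ztbound_seminorm hM] := bphi N; rewrite (le_lt_trans hM)// ltry.
Qed.

Lemma ztbound_lin N c phi psi M M' : schwartzZT phi -> schwartzZT psi ->
  ztbound N phi M -> ztbound N psi M' ->
  ztbound N (fun x => c * phi x + psi x) (normc c * M + M').
Proof.
move=> sphi spsi b1 b2 j s w sN.
have [s1 _] := schwartz_tsmooth j sphi; have [s2 _] := schwartz_tsmooth j spsi.
rewrite (pderivs_lin s c s1 s2)/=.
apply: (@le_trans _ _ ((1 + zabs R j) ^+ N *
  (normc c * normc (pderivs s (fun w => phi (j, w)) w) +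
   normc (pderivs s (fun w => psi (j, w)) w)))).
  by rewrite ler_wpM2l ?exprn_ge0 ?(ltW (zabs1_gt0 _))// -normcM le_normcD.
rewrite mulrDr lerD//; last exact: b2.
by rewrite mulrCA ler_wpM2l ?normc_ge0//; exact: b1.
Qed.

Lemma schwartz_lin c phi psi : schwartzZT phi -> schwartzZT psi ->
  schwartzZT (fun x => c * phi x + psi x).
Proof.
move=> sphi spsi; apply: schwartzP => [j|N].
  have [s1 p1] := schwartz_tsmooth j sphi; have [s2 p2] := schwartz_tsmooth j spsi.
  split; last by move=> i w; rewrite p1 p2.
  by apply: smoothD => //; exact: smoothZ.
have [M1 h1] := schwartz_ztbound N sphi; have [M2 h2] := schwartz_ztbound N spsi.
by eexists; exact: ztbound_lin h1 h2.
Qed.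

Lemma schwartz0 : schwartzZT (fun _ : Zn n * Rn R n => 0 : R[i]).
Proof.
apply: schwartzP => [j|N]; first by split=> //; exact: smooth0.
by exists 0 => j s w sN; rewrite pderivs0 normc0 mulr0.
Qed.

Lemma schwartz_sum (I : Type) (r : seq I) (c : I -> R[i]) (phi : I -> Zn n * Rn R n -> R[i]) :
  (forall k, schwartzZT (phi k)) -> schwartzZT (fun x => \sum_(k <- r) c k * phi k x).
Proof.
move=> sphi; elim: r => [|k r ih].
  by under eq_fun do rewrite big_nil; exact: schwartz0.
by under eq_fun do rewrite big_cons; exact: schwartz_lin.
Qed.

Definition ztsingle j h (x : Zn n * Rn R n) : R[i] := if x.1 == j then h x.2 else 0.

Lemma schwartz_single j h : tsmooth h -> (forall N, exists M, dbound N h M) ->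
  schwartzZT (ztsingle j h).
Proof.
move=> [sh ph] bh; rewrite /ztsingle; apply: schwartzP => [k|N] /=.
  by case: eqP => _; split=> //; exact: smooth0.
have [M hM] := bh N; exists ((1 + zabs R j) ^+ N * M) => k s w sN /=.
case: eqP => [->|_].
  by rewrite ler_wpM2l ?exprn_ge0 ?(ltW (zabs1_gt0 _))//; exact: hM.
rewrite pderivs0 normc0 mulr0 mulr_ge0 ?(dbound_ge0 hM)//.
by rewrite exprn_ge0// ltW// zabs1_gt0.
Qed.

Lemma dbound_chi N l : exists M, dbound N (chi l : Rn R n -> R[i]) M.
Proof.
have b1 : dbound N (fun _ : Rn R n => 1 : R[i]) 1.
  move=> s w _; case: s => [|i s].
    by change (normc (1%:C : R[i]) <= 1); rewrite normc_real normr1.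
  suff -> : pderivs (i :: s) (fun=> 1 : R[i]) w = 0 by rewrite normc0.
  rewrite [pderivs _ _]/=.
  have [c ->] : exists c, pderivs s (fun _ : Rn R n => 1 : R[i]) = (fun=> c).
    elim: s => [|k s [c ih]] /=; first by exists 1.
    by exists 0; rewrite ih; apply/funext => v; apply: pderiv_val; exact: is_cderive_cst.
  by apply: pderiv_val; exact: is_cderive_cst.
exists (chi_growth R l ^+ N * 1); have := dbound_chiM l (@smooth_cst R n 1) b1.
by rewrite (_ : (fun w => _) = chi l)//; apply/funext => w; rewrite mulr1.
Qed.

Lemma tsmooth_chi l : tsmooth (chi l : Rn R n -> R[i]).
Proof. by split; [exact: smooth_chi|exact: periodic_chi]. Qed.

(** A point mass in the lattice variable times a character: the elementary test functions whose
    finite combinations approximate all others. *)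
Definition ztexp j l := ztsingle j (chi l).

Lemma schwartz_exp j l : schwartzZT (ztexp j l).
Proof. by apply: schwartz_single; [exact: tsmooth_chi|move=> N; exact: dbound_chi]. Qed.

(* Truncation to a box in the lattice variable and Fejer summation in the
   torus variable. *)
Section trigonometric_approximation.
Variable K : nat.
Local Notation cube := {ffun 'I_n -> 'I_K.+1}.
Local Notation idx := ({ffun 'I_n -> 'I_(K.*2.+1)} * (cube * cube))%type.

Definition idxl (i : idx) : Zn n := cubept i.2.1 - cubept i.2.2.

Definition ztapprox phi (x : Zn n * Rn R n) : R[i] := \sum_(i : idx)
  ((cubevol R n K)^-1)%:C * fcoef (fun w => phi (boxpt i.1, w)) (idxl i) *
  ztexp (boxpt i.1) (idxl i) x.

Lemma ztapproxE phi j w : ztapprox phi (j, w) =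
  if inbox K j then fejer_sum K (fun w => phi (j, w)) w else 0.
Proof.
rewrite /ztapprox -(pair_bigA _ (fun a (b : cube * cube) =>
  ((cubevol R n K)^-1)%:C * fcoef (fun w => phi (boxpt a, w)) (cubept b.1 - cubept b.2) *
  ztexp (boxpt a) (cubept b.1 - cubept b.2) (j, w)))/=.
case: ifPn => [/inboxP[a ->]|nj].
  rewrite (bigD1 a)//= [X in _ + X]big1 ?addr0; last first.
    move=> b ba; apply: big1 => c _; rewrite /ztexp /ztsingle/=.
    rewrite (_ : (_ == _) = false) ?mulr0//.
    by apply/eqP => /boxpt_inj/esym/eqP; rewrite (negbTE ba).
  rewrite -(pair_bigA _ (fun (b c : cube) =>
    ((cubevol R n K)^-1)%:C * fcoef (fun w => phi (boxpt a, w)) (cubept b - cubept c) *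
    ztexp (boxpt a) (cubept b - cubept c) (boxpt a, w)))/=.
  rewrite /fejer_sum mulr_sumr; apply: eq_bigr => b _; rewrite mulr_sumr.
  by apply: eq_bigr => c _; rewrite /ztexp /ztsingle/= eqxx mulrA.
apply: big1 => a _; apply: big1 => b _; rewrite /ztexp /ztsingle/=.
rewrite (_ : (_ == _) = false) ?mulr0//.
by apply: contraNF nj => /eqP ->; exact: inbox_boxpt.
Qed.

Lemma schwartz_ztapprox phi : schwartzZT (ztapprox phi).
Proof. by apply: schwartz_sum => i; exact: schwartz_exp. Qed.

End trigonometric_approximation.

(** [K0] depends on [e] alone, uniformly in [N] and [phi]. The lost order of the seminorm is spent
    twice: as one extra derivative for the Fejer rate inside the box, and as one extra power of the
    weight outside it. *)
Lemma ztapprox_le (e : R) : 0 < e -> exists K0, forall K, (K0 <= K)%N ->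
  forall N phi M, schwartzZT phi -> ztbound N.+1 phi M ->
    ztbound N (fun x => -1 * phi x + ztapprox K phi x) (e * M).
Proof.
(* Ensures that the [d] chosen below is at most 1/2, as the estimates on [cosgap] require. *)
wlog e1 : e / e <= 1.
  move=> h e0; have [e1|e1] := leP e 1; first exact: h.
  have [K0 hK0] := h 1 (lexx _) ltr01; exists K0 => K KK0 N phi M sphi bphi j s w sN.
  rewrite (le_trans (hK0 K KK0 N phi M sphi bphi j s w sN))// ler_wpM2r ?(ztbound_ge0 bphi)//.
  exact: ltW.
move=> e0.
have n1 : (1 : R) <= n.+1%:R by rewrite ler1n.
(* Chosen so that the term [2 * (n * d)] of the modulus of continuity is at most [e / 2]. *)
pose d : R := e / (4 * n.+1%:R).
have d0 : 0 < d by rewrite divr_gt0.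
have d1 : d <= 2^-1.
  by rewrite ler_pdivrMr ?mulr_gt0//; nra.
have c0 := cosgap_gt0 d0 d1.
(* The first summand is the factor of 1/(K+1) in the Fejer error; the extra 1 pays for the tail
   outside the box. *)
pose A : R := 2 * (cosgap d)^-1 * n%:R + 1.
have A0 : 0 < A by rewrite ltr_wpDl// !mulr_ge0// invr_ge0 ltW.
have [K0 _ hK0] := nbhs_infty_ger (2 * A / e).
exists K0 => K KK0 N phi M sphi bphi j s w sN.
have M0 := ztbound_ge0 bphi.
have K1 : A / K.+1%:R <= e / 2.
  have := hK0 K KK0; rewrite ler_pdivrMr// => hA.
  have : K%:R * e <= K.+1%:R * e by rewrite ler_wpM2r ?(ltW e0)// ler_nat.
  by rewrite ler_pdivrMr//; move: hA; lra.
have Kp : (0 : R) < K.+1%:R^-1 by rewrite invr_gt0.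
have [th1 th2] := schwartz_tsmooth j sphi.
have bd N' : exists M', dbound N' (fun w => phi (j, w)) M'.
  have [M' hM'] := schwartz_ztbound N' sphi; eexists; exact: ztbound_dbound hM'.
have z0 := zabs1_gt0 j.
have bj := ztbound_dbound j bphi.
set Mj := M / _ in bj.
have zMj : (1 + zabs R j) ^+ N * Mj <= M.
  rewrite /Mj mulrCA ler_piMr// exprS invfM mulrCA divff ?mulr1; last first.
    by rewrite gt_eqF// exprn_gt0.
  by rewrite invf_le1// zabs1_ge1.
clearbody Mj.
rewrite (pderivs_lin s (-1) th1); last by have [] := schwartz_tsmooth j (schwartz_ztapprox K phi).
rewrite mulN1r.
have [jK|jK] := boolP (inbox K j).
  have -> : (fun w => ztapprox K phi (j, w)) = fejer_sum K (fun w => phi (j, w)).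
    by apply/funext => v; rewrite ztapproxE jK.
  rewrite pderivs_fejer_sum//.
  set h := pderivs s (fun w => phi (j, w)).
  have sh : smooth h by exact: smooth_pderivs.
  have ph : periodicT h by exact: periodic_pderivs.
  have hM v : normc (h v) <= Mj by apply: bj; exact: leqW.
  have dM i v : normc (pderiv i h v) <= Mj by exact: (bj (i :: s)).
  have Mj0 : 0 <= Mj by exact: le_trans (normc_ge0 _) (hM 0).
  rewrite [- _ + _]addrC; have := @fejer_approx R n K h w Mj (2 * Mj * (n%:R * d))
    (2 * Mj * (cosgap d)^-1) (tsmooth_cmeasurable sh) hM.
  move=> /(_ _ _ (smooth_modulus (conj sh ph) dM d0 d1 w)) happ.
  apply: (@le_trans _ _ ((1 + zabs R j) ^+ N * (Mj * e))).
    rewrite ler_wpM2l ?exprn_ge0 ?(ltW z0)// (le_trans (happ _ _))//.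
    - by apply: mulr_ge0; [exact: mulr_ge0|apply: mulr_ge0 => //; exact: ltW].
    - by apply: mulr_ge0; [exact: mulr_ge0|rewrite invr_ge0; exact: ltW].
    have -> : 2 * Mj * (n%:R * d) + 2 * Mj / cosgap d * (n%:R / K.+1%:R) =
      Mj * (2 * (n%:R * d) + (A - 1) / K.+1%:R) by rewrite /A; ring.
    rewrite ler_wpM2l//.
    have : 2 * (n%:R * d) <= e / 2.
      rewrite /d mulrA mulrA ler_pdivrMr ?mulr_gt0//.
      have <- : n%:R + 1 = n.+1%:R :> R by rewrite natr1.
      have : 0 <= e * n%:R by rewrite mulr_ge0// ltW.
      by move: e0; lra.
    have -> : (A - 1) / K.+1%:R = A / K.+1%:R - K.+1%:R^-1 by rewrite mulrBl mul1r.
    by move=> h2; rewrite [leRHS]splitr lerD// (le_trans _ K1)// gerBl ltW.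
  by rewrite mulrA mulrC ler_wpM2l ?(ltW e0).
(* Outside the box the approximant vanishes, and the spare weight [1 + zabs R j] is at least
   [K + 1]. *)
have -> : (fun w => ztapprox K phi (j, w)) = (fun=> 0).
  by apply/funext => v; rewrite ztapproxE (negbTE jK).
rewrite pderivs0 addr0 normcN.
have := inbox_zabs R jK => Kz.
have h1 := bphi j s w (leqW sN).
have zK : K.+1%:R <= 1 + zabs R j by rewrite -natr1 addrC lerD2l.
have : K.+1%:R * ((1 + zabs R j) ^+ N * normc (pderivs s (fun w => phi (j, w)) w)) <= M.
  apply: le_trans h1; rewrite exprS -mulrA ler_wpM2r//.
  by rewrite mulr_ge0 ?normc_ge0// exprn_ge0// ltW.
rewrite mulrC -ler_pdivlMr// => /le_trans; apply; rewrite mulrC ler_wpM2r//.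
apply: le_trans (_ : A / K.+1%:R <= _); last first.
  by rewrite (le_trans K1)// ler_pdivrMr// ler_peMr ?ltW// ltr1n.
by rewrite ler_peMl ?(ltW Kp)// /A lerDr !mulr_ge0// invr_ge0 ltW.
Qed.

End schwartz_functions.

(** * Time-frequency shifts of the window as test functions *)

Section modulated_windows.
Context (R : realType) (n : nat).
Implicit Types (w eta omega xi : Rn R n) (j k l m : Zn n).
Variable G : Zn n * Rn R n -> R[i].
Hypothesis hG : schwartzZT G.

Definition ctfshift (z : (Zn n * Rn R n) * (Rn R n * Zn n)) (x : Zn n * Rn R n) : R[i] :=
  (tfshiftZT z.1 z.2 G x)^*.

(** What remains of a fiber of [ctfshift] once [omega] and [xi] are removed: they act only by a
    translation and by factors of modulus one. *)
Definition window_fiber m k j (v : Rn R n) : R[i] := chi (- k) v * (G (j - m, v))^*.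

Lemma ctfshiftE m omega xi k j eta : ctfshift ((m, omega), (xi, k)) (j, eta) =
  chi (- j) xi * chi (- k) omega * window_fiber m k j (eta - omega).
Proof.
rewrite /ctfshift /tfshiftZT/= !rmorphM/= -!/(chi _ _) !chi_conj /window_fiber.
rewrite -!mulrA; congr (_ * _); rewrite mulrA; congr (_ * _).
by rewrite -chiDr addrC subrK.
Qed.

Lemma smooth_window_fiber m k j : smooth (window_fiber m k j).
Proof.
by apply: smooth_chiM; apply: smooth_conj; have [] := schwartz_tsmooth (j - m) hG.
Qed.

Lemma ctfshift_tsmooth z j : tsmooth (fun eta => ctfshift z (j, eta)).
Proof.
case: z => -[m omega] [xi k].
rewrite (_ : (fun eta => _) = fun eta => chi (- j) xi * chi (- k) omega *
  window_fiber m k j (eta - omega)); last by apply/funext => eta; rewrite ctfshiftE.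
split; first by apply: smoothZ; apply: smooth_translate; exact: smooth_window_fiber.
move=> i w; congr (_ * _); rewrite /window_fiber addrAC periodic_chi.
by have [_ ->] := schwartz_tsmooth (j - m) hG.
Qed.

(** Uniformity in [omega] and [xi] is what permits averaging over both. The weight at [j] passes to
    [j - m] by 1 + |j| <= (1 + |m|)(1 + |j - m|). *)
Lemma ctfshift_ztbound N m k : exists M, forall omega xi,
  ztbound N (ctfshift ((m, omega), (xi, k))) M.
Proof.
have [M hM] := schwartz_ztbound N hG.
exists ((1 + zabs R m) ^+ N * (chi_growth R (- k) ^+ N * M)) => omega xi j s w sN.
rewrite (_ : (fun eta => _) = fun eta => chi (- j) xi * chi (- k) omega *
  window_fiber m k j (eta - omega)); last by apply/funext => eta; rewrite ctfshiftE.
rewrite pderivsZ; last by apply: smooth_translate; exact: smooth_window_fiber.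
rewrite (pderivs_translate s (window_fiber m k j)) !normcM !normc_chi !mul1r.
have [sG _] := schwartz_tsmooth (j - m) hG.
have bG := ztbound_dbound (j - m) hM.
have bGc : dbound N (fun v => (G (j - m, v))^*) (M / (1 + zabs R (j - m)) ^+ N).
  by move=> t v tN; rewrite pderivs_conj// normc_conj; exact: bG.
have := dbound_chiM (- k) (smooth_conj sG) bGc.
move=> /(_ s (w - omega) sN) h.
apply: (@le_trans _ _ (((1 + zabs R m) * (1 + zabs R (j - m))) ^+ N *
   (chi_growth R (- k) ^+ N * (M / (1 + zabs R (j - m)) ^+ N)))).
  apply: ler_pM => //; rewrite ?normc_ge0 ?exprn_ge0 ?(ltW (zabs1_gt0 _ _))//.
  rewrite lerXn2r ?nnegrE ?mulr_ge0 ?(ltW (zabs1_gt0 _ _))//.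
  have := zabsD R (j - m) m; rewrite subrK.
  have := zabs_ge0 R m; have := zabs_ge0 R (j - m).
  by move=> h1 h2 h3; rewrite mulrDl mul1r mulrDr mulr1; have := mulr_ge0 h2 h1; lra.
rewrite exprMn -mulrA ler_wpM2l ?exprn_ge0 ?(ltW (zabs1_gt0 _ _))//.
have z0 : (1 + zabs R (j - m)) ^+ N != 0 by rewrite gt_eqF// exprn_gt0// zabs1_gt0.
by rewrite mulrCA [X in _ * X]mulrCA divff// mulr1.
Qed.

Lemma ctfshift_schwartz z : schwartzZT (ctfshift z).
Proof.
apply: schwartzP => [j|N]; first exact: ctfshift_tsmooth.
by case: z => -[m omega] [xi k]; have [M hM] := ctfshift_ztbound N m k; exists M.
Qed.

(** Translation invariance separates the variables: [omega] and [xi] appear only through characters,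
    so an average against characters can single out one pair [(j, l)]. *)
Lemma fcoef_ctfshift m omega xi k j l :
  fcoef (fun eta => ctfshift ((m, omega), (xi, k)) (j, eta)) l =
  chi (- j) xi * chi (- (k + l)) omega * (fcoef (fun v => G (j - m, v)) (- (k + l)))^*.
Proof.
have [sG pG] := schwartz_tsmooth (j - m) hG.
have [M bG] : exists M, dbound 0 (fun v => G (j - m, v)) M.
  by have [M hM] := schwartz_ztbound 0 hG; eexists; exact: ztbound_dbound hM.
have mG := tsmooth_cmeasurable sG.
have iG : cintegrable (haar R n) (fun v => G (j - m, v) * chi (- - (k + l)) v).
  apply: (@cintegrable_bounded _ _ _ _ _ M).
    by apply: cmeasurableM => //; exact: cmeasurable_chi.
  by move=> v; rewrite normcM normc_chi mulr1; exact: (bG [::]).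
rewrite /fcoef -(cintegral_conj iG).
pose h v := (G (j - m, v) * chi (- - (k + l)) v)^*.
have ph : periodicT h by move=> i w; rewrite /h pG periodic_chi.
have mh : cmeasurable h by have /cintegrableP[/cmeasurable_conj] := iG.
rewrite -[X in _ * X](cintegral_haar_translate (- omega) mh ph).
have iht : cintegrable (haar R n) (fun w => h (w - omega)).
  apply: (@cintegrable_bounded _ _ _ _ _ M).
    exact: (cmeasurable_comp (measurable_Rn_translate _) mh).
  by move=> v; rewrite /h normc_conj normcM normc_chi mulr1; exact: (bG [::]).
rewrite -cintegralZ//; apply: eq_cintegral => eta.
rewrite ctfshiftE /window_fiber /h rmorphM/= chi_conj opprK.
have e1 : chi (- k) omega * chi (- k) (eta - omega) = chi (- k) eta.
  by rewrite -chiDr addrC subrK.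
have e2 : chi (- (k + l)) omega * chi (- (k + l)) (eta - omega) =
    chi (- k) eta * chi (- l) eta by rewrite -chiDr [omega + _]addrC subrK opprD chiDl.
transitivity (chi (- j) xi * (G (j - m, eta - omega))^* *
  (chi (- k) omega * chi (- k) (eta - omega)) * chi (- l) eta); first by ring.
by rewrite e1 -mulrA -e2; ring.
Qed.

End modulated_windows.

(** * Tempered functionals and their Fourier coefficients *)

Section tempered_functional.
Context (R : realType) (n : nat).
Implicit Types (w eta omega xi : Rn R n) (j k l m : Zn n).
Implicit Types (phi psi : Zn n * Rn R n -> R[i]).
Variable u : (Zn n * Rn R n -> R[i]) -> R[i].
Hypothesis hu : temperedZT u.

Lemma tempered_sum (I : Type) (r : seq I) (c : I -> R[i]) (phi : I -> Zn n * Rn R n -> R[i]) :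
  (forall i, schwartzZT (phi i)) ->
  u (fun x => \sum_(i <- r) c i * phi i x) = \sum_(i <- r) c i * u (phi i).
Proof.
have [ulin _] := hu => sphi.
have u0 : u (fun=> 0) = 0.
  have := ulin (-1) (fun=> 0) (fun=> 0) (@schwartz0 R n) (@schwartz0 R n).
  rewrite (_ : (fun x : Zn n * Rn R n => -1 * 0 + 0) = fun=> 0); last first.
    by apply/funext => x; rewrite mulr0 addr0.
  by rewrite mulN1r addNr.
elim: r => [|i r ih]; first by rewrite big_nil -[RHS]u0; congr u; apply/funext => x; rewrite big_nil.
rewrite big_cons -ih -ulin//; last exact: schwartz_sum.
by congr u; apply/funext => x; rewrite big_cons.
Qed.

Lemma tempered_bound : exists N B, 0 <= B /\ forall phi M, schwartzZT phi ->
  ztbound N phi M -> normc (u phi) <= B * M.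
Proof.
have [_ [N [B hB]]] := hu; exists N, `|B|; split=> // phi M sphi bphi.
rewrite -lee_fin (le_trans (hB _ sphi))// EFinM.
have s0 : (0 <= seminormZT N phi)%E.
  apply: (@le_trans _ _ ((1 + zabs R (0 : Zn n)) ^+ N *
     normc (pderivs [::] (fun w => phi (0, w)) 0))%:E).
    by rewrite lee_fin mulr_ge0 ?normc_ge0// exprn_ge0// ltW// zabs1_gt0.
  by apply: ereal_sup_ubound; exists ((0, 0), [::]).
rewrite (@le_trans _ _ (`|B|%:E * seminormZT N phi)%E)//.
  by rewrite lee_wpmul2r// lee_fin ler_norm.
by rewrite lee_wpmul2l ?lee_fin// ztbound_seminorm.
Qed.

(** Continuity of [u] costs a fixed order and a fixed factor, so the uniform threshold of
    [ztapprox_le] carries over to the values of [u]. *)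
Lemma tempered_approx : exists N, forall e, 0 < e -> exists K0, forall K, (K0 <= K)%N ->
  forall phi M, schwartzZT phi -> ztbound N phi M ->
  normc (u (ztapprox K phi) - u phi) <= e * M.
Proof.
have [N [B [B0 hB]]] := tempered_bound; have [ulin _] := hu.
exists N.+1 => e e0; have B1 : 0 < B + 1 by rewrite ltr_wpDl.
have [K0 hK0] := @ztapprox_le R n (e / (B + 1)) (divr_gt0 e0 B1).
exists K0 => K KK0 phi M sphi bphi.
have := hB _ _ (schwartz_lin (-1) sphi (schwartz_ztapprox K phi)) (hK0 K KK0 N phi M sphi bphi).
rewrite ulin//; last exact: schwartz_ztapprox.
rewrite mulN1r addrC => /le_trans; apply.
rewrite mulrA ler_wpM2r ?(ztbound_ge0 bphi)//.
by rewrite mulrA ler_pdivrMr// mulrC ler_wpM2l ?(ltW e0)// lerDl.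
Qed.

(** The pairing has no conjugation, so this is the Fourier coefficient at frequency [- l] in the
    fiber over [j], in agreement with the sign in [fseries]. *)
Definition ucoef j l := u (ztexp j l).

Lemma tempered_ztapprox K phi : u (ztapprox K phi) = \sum_(i : _ * (_ * _))
  ((cubevol R n K)^-1)%:C * fcoef (fun w => phi (boxpt i.1, w)) (@idxl n K i) *
  ucoef (boxpt i.1) (idxl i).
Proof. by apply: tempered_sum => i; exact: schwartz_exp. Qed.

End tempered_functional.

Lemma cintegrable_boundedM d (T : measurableType d) (R : realType)
    (mu : {measure set T -> \bar R}) (s psi : T -> R[i]) M :
  cintegrable mu s -> cmeasurable psi -> (forall x, normc (psi x) <= M) ->
  cintegrable mu (fun x => s x * psi x) /\
  (\int[mu]_x (normc (s x * psi x))%:E <= (\int[mu]_x (normc (s x))%:E) * M%:E)%E.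
Proof.
move=> is_ mpsi hM; have /cintegrableP[ms soo] := is_.
have M0 : 0 <= M by apply: le_trans (hM point); exact: normc_ge0.
have s0 : (0 <= \int[mu]_x (normc (s x))%:E)%E.
  by apply: integral_ge0 => l _; rewrite lee_fin normc_ge0.
have le1 : (\int[mu]_x (normc (s x * psi x))%:E <=
    (\int[mu]_x (normc (s x))%:E) * M%:E)%E.
  rewrite -ge0_integralZr//; last 2 first.
  - exact: cmeasurable_normcE.
  - by move=> x _; rewrite lee_fin normc_ge0.
  apply: ge0_le_integral => //.
  - by move=> x _; rewrite lee_fin normc_ge0.
  - exact/cmeasurable_normcE/cmeasurableM.
  - by apply: emeasurable_funM => //; exact: cmeasurable_normcE.
  - by move=> x _; rewrite -EFinM lee_fin normcM ler_wpM2l ?normc_ge0.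
split=> //; apply/cintegrableP; split; first exact: cmeasurableM.
apply: le_lt_trans le1 _; rewrite -(@fineK _ (integral _ _ _)) ?ge0_fin_numE//.
by rewrite -EFinM ltry.
Qed.

(** * Averages of trigonometric polynomials *)

Section trigonometric_polynomials.
Context (R : realType) (n : nat).
Implicit Types (w eta omega xi : Rn R n) (j k l m : Zn n).
Local Notation haarn := (haar R n).

Lemma cmeasurableB d (T : measurableType d) (f h : T -> R[i]) :
  cmeasurable f -> cmeasurable h -> cmeasurable (fun x => f x - h x).
Proof.
move=> [f1 f2] [h1 h2]; split.
  by under eq_fun do rewrite cReD cReN; exact: measurable_funB.
by under eq_fun do rewrite cImD cImN; exact: measurable_funB.
Qed.

Lemma cintegral_trig_sum (I : Type) (r : seq I) (a : I -> R[i]) (p : I -> Zn n) :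
  cintegral haarn (fun w => \sum_(i <- r) a i * chi (p i) w) =
  \sum_(i <- r) a i * (p i == 0)%:R.
Proof.
rewrite cintegral_sum => [|i]; last by apply: cintegrableZ; exact: cintegrable_chi.
by apply: eq_bigr => i _; rewrite cintegralZ ?cintegral_chi//; exact: cintegrable_chi.
Qed.

Lemma cmeasurable_trig_sum (I : Type) (r : seq I) (a : I -> R[i]) (p : I -> Zn n) :
  cmeasurable (fun w : Rn R n => \sum_(i <- r) a i * chi (p i) w).
Proof.
by apply: cmeasurable_sum => i _; apply: cmeasurableM;
  [exact: cmeasurable_cst|exact: cmeasurable_chi].
Qed.

Lemma cintegrable_trig_sum (I : Type) (r : seq I) (a : I -> R[i]) (p : I -> Zn n) :
  cintegrable haarn (fun w => \sum_(i <- r) a i * chi (p i) w).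
Proof. by apply: cintegrable_sum => i; apply: cintegrableZ; exact: cintegrable_chi. Qed.

(** Averaging over both torus variables keeps exactly the terms of frequency zero. The additive [E]
    leaves room for an approximation error uniform in both variables. *)
Lemma normc_trig_mean_le (I : Type) (r : seq I) (a : I -> R[i]) (p q : I -> Zn n)
    (H : Rn R n * Rn R n -> \bar R) (E : R) :
  measurable_fun setT H -> (forall z, 0 <= H z)%E -> 0 <= E ->
  (forall v w, ((normc (\sum_(i <- r) a i * chi (p i) v * chi (q i) w))%:E <=
     H (v, w) + E%:E)%E) ->
  ((normc (\sum_(i <- r) a i * (p i == 0)%:R * (q i == 0)%:R))%:E <=
    \int[haarn]_v \int[haarn]_w H (v, w) + E%:E)%E.
Proof.
move=> mH H0 E0 hH.
have cstE : (\int[haarn]_w E%:E = E%:E)%E.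
  by rewrite integral_cst//= [X in (_ * X)%E](_ : _ = 1%E) ?mule1//; exact: probability_setT.
have step v : ((normc (\sum_(i <- r) a i * (q i == 0)%:R * chi (p i) v))%:E <=
    \int[haarn]_w H (v, w) + E%:E)%E.
  rewrite (eq_bigr (fun i => a i * chi (p i) v * (q i == 0)%:R)); last first.
    by move=> i _; rewrite mulrAC.
  rewrite -cintegral_trig_sum; apply: le_trans (le_normc_cintegral _) _.
    exact: cintegrable_trig_sum.
  rewrite -[X in (_ + X)%E]cstE -ge0_integralD//; last first.
    by apply: (measurableT_comp mH); exact: measurable_pair1.
  apply: ge0_le_integral => //.
  - by move=> w _; rewrite lee_fin normc_ge0.
  - exact/cmeasurable_normcE/cmeasurable_trig_sum.
  - apply: emeasurable_funD; last exact: measurable_cst.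
    by apply: (measurableT_comp mH); exact: measurable_pair1.
rewrite (eq_bigr (fun i => a i * (q i == 0)%:R * (p i == 0)%:R)); last first.
  by move=> i _; rewrite mulrAC.
rewrite -cintegral_trig_sum; apply: le_trans (le_normc_cintegral _) _.
  exact: cintegrable_trig_sum.
have mI : measurable_fun setT (fun v => \int[haarn]_w H (v, w))%E.
  exact: measurable_integral2.
have I0 v : (0 <= \int[haarn]_w H (v, w))%E by apply: integral_ge0.
rewrite -[X in (_ + X)%E]cstE -ge0_integralD//.
apply: ge0_le_integral => //.
- by move=> w _; rewrite lee_fin normc_ge0.
- exact/cmeasurable_normcE/cmeasurable_trig_sum.
- by apply: emeasurable_funD => //; exact: measurable_cst.
Qed.

Lemma fcoef_chi l k : fcoef (chi l : Rn R n -> R[i]) k = (k == l)%:R.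
Proof. by rewrite /fcoef cintegral_chiM subr_eq0 eq_sym. Qed.

Lemma fcoef_ztexp j l j' l' :
  fcoef (fun w : Rn R n => ztexp j l (j', w)) l' = (j' == j)%:R * (l' == l)%:R :> R[i].
Proof.
rewrite /ztexp /ztsingle/=; have [_|_] := eqVneq j' j; first by rewrite mul1r -fcoef_chi.
by rewrite mul0r /fcoef; under eq_cintegral do rewrite mul0r; rewrite cintegral0.
Qed.

(** If all coefficients vanished, the Fejer means would be zero; with tolerance |G(x)|/(M+1) the
    approximation would then give |G(x)| < |G(x)|. *)
Lemma schwartz_fcoef_neq0 (G : Zn n * Rn R n -> R[i]) x : schwartzZT G -> G x != 0 ->
  exists l, fcoef (fun w => G (x.1, w)) l != 0.
Proof.
case: x => j w hG /= Gx; apply: contrapT => hl.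
have f0 l : fcoef (fun w => G (j, w)) l = 0.
  by apply/eqP/negPn/negP => fl; apply: hl; exists l.
have [M hM] := schwartz_ztbound 1 hG.
have g0 : 0 < normc (G (j, w)) by rewrite normc_gt0.
have M1 : 0 < M + 1 by rewrite ltr_wpDl// (ztbound_ge0 hM).
have [K0 hK] := @ztapprox_le R n (normc (G (j, w)) / (M + 1)) (divr_gt0 g0 M1).
have := hK K0 (leqnn _) 0 G M hG hM j [::] w isT.
rewrite expr0 mul1r /= ztapproxE (_ : (if _ then _ else _) = 0); last first.
  case: ifP => // _; rewrite /fejer_sum big1 ?mulr0// => a _.
  by rewrite big1// => b _; rewrite f0 mul0r.
rewrite addr0 mulN1r normcN mulrAC ler_pdivlMr// ler_pM2l// => /(lt_le_trans _).
by move=> /(_ M); rewrite ltrDl ltr01 ltxx => /(_ isT).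
Qed.

End trigonometric_polynomials.

Lemma sigma_finite_muZT (R : realType) (n : nat) :
  sigma_finite [set: Zn n * Rn R n] (muZT R n).
Proof.
have [F TF Foo] := @sigma_finite_counting_Zn R n.
exists (fun m => F m `*` setT) => [|m].
  apply/seteqP; split => // -[k w] _.
  by have : [set: Zn n] k by []; rewrite TF => -[m _ Fmk]; exists m.
have [mF Fmoo] := Foo m; split; first exact: measurableX.
rewrite [X in (X < _)%E](_ : _ = (@countZ R n \x haar R n)%E (F m `*` setT))//.
by rewrite product_measure1E// [X in (_ * X)%E](_ : _ = 1%E) ?mule1//; exact: probability_setT.
Qed.

(* A copy of [muZT] carrying the sigma-finite structure that the library
   infers for products of subprobabilities only. *)
Definition sfmuZT (R : realType) (n : nat) : set (Zn n * Rn R n)%type -> \bar R :=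
  (@countZ R n \x haar R n)%E.

HB.instance Definition _ (R : realType) (n : nat) :=
  Measure.copy (@sfmuZT R n) (@countZ R n \x haar R n)%E.
HB.instance Definition _ (R : realType) (n : nat) :=
  @Measure_isSigmaFinite.Build _ _ _ (@sfmuZT R n) (@sigma_finite_muZT R n).

(** * Iterated integrals over phase space *)

Section phase_space_integral.
Context (R : realType) (n : nat).
Implicit Types (omega xi : Rn R n) (k m : Zn n).
Local Notation cnt := (@countZ R n).
Local Notation haarn := (haar R n).
Variable f : (Zn n * Rn R n) * (Rn R n * Zn n) -> \bar R.
Hypothesis mf : measurable_fun setT f.
Hypothesis f0 : forall z, (0 <= f z)%E.

Lemma measurable_phase_torus m k :
  measurable_fun setT (fun z : Rn R n * Rn R n => f ((m, z.1), (z.2, k))).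
Proof.
apply: (measurableT_comp mf).
by apply: measurable_fun_pair; apply: measurable_fun_pair => //=.
Qed.

Lemma integral_muZTTZ : (\int[muZTTZ R n]_z f z =
  \int[cnt]_m \int[haarn]_omega \int[@muTZ R n]_y f ((m, omega), y))%E.
Proof.
pose g x := (\int[@muTZ R n]_y f (x, y))%E.
have mg : measurable_fun setT g by exact: measurable_integral2.
have g0 x : (0 <= g x)%E by apply: integral_ge0.
transitivity (\int[(cnt \x haarn)%E]_x g x)%E.
  rewrite -[RHS](@fubini_tonelli1 _ _ _ _ _ (@sfmuZT R n) (@muTZ R n) f mf f0).
  exact: eq_measure_integral.
by rewrite (@fubini_tonelli1 _ _ _ _ _ cnt haarn g mg g0).
Qed.

Lemma integral_muTZ x : (\int[@muTZ R n]_y f (x, y) =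
  \int[cnt]_k \int[haarn]_xi f (x, (xi, k)))%E.
Proof.
have mfx : measurable_fun setT (fun y => f (x, y)).
  by apply: (measurableT_comp mf); exact: measurable_pair1.
by rewrite -[RHS](@fubini_tonelli2 _ _ _ _ _ haarn cnt _ mfx (fun y => f0 _)).
Qed.

(** The lattice variables are placed outside, so that the inner double integral is the one bounding
    a single coefficient in [ucoef_le]. *)
Lemma integral_phase_space : (\int[muZTTZ R n]_z f z =
  \int[cnt]_m \int[cnt]_k \int[haarn]_omega \int[haarn]_xi f ((m, omega), (xi, k)))%E.
Proof.
rewrite integral_muZTTZ; apply: eq_integral => m _.
pose h (z : Rn R n * Zn n) := (\int[haarn]_xi f ((m, z.1), (xi, z.2)))%E.
have mh : measurable_fun setT h.
  apply: (@measurable_integral2 _ _ _ _ _ _ (fun z => f ((m, z.1.1), (z.2, z.1.2)))) => //.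
  apply: (measurableT_comp mf).
  apply: measurable_fun_pair; apply: measurable_fun_pair => //=;
    exact: measurableT_comp.
have h0 z : (0 <= h z)%E by apply: integral_ge0.
transitivity (\int[haarn]_omega \int[cnt]_k h (omega, k))%E; last first.
  transitivity (\int[(haarn \x cnt)%E]_z h z)%E.
    by rewrite (@fubini_tonelli1 _ _ _ _ _ haarn cnt h mh h0).
  by rewrite (@fubini_tonelli2 _ _ _ _ _ haarn cnt h mh h0).
by apply: eq_integral => omega _; exact: integral_muTZ.
Qed.

End phase_space_integral.

(** * The distribution as an integrable function *)

Section symbol.
Context (R : realType) (n : nat).
Implicit Types (w eta omega xi : Rn R n) (j k l m : Zn n).
Local Notation cnt := (@countZ R n).
Local Notation haarn := (haar R n).
Variables (G : Zn n * Rn R n -> R[i]) (u : (Zn n * Rn R n -> R[i]) -> R[i]).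
Hypothesis hG : schwartzZT G.
Hypothesis hu : modspaceZT G 1%E u.
Local Notation V := (stftZT G u).

Let tu : temperedZT u. Proof. by case: hu. Qed.

Lemma cmeasurable_stftZT : cmeasurable V.
Proof. by have [_ []] := hu. Qed.

Lemma normMZT_lty : (\int[muZTTZ R n]_z (normc (V z))%:E < +oo)%E.
Proof.
have [_ [_ _]] := hu; rewrite /Lpnorm Lnorm1.
by under eq_integral do rewrite gee0_abs ?lee_fin ?normc_ge0//.
Qed.

Let mVt m k : measurable_fun setT
  (fun z : Rn R n * Rn R n => (normc (V ((m, z.1), (z.2, k))))%:E).
Proof.
by apply: (@measurable_phase_torus _ _ (fun z => (normc (V z))%:E));
  exact/cmeasurable_normcE/cmeasurable_stftZT.
Qed.

(* Integrating [V] against characters of the two torus variables isolates a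
   single coefficient of [u]. *)
Lemma ucoef_le m k j l : ((normc (fcoef (fun v => G (j - m, v)) (- (k + l))) *
    normc (ucoef u j l))%:E <=
  \int[haarn]_omega \int[haarn]_xi (normc (V ((m, omega), (xi, k))))%:E)%E.
Proof.
set c := normc (fcoef _ _); set I := (\int[_]_omega _)%E.
have c0 : 0 <= c by exact: normc_ge0.
have [N hN] := tempered_approx tu.
have [M hM] := ctfshift_ztbound hG N m k.
have [M' hM'] := schwartz_ztbound N (@schwartz_exp R n j l).
have M0 := ztbound_ge0 (hM 0 0); have M'0 := ztbound_ge0 hM'.
apply/lee_addgt0Pr => e e0.
(* Collects the two approximation errors, for the shifted windows ([M]) and for [ztexp j l]
   ([c * M']); the 1 keeps it positive. *)
pose D := M + c * M' + 1; have D0 : 0 < D by rewrite ltr_wpDl// addr_ge0// mulr_ge0.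
have [K hK] := hN (e / D) (divr_gt0 e0 D0).
(* After approximation [u] acts on a finite sum, so [u] of the shifted window is a trigonometric
   polynomial in [(omega, xi)] and averaging it needs no exchange with [u]. *)
have key : ((c * normc (u (ztapprox K (ztexp j l))))%:E <= I + (e / D * M)%:E)%E.
  pose a i := ((cubevol R n K)^-1)%:C *
    (fcoef (fun v => G (@boxpt n K i.1 - m, v)) (- (k + @idxl n K i)))^* *
    ucoef u (boxpt i.1) (idxl i).
  have aE omega xi : u (ztapprox K (ctfshift G ((m, omega), (xi, k)))) =
     \sum_i a i * chi (- (k + idxl i)) omega * chi (- boxpt i.1) xi.
    rewrite tempered_ztapprox//; apply: eq_bigr => i _.
    rewrite fcoef_ctfshift// /a [X in _ * X * _]mulrC -!mulrA; congr (_ * (_ * _)).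
    by rewrite mulrCA [RHS]mulrCA [chi (- boxpt _) _ * _]mulrC mulrA.
  have := @normc_trig_mean_le R n _ (index_enum _) a (fun i => l - idxl i)
    (fun i => j - boxpt i.1) (fun z => (normc (V ((m, z.1), (z.2, k))))%:E)
    (e / D * M) (mVt m k) (fun z => normc_ge0 _) (mulr_ge0 (ltW (divr_gt0 e0 D0)) M0).
  set S1 := \sum_(i <- _) _ => hS.
  have -> : c * normc (u (ztapprox K (ztexp j l))) = normc S1.
    rewrite -[c]normc_conj -normcM; congr normc.
    rewrite tempered_ztapprox// mulr_sumr; apply: eq_bigr => i _.
    rewrite fcoef_ztexp /a !subr_eq0 [boxpt _ == j]eq_sym [idxl _ == l]eq_sym.
    have [<-|_] := eqVneq j (boxpt i.1); last by rewrite !(mul0r, mulr0).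
    have [<-|_] := eqVneq l (idxl i); last by rewrite !(mul0r, mulr0).
    by rewrite !mulr1 mulrCA mulrA.
  apply: hS => v w; rewrite /S1.
  (* Multiplying by these two characters moves the wanted frequency to zero without changing the
     modulus. *)
  have -> : \sum_(i <- index_enum _) a i * chi (l - idxl i) v * chi (j - boxpt i.1) w =
      u (ztapprox K (ctfshift G ((m, v), (w, k)))) * (chi (k + l) v * chi j w).
    rewrite aE mulr_suml; apply: eq_bigr => i _.
    rewrite (_ : l - idxl i = - (k + idxl i) + (k + l)); last first.
      by move: (idxl i) => b; rewrite opprD addrACA addNr add0r addrC.
    by rewrite [j - _]addrC !chiDl; ring.
  rewrite normcM normcM !normc_chi !mulr1 -EFinD lee_fin.
  have := hK K (leqnn _) _ M (ctfshift_schwartz hG ((m, v), (w, k))) (hM v w).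
  set x := u _; set y := u _ => h.
  by rewrite -[x](subrK y) (le_trans (le_normcD _ _))// addrC lerD2l.
have h2 := hK K (leqnn _) _ M' (@schwartz_exp R n j l) hM'.
have : (c * normc (ucoef u j l))%R <=
    c * normc (u (ztapprox K (ztexp j l))) + e / D * (c * M').
  rewrite mulrCA -mulrDr ler_wpM2l// /ucoef.
  set x := u _; set y := u _ in h2 *; rewrite -[x](subrK y) (le_trans (le_normcD _ _))//.
  by rewrite addrC lerD2l normcB.
rewrite -lee_fin => /le_trans; apply; rewrite EFinD.
apply: (@le_trans _ _ (I + (e / D * M)%:E + (e / D * (c * M'))%:E)%E).
  by rewrite leeD2r.
rewrite -addeA leeD2l// -EFinD lee_fin -mulrDr mulrAC ler_pdivrMr// ler_pM2l//.
by rewrite lerDl.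
Qed.

Variable x0 : Zn n * Rn R n.
Hypothesis Gx0 : G x0 != 0.

(** Fix a nonzero coefficient [l0] of the fiber of [G] at [x0.1]. Taking [m = j - x0.1] and
    [k = - l0 - l] in [ucoef_le] makes the window factor the constant [c], and these substitutions
    are bijections of the lattice, so the sum is at most the norm divided by [c]. *)
Lemma ucoef_summable : (\int[cnt]_j \int[cnt]_l (normc (ucoef u j l))%:E < +oo)%E.
Proof.
have [l0 l0P] := schwartz_fcoef_neq0 hG Gx0.
pose c : R := normc (fcoef (fun w => G (x0.1, w)) l0).
have c0 : 0 < c by rewrite normc_gt0.
pose f z : \bar R := (normc (V z))%:E.
have f0 z : (0 <= f z)%E by rewrite lee_fin normc_ge0.
have mf : measurable_fun setT f by exact/cmeasurable_normcE/cmeasurable_stftZT.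
pose I m k : \bar R := (\int[haarn]_omega \int[haarn]_xi f ((m, omega), (xi, k)))%E.
have I0 m k : (0 <= I m k)%E by do 2 apply: integral_ge0 => ? _.
have le1 j l : ((normc (ucoef u j l))%:E <= (c^-1)%:E * I (j - x0.1)%R (- l0 - l)%R)%E.
  rewrite muleC lee_pdivlMr// muleC -EFinM; have := ucoef_le (j - x0.1) (- l0 - l) j l.
  by rewrite subKr subrK opprK.
have : (c^-1%:E * \int[muZTTZ R n]_z f z < +oo)%E.
  by rewrite lte_mul_pinfty ?lee_fin ?invr_ge0 ?(ltW c0)// normMZT_lty.
apply: le_lt_trans.
have ci0 : (0 <= (c^-1)%:E)%E by rewrite lee_fin invr_ge0 ltW.
have -> : (\int[muZTTZ R n]_z f z = \int[cnt]_m \int[cnt]_k I m k)%E.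
  exact: integral_phase_space.
rewrite -ge0_integralZl//; last by move=> m _; apply: integral_ge0.
rewrite -[leRHS](integral_countZ_shift _ (- x0.1)%R).
apply: ge0_le_integral => // j _.
  by apply: integral_ge0 => l _; rewrite lee_fin normc_ge0.
rewrite -ge0_integralZl//.
rewrite -[leRHS](integral_countZ_reflect _ (- l0)%R).
by apply: ge0_le_integral => // l _; rewrite ?lee_fin ?normc_ge0// mule_ge0.
Qed.

Lemma ucoef_integrable j : cintegrable cnt (ucoef u j).
Proof.
apply/cintegrableP; split=> //; apply: le_lt_trans ucoef_summable.
apply: (@ge0_integral_countZ_ge _ _ (fun j => \int[cnt]_l (normc (ucoef u j l))%:E)%E j) => k.
by apply: integral_ge0 => l _; rewrite lee_fin normc_ge0.
Qed.

Definition symb (x : Zn n * Rn R n) : R[i] := fseries (ucoef u x.1) x.2.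

Lemma periodic_symb j : periodicT (fun w => symb (j, w)).
Proof.
by move=> i w; rewrite /symb/= /fseries; apply: eq_cintegral => k; rewrite periodic_chi.
Qed.

Lemma cmeasurable_symb : cmeasurable symb.
Proof. by apply: cmeasurable_Zn_prod => j; rewrite /symb/=; exact: cmeasurable_fseries. Qed.

(** Each fiber is bounded by the sum of the moduli of its coefficients, and the Haar measure has
    mass one. *)
Lemma cintegrable_symb : cintegrable (muZT R n) symb.
Proof.
apply: cintegrable_prod; first exact: cmeasurable_symb.
apply: le_lt_trans ucoef_summable; apply: ge0_le_integral => //.
  by move=> j _; apply: integral_ge0 => w _; rewrite lee_fin normc_ge0.
move=> j _; have /cintegrableP[_ fin] := ucoef_integrable j.
have I0 : (0 <= \int[cnt]_l (normc (ucoef u j l))%:E)%E.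
  by apply: integral_ge0 => l _; rewrite lee_fin normc_ge0.
rewrite -[leRHS]fineK ?ge0_fin_numE//; apply: integral_bounded_le.
  by rewrite /symb/=; exact: cmeasurable_fseries.
move=> w; rewrite -lee_fin fineK ?ge0_fin_numE//.
by apply: normc_fseries_le; exact: ucoef_integrable.
Qed.

Lemma cintegrable_symbM (psi : Zn n * Rn R n -> R[i]) M : cmeasurable psi ->
  (forall x, normc (psi x) <= M) ->
  cintegrable (muZT R n) (fun x => symb x * psi x) /\
  normc (cintegral (muZT R n) (fun x => symb x * psi x)) <=
    fine (\int[muZT R n]_x (normc (symb x))%:E)%E * M.
Proof.
move=> mpsi hM; have [isp le1] := cintegrable_boundedM cintegrable_symb mpsi hM.
have /cintegrableP[_ soo] := cintegrable_symb.
split=> //; rewrite -lee_fin EFinM fineK; first exact: le_trans (le_normc_cintegral isp) le1.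
by rewrite ge0_fin_numE// integral_ge0// => x _; rewrite lee_fin normc_ge0.
Qed.

Lemma schwartz_cmeasurable (phi : Zn n * Rn R n -> R[i]) : schwartzZT phi -> cmeasurable phi.
Proof.
move=> sphi; apply: cmeasurable_Zn_prod => j.
by have [sj _] := schwartz_tsmooth j sphi; exact: tsmooth_cmeasurable.
Qed.

Lemma schwartz_bounded (phi : Zn n * Rn R n -> R[i]) : schwartzZT phi ->
  exists M, forall x, normc (phi x) <= M.
Proof.
move=> /(schwartz_ztbound 0)[M hM]; exists M => -[j w].
by have := hM j [::] w isT; rewrite expr0 mul1r.
Qed.

Lemma symb_ztexp j l : u (ztexp j l) = cintegral (muZT R n) (fun x => symb x * ztexp j l x).
Proof.
have [M hM] := schwartz_bounded (@schwartz_exp R n j l).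
have [ise _] := cintegrable_symbM (schwartz_cmeasurable (@schwartz_exp R n j l)) hM.
rewrite -cintegral_fubini1// (@cintegral_countZ_single _ _ _ j) => [|j' j'j].
  rewrite -[LHS](fseries_coef l (ucoef_integrable j)); apply: eq_cintegral => w.
  by rewrite /ztexp /ztsingle/= eqxx.
rewrite /ztexp /ztsingle/= (negbTE j'j).
by under eq_cintegral do rewrite mulr0; rewrite cintegral0.
Qed.

(** Both sides agree on every [ztexp], hence on the approximants. [u] passes to the limit by
    temperedness; the integral does because [symb] is integrable and the approximation is
    uniform. *)
Lemma symb_represents : represents symb u.
Proof.
split; [exact: periodic_symb|exact: cintegrable_symb|].
move=> phi sphi.
have [N hN] := tempered_approx tu.
have [M hM] := schwartz_ztbound N sphi; have [M1 hM1] := schwartz_ztbound 1 sphi.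
have [B hB] := schwartz_bounded sphi.
have [isphi _] := cintegrable_symbM (schwartz_cmeasurable sphi) hB.
set S := fine (\int[muZT R n]_x (normc (symb x))%:E)%E.
have S0 : 0 <= S by apply: fine_ge0; apply: integral_ge0 => x _; rewrite lee_fin normc_ge0.
apply/eqP; rewrite -subr_eq0 -normc_eq0 eq_le normc_ge0 andbT.
apply/ler_addgt0Pr => e e0; rewrite add0r.
have M0 := ztbound_ge0 hM; have M10 := ztbound_ge0 hM1.
pose D := M + S * M1 + 1; have D0 : 0 < D by rewrite ltr_wpDl// addr_ge0// mulr_ge0.
have eD := divr_gt0 e0 D0.
have [K1 hK1] := hN _ eD; have [K2 hK2] := @ztapprox_le R n _ eD.
pose K := maxn K1 K2.
have h1 := hK1 K (leq_maxl _ _) phi M sphi hM.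
have h2 := hK2 K (leq_maxr _ _) 0 phi M1 sphi hM1.
have sK := schwartz_ztapprox K phi.
have [BK hBK] := schwartz_bounded sK.
have [isK _] := cintegrable_symbM (schwartz_cmeasurable sK) hBK.
have uK : u (ztapprox K phi) = cintegral (muZT R n) (fun x => symb x * ztapprox K phi x).
  rewrite tempered_ztapprox//.
  under [RHS]eq_cintegral do rewrite mulr_sumr.
  have ise j l : cintegrable (muZT R n) (fun x => symb x * ztexp j l x).
    have [M' hM'] := schwartz_bounded (@schwartz_exp R n j l).
    by have [] := cintegrable_symbM (schwartz_cmeasurable (@schwartz_exp R n j l)) hM'.
  under [RHS]eq_cintegral do under eq_bigr do rewrite mulrCA.
  rewrite cintegral_sum; last by move=> i; exact: cintegrableZ.
  by apply: eq_bigr => i _; rewrite cintegralZ// -symb_ztexp.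
have h3 : normc (cintegral (muZT R n) (fun x => symb x * ztapprox K phi x) -
    cintegral (muZT R n) (fun x => symb x * phi x)) <= S * (e / D * M1).
  rewrite -cintegralB//; under eq_cintegral do rewrite -mulrBr.
  have := @cintegrable_symbM (fun x => ztapprox K phi x - phi x) (e / D * M1).
  case=> //; first by apply: cmeasurableB; exact: schwartz_cmeasurable.
  move=> [j w]; have := h2 j [::] w isT.
  by rewrite expr0 mul1r /= mulN1r addrC.
move: h1; rewrite uK => h1.
set a := cintegral _ _ in h1 h3; set b := cintegral _ _ in h3 *.
rewrite -[u phi - b](subrKA a) (le_trans (le_normcD _ _))//.
rewrite normcB (le_trans (lerD h1 h3))// mulrCA -mulrDr mulrAC ler_pdivrMr// ler_pM2l//.
by rewrite lerDl.
Qed.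

End symbol.

(** * Pointwise bounds by the sum of the Fourier coefficients *)

Section absolutely_convergent_fourier_series.
Context (R : realType) (n : nat).
Implicit Types (w eta t : Rn R n) (k l : Zn n) (h b : Rn R n -> R[i]).
Local Notation cnt := (@countZ R n).
Local Notation haarn := (haar R n).

(** For fixed a the differences a - b are distinct, so the inner sum is part of the full sum of
    moduli; the outer sum is an average of [cubevol] such terms. *)
Lemma normc_fejer_sum_fcoef_le K h w :
  ((normc (fejer_sum K h w))%:E <= \int[cnt]_k (normc (fcoef h k))%:E)%E.
Proof.
have v0 := cubevol_gt0 R n K.
pose S := (\int[cnt]_k (normc (fcoef h k))%:E)%E.
have f0 k : (0 <= (normc (fcoef h k))%:E)%E by rewrite lee_fin normc_ge0.
apply: (@le_trans _ _ (((cubevol R n K)^-1)%:E * \sum_(a : {ffun 'I_n -> 'I_K.+1}) S)%E).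
  rewrite /fejer_sum normcM EFinM normc_real ger0_norm ?invr_ge0 ?(ltW v0)//.
  rewrite lee_wpmul2l ?lee_fin ?invr_ge0 ?(ltW v0)//.
  rewrite (le_trans (_ : _ <= (\sum_(a : {ffun 'I_n -> 'I_K.+1})
     normc (\sum_(b : {ffun 'I_n -> 'I_K.+1})
       fcoef h (cubept a - cubept b) * chi (cubept a - cubept b) w))%:E)%E)//.
    by rewrite lee_fin normc_sum.
  rewrite -sumEFin; apply: lee_sum => a _.
  rewrite (le_trans (_ : _ <= (\sum_(b : {ffun 'I_n -> 'I_K.+1})
    normc (fcoef h (cubept a - cubept b)))%:E)%E)//.
    rewrite lee_fin (le_trans (normc_sum _ _ _))//.
    by apply: ler_sum => b _; rewrite normcM normc_chi mulr1.
  rewrite -sumEFin.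
  have inj : injective (fun b : {ffun 'I_n -> 'I_K.+1} => cubept a - cubept b).
    by move=> b b' /addrI/oppr_inj; exact: cubept_inj.
  exact: (@ge0_sum_le_countZ R n _ _ (fun k => (normc (fcoef h k))%:E) inj f0).
rewrite -/S; have [->|Soo] := eqVneq S +oo%E; first by rewrite leey.
have S0 : (0 <= S)%E by exact: integral_ge0.
rewrite -(@fineK _ S); last by rewrite ge0_fin_numE// ltey.
rewrite sumEFin -EFinM lee_fin sumr_const -mulr_natl card_cube mulrA mulVf ?mul1r//.
by rewrite gt_eqF.
Qed.

(** Placing [h] over the lattice point 0, which lies in every box, reduces this to [ztapprox_le] at
    order 0. *)
Lemma fejer_sum_cvg h w : tsmooth h -> (forall N, exists M, dbound N h M) ->
  (fun K => normc (fejer_sum K h w - h w)) @ \oo --> (0 : R).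
Proof.
move=> th bh; have ss := schwartz_single 0 th bh.
have [M hM] := schwartz_ztbound 1 ss; have M0 := ztbound_ge0 hM.
apply/cvgrPdist_le => e e0; have M1 : 0 < M + 1 by rewrite ltr_wpDl.
have [K0 hK0] := @ztapprox_le R n (e / (M + 1)) (divr_gt0 e0 M1).
exists K0 => // K /= K0K; rewrite sub0r normrN ger0_norm ?normc_ge0//.
have := hK0 K K0K 0 _ M ss hM 0 [::] w isT.
rewrite expr0 mul1r /= ztapproxE mulN1r addrC.
have -> : inbox K (0 : Zn n) by apply/forallP => i; rewrite mxE.
rewrite /ztsingle/= eqxx => /le_trans; apply.
by rewrite mulrAC ler_pdivrMr// ler_wpM2l ?(ltW e0)// lerDl.
Qed.

Variables (c : Zn n -> R[i]) (b : Rn R n -> R[i]).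
Hypothesis ic : cintegrable cnt c.
Hypothesis tb : tsmooth b.
Hypothesis bb : forall N, exists M, dbound N b M.

(** The product [fseries c * b] is the superposition of the [c l * cb l], each of which is smooth
    although [fseries c] need not be. *)
Let cb l v := chi (- l) v * b v.

Let tcb l : tsmooth (cb l).
Proof.
have [sb pb] := tb; split; first exact: smooth_chiM.
by move=> i w; rewrite /cb periodic_chi pb.
Qed.

Let bcb l N : exists M, dbound N (cb l) M.
Proof.
have [sb _] := tb; have [M hM] := bb N.
by eexists; exact: (dbound_chiM (- l) sb hM).
Qed.

Let bM : exists2 M, 0 <= M & forall l v, normc (cb l v) <= M.
Proof.
have [M hM] := bb 0; exists M; first exact: dbound_ge0 hM.
by move=> l v; rewrite normcM normc_chi mul1r; exact: (hM [::]).
Qed.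

Lemma fejer_sum_fseriesM K w : fejer_sum K (fun v => fseries c v * b v) w =
  cintegral cnt (fun l => c l * fejer_sum K (cb l) w).
Proof.
have [M M0 hM] := bM; have [B hB] := @kernel_bounded R n K.
have /cintegrableP[_ coo] := ic.
have c0 l : (0 <= (normc (c l))%:E)%E by rewrite lee_fin normc_ge0.
have finc : (\int[cnt]_l (normc (c l))%:E)%E \is a fin_num.
  by rewrite ge0_fin_numE// integral_ge0.
have mb := tsmooth_cmeasurable tb.1.
have mk : cmeasurable (fun t => (fejer_kernel K (w - t))%:C).
  by have /cintegrableP[] := cintegrable_kernel K w.
have mcb l : cmeasurable (cb l) by have [/tsmooth_cmeasurable] := tcb l.
pose F z := c z.1 * (cb z.1 z.2 * (fejer_kernel K (w - z.2))%:C).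
have mF l : cmeasurable (fun t => cb l t * (fejer_kernel K (w - t))%:C).
  exact: cmeasurableM.
have bF l t : normc (cb l t * (fejer_kernel K (w - t))%:C) <= M * B.
  by rewrite normcM ler_pM ?normc_ge0.
have iF : cintegrable (cnt \x haarn)%E F.
  apply: cintegrable_prod.
    apply: cmeasurable_Zn_prod => l; rewrite /F/=.
    by apply: cmeasurableM => //; exact: cmeasurable_cst.
  apply: (@le_lt_trans _ _ (\int[cnt]_l ((normc (c l))%:E * (M * B)%:E))%E).
    apply: ge0_le_integral => // l _.
    - by apply: integral_ge0 => t _; rewrite lee_fin normc_ge0.
    - rewrite -EFinM; apply: integral_bounded_le.
        rewrite /F/=; apply: cmeasurableM => //; exact: cmeasurable_cst.
      by move=> t; rewrite /F normcM ler_wpM2l ?normc_ge0.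
  have MB0 : 0 <= M * B by apply: le_trans (bF 0 0); exact: normc_ge0.
  by rewrite ge0_integralZr// -(fineK finc) -EFinM ltry.
rewrite fejer_sum_conv; last 2 first.
- by apply: cmeasurableM => //; exact: cmeasurable_fseries.
- exists (fine (\int[cnt]_l (normc (c l))%:E)%E * M) => v; rewrite normcM.
  rewrite ler_pM ?normc_ge0//.
    by rewrite -lee_fin fineK// normc_fseries_le.
  by have := hM 0 v; rewrite /cb oppr0 chi0 mul1r.
transitivity (cintegral haarn (fun t => cintegral cnt (fun l => F (l, t)))).
  apply: eq_cintegral => t; rewrite /fseries -mulrA -cintegralZr.
    by apply: eq_cintegral => l; rewrite /F /cb/= !mulrA.
  by apply: cintegrable_fseries => // k; exact: normc_chi.
rewrite cintegral_fubini2// -cintegral_fubini1//; apply: eq_cintegral => l.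
rewrite /F/= cintegralZ; last exact: cintegrable_bounded (mF l) (bF l).
by rewrite fejer_sum_conv//; exists M.
Qed.

(** All Fejer means of the product are bounded by the right-hand side, and they converge at the
    given point: term by term for the smooth [cb l], then by domination with [normc (c l) * M]. *)
Lemma normc_fseriesM_le w : ((normc (fseries c w * b w))%:E <=
  \int[cnt]_k (normc (fcoef (fun v => (fseries c v * b v)%R) k))%:E)%E.
Proof.
pose q v : R[i] := fseries c v * b v; set S := (X in (_ <= X)%E).
have [Soo|] := eqVneq S +oo%E; first by rewrite Soo leey.
have S0 : (0 <= S)%E by apply: integral_ge0 => k _; rewrite lee_fin normc_ge0.
rewrite -ltey -ge0_fin_numE// => finS.
have [M M0 hM] := bM; have /cintegrableP[_ coo] := ic.
have := @cintegral_dominated _ _ _ cnt (fun K l => c l * fejer_sum K (cb l) w)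
  (fun l => c l * cb l w) (fun l => normc (c l) * M).
case=> //.
- move=> l; apply/cvgrPdist_le => e e0.
  have e1 : 0 < e / (normc (c l) + 1) by rewrite divr_gt0// ltr_wpDl ?normc_ge0.
  have /cvgrPdist_le/(_ _ e1) := fejer_sum_cvg w (tcb l) (bcb l).
  apply: filterS => K; rewrite !sub0r !normrN !ger0_norm ?normc_ge0// => hK.
  rewrite -mulrBr normcM (le_trans (ler_wpM2l _ hK)) ?normc_ge0//.
  rewrite mulrCA ler_piMr ?(ltW e0)// ler_pdivrMr ?mul1r ?lerDl//.
  by rewrite ltr_wpDl ?normc_ge0.
- rewrite (_ : _ \o _ = (fun l => (normc (c l))%:E * M%:E)%E)//.
  apply: integrableZr => //; apply/integrableP; split=> //.
  by under eq_integral do rewrite gee0_abs ?lee_fin ?normc_ge0//.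
- move=> K l; rewrite normcM ler_wpM2l ?normc_ge0//; apply: normc_fejer_sum_le => //.
  by have [/tsmooth_cmeasurable] := tcb l.
move=> _; rewrite (_ : cintegral cnt _ = q w); last first.
  rewrite /q /fseries -cintegralZr; last first.
    by apply: cintegrable_fseries => // k; exact: normc_chi.
  by apply: eq_cintegral => l; rewrite /cb mulrA.
move=> /cvgrPdist_le cv; rewrite -(fineK finS) lee_fin; apply/ler_addgt0Pr => e e0.
have [K0 _ /(_ K0 (leqnn _))] := cv e e0.
rewrite sub0r normrN ger0_norm ?normc_ge0// -fejer_sum_fseriesM -/q normcB => h.
by rewrite -[fseries c w * b w]/(q w) -[q w](subrK (fejer_sum K0 q w)) (le_trans (le_normcD _ _))// addrC lerD// -lee_fin fineK// normc_fejer_sum_fcoef_le.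
Qed.

End absolutely_convergent_fourier_series.

Lemma integral_muZT (R : realType) (n : nat) (f : Zn n * Rn R n -> \bar R) :
  measurable_fun setT f -> (forall x, 0 <= f x)%E ->
  (\int[muZT R n]_x f x = \int[@countZ R n]_j \int[haar R n]_w f (j, w))%E.
Proof.
move=> mf f0.
exact: (@fubini_tonelli1 _ _ _ _ _ (@countZ R n) (haar R n) f mf f0).
Qed.

(** * The norm of the symbol *)

Section symbol_norm.
Context (R : realType) (n : nat).
Implicit Types (w eta omega xi : Rn R n) (j k l m : Zn n).
Local Notation cnt := (@countZ R n).
Local Notation haarn := (haar R n).
Variables (G : Zn n * Rn R n -> R[i]) (u : (Zn n * Rn R n -> R[i]) -> R[i]).
Hypothesis hG : schwartzZT G.
Hypothesis hu : modspaceZT G 1%E u.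
Variable x0 : Zn n * Rn R n.
Hypothesis Gx0 : G x0 != 0.
Local Notation V := (stftZT G u).

Definition window_conj m omega (x : Zn n * Rn R n) : R[i] := (G (x.1 - m, x.2 - omega))^*.

Lemma ctfshift_window_conj m omega xi k j eta : ctfshift G ((m, omega), (xi, k)) (j, eta) =
  chi (- j) xi * chi (- k) eta * window_conj m omega (j, eta).
Proof. by rewrite /ctfshift /tfshiftZT/= !rmorphM/= -!/(chi _ _) !chi_conj. Qed.

Lemma schwartz_window_conj m omega : schwartzZT (window_conj m omega).
Proof.
rewrite (_ : window_conj m omega = ctfshift G ((m, omega), (0, 0))).
  exact: ctfshift_schwartz.
by apply/funext => -[j eta]; rewrite ctfshift_window_conj oppr0 chi0r chi0 !mul1r.
Qed.

Lemma cintegrable_fcoef_symb m omega k : cintegrable cnt (fun j =>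
  fcoef (fun eta => symb u (j, eta) * window_conj m omega (j, eta)) k).
Proof.
have [M hM] := schwartz_bounded (ctfshift_schwartz hG ((m, omega), (0, k))).
have [] := cintegrable_symbM hG hu Gx0 (schwartz_cmeasurable
  (ctfshift_schwartz hG ((m, omega), (0, k)))) hM.
move=> /cintegrable_fubini1 + _; rewrite (_ : (fun j => cintegral _ _) = (fun j =>
  fcoef (fun eta => symb u (j, eta) * window_conj m omega (j, eta)) k))//.
apply/funext => j; apply: eq_cintegral => eta; rewrite ctfshift_window_conj chi0r mul1r.
by rewrite mulrCA mulrC.
Qed.

(** Exhibits the transform as a Fourier series in [xi], so that [fseries_coef] recovers each
    coefficient in [eta] as an average over [xi]. *)
Lemma stftZT_fseries m omega xi k : V ((m, omega), (xi, k)) =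
  fseries (fun j => fcoef (fun eta => symb u (j, eta) * window_conj m omega (j, eta)) k) xi.
Proof.
have sc := ctfshift_schwartz hG ((m, omega), (xi, k)).
rewrite [LHS](_ : _ = u (ctfshift G ((m, omega), (xi, k))))//.
have [_ _ ->//] := symb_represents hG hu Gx0.
have [M hM] := schwartz_bounded sc.
have [isc _] := cintegrable_symbM hG hu Gx0 (schwartz_cmeasurable sc) hM.
rewrite -cintegral_fubini1//; apply: eq_cintegral => j; rewrite mulrC.
have [Mw hMw] := schwartz_bounded (schwartz_window_conj m omega).
rewrite -cintegralZ; last first.
  apply: (@cintegrable_bounded _ _ _ _ _
    (fine (\int[cnt]_l (normc (ucoef u j l))%:E)%E * Mw)).
    apply: cmeasurableM; last exact: cmeasurable_chi.
    apply: cmeasurableM; apply: cmeasurable_pair1.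
      exact: cmeasurable_symb.
    exact/schwartz_cmeasurable/schwartz_window_conj.
  move=> eta; rewrite !normcM normc_chi mulr1 ler_pM ?normc_ge0//.
  have ij := ucoef_integrable hG hu Gx0 j; have /cintegrableP[_ ijoo] := ij.
  rewrite -lee_fin fineK; first exact: normc_fseries_le.
  by rewrite ge0_fin_numE// integral_ge0// => l _; rewrite lee_fin normc_ge0.
by apply: eq_cintegral => eta; rewrite -/(ctfshift _ _ _) ctfshift_window_conj; ring.
Qed.

Lemma normc_symb_le m omega j eta :
  ((normc (symb u (j, eta)) * normc (G (j - m, eta - omega)))%:E <=
    \int[@muTZ R n]_y (normc (V ((m, omega), y)))%:E)%E.
Proof.
have mV : measurable_fun setT (fun z => (normc (V z))%:E).
  exact/cmeasurable_normcE/(cmeasurable_stftZT hu).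
have V0 z : (0 <= (normc (V z))%:E)%E by rewrite lee_fin normc_ge0.
rewrite (integral_muTZ mV V0) -[normc (G _)]normc_conj -normcM.
have sw := schwartz_window_conj m omega.
have bw N : exists M, dbound N (fun w => window_conj m omega (j, w)) M.
  by have [M hM] := schwartz_ztbound N sw; eexists; exact: ztbound_dbound hM.
apply: le_trans (normc_fseriesM_le (ucoef_integrable hG hu Gx0 j)
  (schwartz_tsmooth j sw) bw eta) _.
apply: ge0_le_integral => // k _; first by rewrite lee_fin normc_ge0.
have ia := cintegrable_fcoef_symb m omega k.
rewrite -(fseries_coef j ia).
have iV : cintegrable haarn (fun xi => V ((m, omega), (xi, k)) * chi j xi).
  have /cintegrableP[_ aoo] := ia.
  apply: (@cintegrable_bounded _ _ _ _ _ (fine (\int[cnt]_j (normc (fcoef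
    (fun eta => symb u (j, eta) * window_conj m omega (j, eta)) k))%:E)%E)).
    apply: cmeasurableM; last exact: cmeasurable_chi.
    by under eq_fun do rewrite stftZT_fseries; exact: cmeasurable_fseries.
  move=> xi; rewrite normcM normc_chi mulr1 stftZT_fseries -lee_fin fineK.
    exact: normc_fseries_le.
  by rewrite ge0_fin_numE// integral_ge0// => l _; rewrite lee_fin normc_ge0.
under eq_cintegral do rewrite -stftZT_fseries.
apply: le_trans (le_normc_cintegral iV) _.
by under eq_integral do rewrite normcM normc_chi mulr1.
Qed.

(** The choice [m = j - z.1], [omega = w - z.2] pins the argument of the window to [z] while
    [(j, w)] ranges over the group; translation invariance then removes the shift by [z], as the
    inner integral is periodic in the torus variable because [G] is. *)
Lemma symb_norm_le z : ((normc (G z))%:E * \int[muZT R n]_x (normc (symb u x))%:E <=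
  normMZT G 1 u)%E.
Proof.
have mV : measurable_fun setT (fun z => (normc (V z))%:E).
  exact/cmeasurable_normcE/(cmeasurable_stftZT hu).
have V0 y : (0 <= (normc (V y))%:E)%E by rewrite lee_fin normc_ge0.
rewrite /normMZT /Lpnorm Lnorm1.
under [leRHS]eq_integral do rewrite gee0_abs//.
rewrite (integral_muZTTZ mV V0).
pose H x := (\int[@muTZ R n]_y (normc (V (x, y)))%:E)%E.
have mH : measurable_fun setT H.
  exact: (@measurable_integral2 _ _ _ _ _ (@muTZ R n) (fun z => (normc (V z))%:E) mV V0).
have H0 x : (0 <= H x)%E by apply: integral_ge0.
have mHj j : measurable_fun setT (fun w => H (j, w)).
  by apply: (measurableT_comp mH); exact: measurable_pair1.
have pH j : periodicT (fun w => H (j, w)).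
  move=> i w; apply: eq_integral => -[xi k] _; congr (normc _)%:E.
  rewrite /stftZT; congr u; apply/funext => -[j' eta]; rewrite /tfshiftZT/=.
  congr (_ * _)^*; have [_ pG] := schwartz_tsmooth (j' - j) hG.
  by rewrite -(pG i) opprD addrA subrK.
have ms := cmeasurable_normcE (cmeasurable_symb u).
rewrite -ge0_integralZl//; last 2 first.
- by move=> x _; rewrite lee_fin normc_ge0.
- by rewrite lee_fin normc_ge0.
rewrite integral_muZT//; last 2 first.
- exact: measurable_funeM.
- by move=> x; rewrite mule_ge0// lee_fin normc_ge0.
rewrite -[leRHS](integral_countZ_shift _ (- z.1)).
apply: ge0_le_integral => // j _.
  by apply: integral_ge0 => w _; rewrite mule_ge0// lee_fin normc_ge0.
rewrite -[leRHS](ge0_integral_haar_translate (- z.2) (mHj (j - z.1)) _ (pH _))//.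
apply: ge0_le_integral => //.
- by move=> w _; rewrite mule_ge0// lee_fin normc_ge0.
- apply: measurable_funeM; apply: (measurableT_comp ms); exact: measurable_pair1.
- exact: (measurableT_comp (mHj _) (measurable_Rn_translate _)).
move=> w _; have := normc_symb_le (j - z.1) (w - z.2) j w.
by rewrite !subKr -surjective_pairing -EFinM mulrC.
Qed.

End symbol_norm.

(** * Schur's test *)

Section schur_test.
Context d (T : measurableType d) (R : realType).
Variable mu : {sigma_finite_measure set T -> \bar R}.

(* The tangent line of [t |-> t `^ p] at [l] lies below the graph. *)
Lemma powR_tangent_le (p l t : R) : 1 <= p -> 0 <= l -> 0 <= t ->
  p * l `^ (p - 1) * t <= t `^ p + (p - 1) * l `^ p.
Proof.
rewrite le_eqVlt => /predU1P[<-|p1] l0 t0.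
  by rewrite subrr powRr0 mul0r addr0 powRr1// !mul1r.
have p0 : 0 < p by rewrite (lt_trans _ p1).
have q0 : 0 < p / (p - 1) by rewrite divr_gt0// subr_gt0.
have p1n0 : p - 1 != 0 by rewrite gt_eqF// subr_gt0.
have pn0 : p != 0 by rewrite gt_eqF.
have := conjugate_powR t0 (powR_ge0 l (p - 1)) p0 q0.
have -> : p^-1 + (p / (p - 1))^-1 = 1 by field; rewrite p1n0.
move=> /(_ erefl); rewrite -powRrM.
have -> : (p - 1) * (p / (p - 1)) = p by field.
rewrite -(ler_pM2l p0) => h.
rewrite -mulrA [_ `^ _ * t]mulrC (le_trans h)// mulrDr mulrCA divff// mulr1 lerD2l.
by rewrite le_eqVlt; apply/orP; left; apply/eqP; field; rewrite p1n0.
Qed.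

Variables (N : T * T -> \bar R) (H : R).
Hypothesis mN : measurable_fun setT N.
Hypothesis N0 : forall z, (0 <= N z)%E.
Hypothesis H0 : 0 < H.
Hypothesis N1 : forall y, (\int[mu]_z N (y, z) <= H%:E)%E.
Hypothesis N2 : forall z, (\int[mu]_y N (y, z) <= H%:E)%E.
Variables F v : T -> R.
Hypothesis mF : measurable_fun setT F.
Hypothesis mv : measurable_fun setT v.
Hypothesis F0 : forall z, 0 <= F z.
Hypothesis v0 : forall z, 0 <= v z.
Hypothesis vN : forall y, ((v y)%:E <= \int[mu]_z (N (y, z) * (F z)%:E))%E.

Let mN1 y : measurable_fun setT (fun z => N (y, z)).
Proof. by apply: (measurableT_comp mN); exact: measurable_pair1. Qed.

Let mN2 z : measurable_fun setT (fun y => N (y, z)).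
Proof. by apply: (measurableT_comp mN); exact: measurable_pair2. Qed.

(* The tangent at [v y / H] turns the linear bound on [v y] into one with the
   power [r], for which the exponents no longer matter. *)
Let schur_pointwise (r : R) : 1 <= r -> forall y,
  ((H * (v y / H) `^ r)%:E <= \int[mu]_z (N (y, z) * (F z `^ r)%:E))%E.
Proof.
move=> r1 y; have r0 : 0 < r by rewrite (lt_le_trans _ r1).
have Fr0 z : (0 <= (F z `^ r)%:E)%E by rewrite lee_fin powR_ge0.
have mFr : measurable_fun setT (fun z => (F z `^ r)%:E).
  by apply/measurable_EFinP; apply: (measurableT_comp (measurable_powR r)).
set l := v y / H; have l0 : 0 <= l by rewrite divr_ge0// ltW.
have vE : v y = l * H by rewrite /l divfK// gt_eqF.
have I0 : (0 <= \int[mu]_z (N (y, z) * (F z `^ r)%:E))%E.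
  by apply: integral_ge0 => z _; rewrite mule_ge0.
have [l1|ln0] := eqVneq l 0; first by rewrite l1 powR0 ?gt_eqF// mulr0.
have lp : 0 < l by rewrite lt_def ln0.
set c := r * l `^ (r - 1); have c0 : 0 < c by rewrite mulr_gt0// powR_gt0.
have b0 : 0 <= (r - 1) * l `^ r by rewrite mulr_ge0 ?powR_ge0// subr_ge0.
have : (c%:E * (v y)%:E <= \int[mu]_z (N (y, z) * (F z `^ r)%:E) +
    ((r - 1) * l `^ r)%:E * H%:E)%E.
  apply: (@le_trans _ _ (c%:E * \int[mu]_z (N (y, z) * (F z)%:E))%E).
    by rewrite lee_wpmul2l// lee_fin ltW.
  rewrite -ge0_integralZl//; last 3 first.
  - by apply: emeasurable_funM => //; exact/measurable_EFinP.
  - by move=> z _; rewrite mule_ge0// lee_fin.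
  - by rewrite lee_fin ltW.
  apply: (@le_trans _ _ (\int[mu]_z (N (y, z) * (F z `^ r)%:E) +
      \int[mu]_z (((r - 1) * l `^ r)%:E * N (y, z)))%E); last first.
    by rewrite leeD2l// ge0_integralZl// lee_wpmul2l.
  rewrite -ge0_integralD//; last 4 first.
  - by move=> z _; rewrite mule_ge0.
  - by apply: emeasurable_funM.
  - by move=> z _; rewrite mule_ge0// lee_fin.
  - by apply: measurable_funeM.
  apply: ge0_le_integral => //.
  - by move=> z _; rewrite mule_ge0 ?lee_fin ?(ltW c0)// mule_ge0// lee_fin.
  - by apply: measurable_funeM; apply: emeasurable_funM => //; exact/measurable_EFinP.
  - by apply: emeasurable_funD; [exact: emeasurable_funM|exact: measurable_funeM].
  - move=> z _; rewrite muleCA [X in (_ <= _ + X)%E]muleC -ge0_muleDr//.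
    by rewrite lee_wpmul2l// -EFinM -EFinD lee_fin powR_tangent_le.
rewrite -!EFinM addeC -leeBlDl// -EFinB; apply: le_trans.
rewrite lee_fin vE /c le_eqVlt; apply/orP; left.
apply/eqP; rewrite -(mulr_powRB1 l0 r0); ring.
Qed.

(** At infinity the bound on the integral in [z] suffices. For finite exponents [schur_pointwise]
    has already used that bound, and Tonelli brings in the one in [y]; neither Hoelder's inequality
    for integrals nor interpolation is involved. *)
Lemma schur_test (p : \bar R) : (1 <= p)%E ->
  (Lnorm mu p (EFin \o v) <= H%:E * Lnorm mu p (EFin \o F))%E.
Proof.
case: p => [r| |//]; last first.
  move=> _; rewrite unlock; case: ifPn => [mu0|_]; last by rewrite mule0.
  set B := ess_sup mu (abse \o (EFin \o F)).
  have B0 : (0 <= B)%E.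
    by apply: ess_sup_gee => //; apply: aeW => x /=; rewrite lee_fin.
  have [->|Boo] := eqVneq B +oo%E; first by rewrite gt0_muley ?lte_fin// leey.
  have finB : B \is a fin_num by rewrite ge0_fin_numE// ltey.
  apply/ess_supP; apply: aeW => y /=; rewrite ger0_norm//.
  apply: (le_trans (vN y)).
  apply: (@le_trans _ _ (\int[mu]_z (N (y, z) * B))%E).
    apply: ae_ge0_le_integral => //.
    - by move=> z _; rewrite mule_ge0// lee_fin.
    - by apply: emeasurable_funM => //; exact/measurable_EFinP.
    - by move=> z _; rewrite mule_ge0.
    - by apply: emeasurable_funM => //; exact: measurable_cst.
    have := ess_sup_ge mu (abse \o (EFin \o F)).
    apply: filterS => z /= h _; rewrite lee_wpmul2l//; apply: le_trans h.
    by rewrite lee_fin ler_norm.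
  by rewrite ge0_integralZr// lee_wpmul2r.
rewrite lee_fin => r1; have r0 : 0 < r by rewrite (lt_le_trans _ r1).
have rn0 : r != 0 by rewrite gt_eqF.
have mpow (f : T -> R) : measurable_fun setT f -> measurable_fun setT (fun z => (f z `^ r)%:E).
  by move=> mf; apply/measurable_EFinP; apply: (measurableT_comp (measurable_powR r)).
have pow0 (f : T -> R) z : (0 <= (f z `^ r)%:E)%E by rewrite lee_fin powR_ge0.
have mvH : measurable_fun setT (fun y => v y / H).
  by apply: measurable_funM => //; exact: measurable_cst.
(* The factor [H] on the left of [schur_pointwise] cancels against the [H] from integrating the
   kernel in [y], leaving a bound with constant 1 for [v / H]. *)
have key : (\int[mu]_y ((v y / H) `^ r)%:E <= \int[mu]_z (F z `^ r)%:E)%E.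
  rewrite -(@lee_pmul2l _ H%:E)//.
  rewrite -ge0_integralZl//; last 3 first.
  - exact: mpow.
  - by move=> x _; rewrite lee_fin powR_ge0.
  - by rewrite lee_fin ltW.
  apply: (@le_trans _ _ (\int[mu]_y \int[mu]_z (N (y, z) * (F z `^ r)%:E))%E).
    apply: ge0_le_integral => //.
    - by move=> y _; apply: mule_ge0; rewrite lee_fin ?powR_ge0// ltW.
    - by apply: measurable_funeM; exact: mpow.
    - apply: (measurable_integral2 mu (f := fun z => N z * (F z.2 `^ r)%:E)%E).
        by apply: emeasurable_funM => //; apply: (measurableT_comp (mpow _ mF)).
      by move=> z; rewrite mule_ge0.
    - by move=> y _; rewrite -EFinM schur_pointwise.
  rewrite (fubini_tonelli (fun z => N z * (F z.2 `^ r)%:E)%E)/=; last 2 first.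
  - by apply: emeasurable_funM => //; apply: (measurableT_comp (mpow _ mF)).
  - by move=> z; rewrite mule_ge0.
  rewrite -ge0_integralZl//; last 2 first.
  - exact: mpow.
  - by rewrite lee_fin ltW.
  apply: ge0_le_integral => //.
  - by move=> z _; apply: integral_ge0 => y _; rewrite mule_ge0.
  - apply: (measurable_integral1 mu (f := fun z => N z * (F z.2 `^ r)%:E)%E).
      by apply: emeasurable_funM => //; apply: (measurableT_comp (mpow _ mF)).
    by move=> z; rewrite mule_ge0.
  - by apply: measurable_funeM; exact: mpow.
  - by move=> z _; rewrite ge0_integralZr// lee_wpmul2r.
rewrite unlock /=.
under eq_integral do rewrite ger0_norm//.
under [X in (_ <= _ * X `^ _)%E]eq_integral do rewrite ger0_norm//.
have I0 (f : T -> R) : (0 <= \int[mu]_z (f z `^ r)%:E)%E by apply: integral_ge0.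
have HrE : (H%:E = (H `^ r)%:E `^ r^-1)%E.
  by rewrite poweR_EFin -powRrM divff// powRr1// ltW.
rewrite [X in (_ <= X * _)%E]HrE -poweRM//; last by rewrite lee_fin powR_ge0.
apply: gt0_ler_poweR.
- by rewrite invr_ge0 ltW.
- by rewrite in_itv/= I0 leey.
- by rewrite in_itv/= mule_ge0 ?lee_fin ?powR_ge0// leey.
rewrite (eq_integral (fun y => (H `^ r)%:E * ((v y / H) `^ r)%:E)%E); last first.
  move=> y _; rewrite -EFinM -powRM ?divr_ge0 ?(ltW H0)//.
  by rewrite mulrCA divff ?mulr1// gt_eqF.
rewrite ge0_integralZl//; last 3 first.
- exact: mpow.
- by move=> x _; rewrite lee_fin powR_ge0.
- by rewrite lee_fin powR_ge0.
by rewrite lee_wpmul2l// lee_fin powR_ge0.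
Qed.

End schur_test.

(** * Modulation spaces on the lattice *)

Section lattice_modulation_spaces.
Context (R : realType) (n : nat).
Implicit Types (w : Rn R n) (k l m : Zn n) (f g h phi : Zn n -> R[i]).
Local Notation cnt := (@countZ R n).
Local Notation haarn := (haar R n).

Lemma schwartzZ_bound phi : schwartzZ phi ->
  forall N, exists M, forall k, (1 + zabs R k) ^+ N * normc (phi k) <= M.
Proof.
move=> hphi N.
have h k : (((1 + zabs R k) ^+ N * normc (phi k))%:E <= seminormZ N phi)%E.
  by apply: ereal_sup_ubound; exists k.
exists (fine (seminormZ N phi)) => k; rewrite -lee_fin fineK//.
rewrite ge0_fin_numE ?hphi//; apply: le_trans (h 0); rewrite lee_fin.
by rewrite mulr_ge0 ?normc_ge0// exprn_ge0// ltW// zabs1_gt0.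
Qed.

Lemma schwartzZ_intro phi :
  (forall N, exists M, forall k, (1 + zabs R k) ^+ N * normc (phi k) <= M) -> schwartzZ phi.
Proof.
move=> hphi N; have [M hM] := hphi N; apply: (@le_lt_trans _ _ M%:E); last exact: ltry.
by apply: ge_ereal_sup => _ [k _ <-]; rewrite lee_fin.
Qed.

Lemma schwartzZ_integrable phi : schwartzZ phi -> cintegrable cnt phi.
Proof.
move=> /schwartzZ_bound/(_ (2 * n)%N)[M hM]; apply/cintegrableP; split=> //.
by apply: le_lt_trans (integrable_of_decay hM) _; rewrite ltry.
Qed.

Lemma schwartzZ_bounded phi : schwartzZ phi -> exists M, forall k, normc (phi k) <= M.
Proof.
by move=> /schwartzZ_bound/(_ 0)[M hM]; exists M => k; have := hM k; rewrite expr0 mul1r.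
Qed.

Lemma tfshiftZE m w g k : tfshiftZ m w g k = chi k w * g (k - m).
Proof. by []. Qed.

Lemma schwartzZ_tfshift_conj m w g : schwartzZ g -> schwartzZ (fun k => (tfshiftZ m w g k)^*).
Proof.
move=> hg; apply: schwartzZ_intro => N; have [M hM] := schwartzZ_bound hg N.
have z0 k : 0 <= 1 + zabs R k by rewrite ltW// zabs1_gt0.
exists ((1 + zabs R m) ^+ N * M) => k; rewrite normc_conj tfshiftZE normcM normc_chi mul1r.
apply: (@le_trans _ _ (((1 + zabs R m) * (1 + zabs R (k - m))) ^+ N * normc (g (k - m)))).
  rewrite ler_wpM2r ?normc_ge0// lerXn2r ?nnegrE ?mulr_ge0//.
  have := zabsD R (k - m) m; rewrite subrK.
  have h1 := zabs_ge0 R m; have h2 := zabs_ge0 R (k - m).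
  by move=> h3; rewrite mulrDl mul1r mulrDr mulr1; have := mulr_ge0 h1 h2; lra.
by rewrite exprMn -mulrA ler_wpM2l ?exprn_ge0.
Qed.

Lemma stftZ_fseries g f m w : stftZ g f (m, w) = fseries (fun k => f k * (g (k - m))^*) w.
Proof.
apply: eq_cintegral => k /=; rewrite tfshiftZE rmorphM/= chi_conj; ring.
Qed.

Lemma cmeasurable_stftZ g f : cmeasurable (stftZ g f : Zn n * Rn R n -> R[i]).
Proof.
apply: cmeasurable_Zn_prod => m; under eq_fun do rewrite stftZ_fseries.
exact: cmeasurable_fseries.
Qed.

Lemma normc_stftZ_le g f m w : cintegrable cnt (fun k => f k * (g (k - m))^*) ->
  ((normc (stftZ g f (m, w)))%:E <= \int[cnt]_k (normc (f k * (g (k - m))^*))%:E)%E.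
Proof. by move=> i; rewrite stftZ_fseries; exact: normc_fseries_le. Qed.

Lemma temperedZ_window g f m : schwartzZ g -> temperedZ f ->
  cintegrable cnt (fun k => f k * (g (k - m))^*).
Proof.
move=> hg [N [B hB]]; have [+ _] := hB _ (schwartzZ_tfshift_conj m 0 hg).
by under eq_fun do rewrite tfshiftZE chi0r mul1r.
Qed.

(** The left-hand side is the modulus of the k-th Fourier coefficient of the transform in the torus
    variable, hence at most its mean modulus. *)
Lemma stftZ_coef_le g f m k : cintegrable cnt (fun k => f k * (g (k - m))^*) ->
  ((normc (f k) * normc (g (k - m)))%:E <= \int[haarn]_w (normc (stftZ g f (m, w)))%:E)%E.
Proof.
move=> ifg; rewrite -[normc (g _)]normc_conj -normcM -(fseries_coef k ifg).
have /cintegrableP[_ foo] := ifg.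
have ifs : cintegrable haarn (fun w => fseries (fun k => f k * (g (k - m))^*) w * chi k w).
  apply: (@cintegrable_bounded _ _ _ _ _ (fine (\int[cnt]_k (normc (f k * (g (k - m))^*))%:E)%E)).
    by apply: cmeasurableM; [exact: cmeasurable_fseries|exact: cmeasurable_chi].
  move=> w; rewrite normcM normc_chi mulr1 -lee_fin fineK; first exact: normc_fseries_le.
  by rewrite ge0_fin_numE// integral_ge0// => l _; rewrite lee_fin normc_ge0.
apply: le_trans (le_normc_cintegral ifs) _.
by under eq_integral do rewrite normcM normc_chi mulr1 -stftZ_fseries.
Qed.

Lemma muZT_gt0 : (0 < muZT R n [set: Zn n * Rn R n])%E.
Proof.
apply: (@lt_le_trans _ _ (muZT R n ([set (0 : Zn n)] `*` setT))).
  rewrite [ltRHS](_ : _ = (cnt \x haarn)%E ([set 0] `*` setT))//.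
  rewrite product_measure1E// [X in (X * _)%E]countZ1 mul1e.
  by rewrite [ltRHS](_ : _ = 1%E) ?lte01//; exact: probability_setT.
by apply: le_measure => //; rewrite inE//; exact: measurableX.
Qed.

(** L^p lies in the sum of L^infinity and L^1. For finite r this is t <= 1 + t^r; at infinity [h] is
    the excess over the essential supremum, which has integral zero. Positivity of the measure makes
    the norm at infinity that supremum. *)
Lemma in_Lp_split d (T : measurableType d) (mu : {measure set T -> \bar R}) (V : T -> R[i]) p :
  (0 < mu setT)%E -> (1 <= p)%E -> in_Lp mu p V ->
  exists M (h : T -> \bar R), [/\ 0 <= M, measurable_fun setT h, forall x, (0 <= h x)%E,
    (\int[mu]_x h x < +oo)%E & forall x, ((normc (V x))%:E <= M%:E + h x)%E].
Proof.
move=> mu0 + [mR mI]; have mV : measurable_fun setT (fun x => normc (V x)).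
  by apply: cmeasurable_normc.
case: p => [r| |//]; last first.
  move=> _; rewrite /Lpnorm unlock mu0; set B := ess_sup _ _ => Boo.
  have B0 : (0 <= B)%E by apply: ess_sup_gee => //; apply: aeW => x /=; rewrite lee_fin.
  have finB : B \is a fin_num by rewrite ge0_fin_numE.
  pose h x := Num.max 0 (normc (V x) - fine B).
  have mh : measurable_fun setT h.
    apply: measurable_maxr; first exact: measurable_cst.
    by apply: measurable_funB => //; exact: measurable_cst.
  have h0 x : 0 <= h x by rewrite le_max lexx.
  exists (fine B), (EFin \o h); split.
  - exact: fine_ge0.
  - exact/measurable_EFinP.
  - by move=> x; rewrite lee_fin.
  - rewrite (_ : integral _ _ _ = 0%E) ?ltry// -(integral0 mu setT).
    apply: ge0_ae_eq_integral => //; first exact/measurable_EFinP.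
      by move=> x _; rewrite lee_fin.
    have := ess_sup_ge mu (abse \o (fun x => (normc (V x))%:E)); rewrite -/B.
    apply: filterS => x /= hx _; congr EFin; apply/max_idPl; rewrite subr_le0.
    by rewrite -lee_fin fineK//; apply: le_trans hx; rewrite lee_fin ler_norm.
  - by move=> x; rewrite -EFinD lee_fin -lerBlDl le_max lexx orbT.
rewrite lee_fin => r1; have r0 : 0 < r by rewrite (lt_le_trans _ r1).
rewrite /Lpnorm unlock => /lty_poweRy; rewrite invr_eq0 gt_eqF// => /(_ isT) Ioo.
exists 1, (fun x => (normc (V x) `^ r)%:E); split; first exact: ler01.
- by apply/measurable_EFinP; apply: (measurableT_comp (measurable_powR r)).
- by move=> x; rewrite lee_fin powR_ge0.
- apply: le_lt_trans Ioo; rewrite le_eqVlt; apply/orP; left; apply/eqP.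
  by apply: eq_integral => x _ /=; rewrite ger0_norm ?normc_ge0.
- move=> x; rewrite -EFinD lee_fin; have [le1|gt1] := leP (normc (V x)) 1.
    by rewrite (le_trans le1)// lerDl powR_ge0.
  by rewrite (le_trans (le1r_powR (ltW gt1) r1))// lerDr.
Qed.

Lemma Lpnorm1E d (T : measurableType d) (mu : {measure set T -> \bar R}) (F : T -> R[i]) :
  Lpnorm mu 1 F = (\int[mu]_x (normc (F x))%:E)%E.
Proof.
rewrite /Lpnorm Lnorm1; apply: eq_integral => x _.
by rewrite gee0_abs ?lee_fin ?normc_ge0.
Qed.

(** No point is null for the counting measure, so an essential bound holds everywhere. *)
Lemma le_Lpnormy_countZ h k : ((normc (h k))%:E <= Lpnorm cnt +oo h)%E.
Proof.
have c0 : (0 < cnt setT)%E.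
  apply: (@lt_le_trans _ _ (cnt [set 0])); first by rewrite countZ1 lte01.
  by apply: le_measure; rewrite ?inE.
rewrite /Lpnorm unlock c0; have [A [mA A0 subA]] := ess_sup_ge cnt (abse \o (EFin \o (fun k => normc (h k)))).
rewrite leNgt; apply/negP => hk.
have : (cnt [set k] <= cnt A)%E.
  apply: le_measure; rewrite ?inE// => _ ->; apply: subA => /=; apply/negP.
  by rewrite -ltNge; apply: (lt_le_trans hk); rewrite lee_fin ler_norm.
by rewrite A0 countZ1 lee_fin ler10.
Qed.

Variables (g : Zn n -> R[i]) (k0 : Zn n).
Hypothesis hg : schwartzZ g.
Hypothesis gk0 : g k0 != 0.

(** With [m = k - k0] the window factor in [stftZ_coef_le] is the constant |g(k0)|, and the fiber
    over [m] of the L^1 part is at most its total integral. Boundedness is all that later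
    convergence arguments use about [f]. *)
Lemma modspaceZ_bounded p f : (1 <= p)%E -> modspaceZ g p f ->
  exists2 B, 0 <= B & forall k, normc (f k) <= B.
Proof.
move=> p1 [tf /(in_Lp_split muZT_gt0 p1) [M [h [M0 mh h0 hoo hV]]]].
have I0 : (0 <= \int[muZT R n]_x h x)%E by exact: integral_ge0.
have finI : (\int[muZT R n]_x h x)%E \is a fin_num by rewrite ge0_fin_numE.
have c0 : 0 < normc (g k0) by rewrite normc_gt0.
exists ((M + fine (\int[muZT R n]_x h x)%E) / normc (g k0)).
  by rewrite divr_ge0 ?addr_ge0 ?fine_ge0 ?normc_ge0.
move=> k; rewrite ler_pdivlMr// -lee_fin.
have := stftZ_coef_le k (temperedZ_window (k - k0) hg tf); rewrite subKr => /le_trans; apply.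
rewrite EFinD fineK// integral_muZT//.
have mhm m : measurable_fun setT (fun w => h (m, w)).
  by apply: (measurableT_comp mh); exact: measurable_pair1.
apply: (@le_trans _ _ (M%:E + \int[haarn]_w h ((k - k0)%R, w))%E); last first.
  rewrite leeD2l//; apply: (@ge0_integral_countZ_ge _ _ (fun m => \int[haarn]_w h (m, w))%E).
  by move=> m; apply: integral_ge0.
have -> : (M%:E = \int[haarn]_w M%:E)%E.
  by rewrite integral_cst//= [X in (_ * X)%E](_ : _ = 1%E) ?mule1//; exact: probability_setT.
rewrite -ge0_integralD//.
apply: ge0_le_integral => //.
- by move=> w _; rewrite lee_fin normc_ge0.
- apply/cmeasurable_normcE; under eq_fun do rewrite stftZ_fseries.
  exact: cmeasurable_fseries.
- by apply: emeasurable_funD => //; exact: measurable_cst.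
Qed.

(** The same choice [m = k - k0], now summed over [k]. *)
Lemma modspaceZ1_integrable f : modspaceZ g 1 f -> cintegrable cnt f.
Proof.
move=> [tf [mR mI]]; rewrite Lpnorm1E => Voo.
have c0 : 0 < normc (g k0) by rewrite normc_gt0.
apply/cintegrableP; split=> //.
have I0 : (0 <= \int[cnt]_k (normc (f k))%:E)%E.
  by apply: integral_ge0 => k _; rewrite lee_fin normc_ge0.
suff : ((normc (g k0))%:E * \int[cnt]_k (normc (f k))%:E < +oo)%E.
  by case: integral I0 => [r| |]//; rewrite ?ltry// gt0_muley ?ltxx ?lte_fin.
apply: le_lt_trans Voo; rewrite -ge0_integralZl//; last 2 first.
- by move=> k _; rewrite lee_fin normc_ge0.
- by rewrite lee_fin ltW.
rewrite integral_muZT//; last 2 first.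
- exact/cmeasurable_normcE/cmeasurable_stftZ.
- by move=> x; rewrite lee_fin normc_ge0.
rewrite -[leRHS](integral_countZ_shift _ (- k0)).
apply: ge0_le_integral => // k _; first by rewrite mule_ge0// lee_fin normc_ge0.
have := stftZ_coef_le k (temperedZ_window (k - k0) hg tf).
by rewrite subKr mulrC EFinM.
Qed.

End lattice_modulation_spaces.

Lemma cintegrable_conj d (T : measurableType d) (R : realType)
    (mu : {measure set T -> \bar R}) (F : T -> R[i]) :
  cintegrable mu F -> cintegrable mu (fun x => (F x)^*).
Proof.
move=> /cintegrableP[mF Foo]; apply/cintegrableP; split; first exact: cmeasurable_conj.
by under eq_integral do rewrite normc_conj.
Qed.

Lemma cintegral_real d (T : measurableType d) (R : realType)
    (mu : {measure set T -> \bar R}) (r : T -> R) :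
  cintegral mu (fun x => (r x)%:C) = (fine (\int[mu]_x (r x)%:E)%E)%:C.
Proof. by rewrite /cintegral/= /Rintegral integral0. Qed.

Lemma cintegrable_fin d (T : measurableType d) (R : realType)
    (mu : {measure set T -> \bar R}) (F : T -> R[i]) :
  cintegrable mu F -> (\int[mu]_x (normc (F x))%:E)%E \is a fin_num.
Proof.
move=> /cintegrableP[_ Foo]; rewrite ge0_fin_numE//.
by apply: integral_ge0 => x _; rewrite lee_fin normc_ge0.
Qed.

(** * Parseval, covariance and the inversion inequality *)

Section inversion.
Context (R : realType) (n : nat).
Implicit Types (w : Rn R n) (k l m : Zn n) (f g h : Zn n -> R[i]) (x y z : Zn n * Rn R n).
Local Notation cnt := (@countZ R n).
Local Notation haarn := (haar R n).

Lemma fseries_bounded (a : Zn n -> R[i]) w : cintegrable cnt a ->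
  normc (fseries a w) <= fine (\int[cnt]_k (normc (a k))%:E)%E.
Proof.
by move=> ia; rewrite -lee_fin fineK ?normc_fseries_le//; exact: cintegrable_fin.
Qed.

(** Summability of both sequences reduces this to Fubini and [fseries_coef], with no recourse to
    square-integrable limits. *)
Lemma parseval (a b : Zn n -> R[i]) : cintegrable cnt a -> cintegrable cnt b ->
  cintegral haarn (fun w => fseries a w * (fseries b w)^*) =
  cintegral cnt (fun k => a k * (b k)^*).
Proof.
move=> ia ib; set A := fine (\int[cnt]_k (normc (a k))%:E)%E.
pose F z := (b z.1)^* * (fseries a z.2 * chi z.1 z.2).
have mF k : cmeasurable (fun w => fseries a w * chi k w).
  by apply: cmeasurableM; [exact: cmeasurable_fseries|exact: cmeasurable_chi].
have bF k w : normc (fseries a w * chi k w) <= A.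
  by rewrite normcM normc_chi mulr1 fseries_bounded.
have iF : cintegrable (cnt \x haarn)%E F.
  apply: cintegrable_prod.
    apply: cmeasurable_Zn_prod => k; rewrite /F/=.
    by apply: cmeasurableM => //; exact: cmeasurable_cst.
  apply: (@le_lt_trans _ _ (\int[cnt]_k ((normc (b k))%:E * A%:E))%E).
    apply: ge0_le_integral => // k _.
      by apply: integral_ge0 => w _; rewrite lee_fin normc_ge0.
    rewrite -EFinM; apply: integral_bounded_le.
      by rewrite /F/=; apply: cmeasurableM => //; exact: cmeasurable_cst.
    by move=> w; rewrite /F normcM normc_conj ler_wpM2l ?normc_ge0.
  have A0 : 0 <= A by apply: le_trans (bF 0 0); exact: normc_ge0.
  rewrite ge0_integralZr//; last by move=> k _; rewrite lee_fin normc_ge0.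
  by rewrite -(fineK (cintegrable_fin ib)) -EFinM ltry.
transitivity (cintegral haarn (fun w => cintegral cnt (fun k => F (k, w)))).
  apply: eq_cintegral => w; rewrite {2}/fseries -cintegral_conj; last first.
    by apply: cintegrable_fseries => // k; exact: normc_chi.
  rewrite -cintegralZ; last first.
    apply: cintegrable_conj; apply: cintegrable_fseries => // k; exact: normc_chi.
  apply: eq_cintegral => k; rewrite /F rmorphM/= chi_conj opprK; ring.
rewrite cintegral_fubini2// -cintegral_fubini1//; apply: eq_cintegral => k.
rewrite /F/= cintegralZ ?fseries_coef//; first by rewrite mulrC.
exact: cintegrable_bounded (mF k) (bF k).
Qed.

Lemma cintegrable_countZ_shift h m : cintegrable cnt h -> cintegrable cnt (fun k => h (k - m)).
Proof.
move=> /cintegrableP[_ hoo]; apply/cintegrableP; split=> //.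
by rewrite (integral_countZ_shift (fun k => (normc (h k))%:E) (- m)).
Qed.

Lemma cintegrable_window f h B m : (forall k, normc (f k) <= B) -> cintegrable cnt h ->
  cintegrable cnt (fun k => f k * (h (k - m))^*) /\
  (\int[cnt]_k (normc (f k * (h (k - m))^*))%:E <= B%:E * \int[cnt]_k (normc (h k))%:E)%E.
Proof.
move=> hB ih.
have [] := @cintegrable_boundedM _ _ _ cnt (fun k => (h (k - m))^*) f B
  (cintegrable_conj (cintegrable_countZ_shift m ih)) _ hB; first by [].
rewrite (_ : (fun k => (h (k - m))^* * f k) = fun k => f k * (h (k - m))^*); last first.
  by apply/funext => k; rewrite mulrC.
move=> i1 le1; split=> //.
under eq_integral do rewrite mulrC; apply: (le_trans le1); rewrite muleC.
under eq_integral do rewrite normc_conj.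
by rewrite (integral_countZ_shift (fun k => (normc (h k))%:E) (- m)).
Qed.

Lemma stftZ_bounded h f B x : (forall k, normc (f k) <= B) -> cintegrable cnt h ->
  normc (stftZ h f x) <= B * fine (\int[cnt]_k (normc (h k))%:E)%E.
Proof.
case: x => m w hB ih; have [i1 le1] := cintegrable_window m hB ih.
rewrite -lee_fin EFinM fineK ?cintegrable_fin//.
exact: le_trans (normc_stftZ_le w i1) le1.
Qed.

(** Covariance: the substitution of [k + m'] for [k] turns the shift of [h] into a shift of the
    point, up to a phase that disappears in moduli. *)
Lemma stftZ_tfshift g h m' w' m w B : (forall k, normc (h k) <= B) -> cintegrable cnt g ->
  stftZ g (tfshiftZ m' w' h) (m, w) = chi m' (w' - w) * stftZ g h (m - m', w - w').
Proof.
move=> hB ig; have [i1 _] := cintegrable_window (m - m') hB ig.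
rewrite /stftZ -(cintegral_countZ_shift _ m') -cintegralZ; last first.
  under eq_fun do rewrite tfshiftZE rmorphM/= chi_conj mulrCA mulrC.
  by apply: cintegrable_fseries => // k; exact: normc_chi.
apply: eq_cintegral => k; rewrite !tfshiftZE/= !rmorphM/= addrK.
rewrite (_ : k + m' - m = k - (m - m')); last by rewrite opprB addrA.
rewrite !chi_conj opprD !chiDl !chiDr !chiNr opprK.
have := chi_mulN k w; have := chi_mulN m' w; move: (chi _ _) => *; ring.
Qed.

Lemma integral_stftZ_tfshift g h x B : (forall k, normc (h k) <= B) -> cintegrable cnt g ->
  (\int[muZT R n]_y (normc (stftZ g (tfshiftZ x.1 x.2 h) y))%:E =
   \int[muZT R n]_y (normc (stftZ g h y))%:E)%E.
Proof.
move=> hB ig; rewrite !integral_muZT; try by move=> z; rewrite lee_fin normc_ge0.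
- have mV m : measurable_fun setT (fun w => (normc (stftZ g h (m, w)))%:E).
    apply/cmeasurable_normcE; under eq_fun do rewrite stftZ_fseries.
    exact: cmeasurable_fseries.
  rewrite -[RHS](integral_countZ_shift _ (- x.1)).
  apply: eq_integral => m _.
  have tr := @ge0_integral_haar_translate R n (fun w =>
    (normc (stftZ g h (m - x.1, w)))%:E) (- x.2) (mV (m - x.1)).
  rewrite -tr {tr}.
  + apply: eq_integral => w _.
    by rewrite (stftZ_tfshift _ _ _ _ hB ig) normcM normc_chi mul1r.
  + by move=> w; rewrite lee_fin normc_ge0.
  + move=> i w; rewrite !stftZ_fseries /fseries; congr (normc _)%:E.
    by apply: eq_cintegral => k; rewrite periodic_chi.
- exact/cmeasurable_normcE/cmeasurable_stftZ.
- exact/cmeasurable_normcE/cmeasurable_stftZ.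
Qed.

Variable g : Zn n -> R[i].
Hypothesis ig : cintegrable cnt g.
Hypothesis g2 : (\int[cnt]_k ((normc (g k)) ^+ 2)%:E < +oo)%E.
Let E2 := fine (\int[cnt]_k ((normc (g k)) ^+ 2)%:E)%E.

Let E2E : (E2%:E = \int[cnt]_k ((normc (g k)) ^+ 2)%:E)%E.
Proof.
by rewrite fineK// ge0_fin_numE// integral_ge0// => k _; rewrite lee_fin sqr_ge0.
Qed.

(** For fixed [m], Parseval turns the torus integral of V_g f conj(V_g h) into the sum over k of f
    conj(h) |g(k - m)|^2; summing over [m] yields the factor [E2]. Moduli are taken only after this
    exact identity. *)
Lemma stftZ_inversion_le f h B : (forall k, normc (f k) <= B) -> cintegrable cnt h ->
  ((E2 * normc (cintegral cnt (fun k => f k * (h k)^*)))%:E <=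
  \int[muZT R n]_x (normc (stftZ g f x) * normc (stftZ g h x))%:E)%E.
Proof.
move=> fB ih.
have h0 k : normc (h k) <= fine (\int[cnt]_k (normc (h k))%:E)%E.
  rewrite -lee_fin fineK ?cintegrable_fin//.
  by apply: (@ge0_integral_countZ_ge _ _ (fun k => (normc (h k))%:E)) => l; rewrite lee_fin normc_ge0.
pose c k := f k * (h k)^*.
have ic : cintegrable cnt c.
  by have [+ _] := cintegrable_window 0 fB ih; under eq_fun do rewrite subr0.
pose q k m : R := normc (g (k - m)) ^+ 2.
have q0 k m : (0 <= (q k m)%:E)%E by rewrite lee_fin sqr_ge0.
have c0 k : (0 <= (normc (c k))%:E)%E by rewrite lee_fin normc_ge0.
have qE k : (\int[cnt]_m (q k m)%:E = E2%:E)%E.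
  by rewrite E2E (integral_countZ_reflect (fun k => (normc (g k) ^+ 2)%:E)).
have E20 : 0 <= E2 by apply: fine_ge0; apply: integral_ge0 => k _; rewrite lee_fin sqr_ge0.
pose F (z : Zn n * Zn n) := c z.2 * (q z.2 z.1)%:C.
have normF m k : normc (F (m, k)) = normc (c k) * q k m.
  by rewrite normcM normc_real ger0_norm// sqr_ge0.
have iF : cintegrable (cnt \x cnt)%E F.
  apply: cintegrable_prod; first exact: cmeasurable_Zn_prod.
  rewrite (@fubini_tonelli _ _ _ _ _ cnt cnt (fun z : Zn n * Zn n => (normc (F z))%:E))//; last 2 first.
  - by apply: measurable_Zn_prod.
  - by move=> z; rewrite lee_fin normc_ge0.
  apply: (@le_lt_trans _ _ (\int[cnt]_k ((normc (c k))%:E * E2%:E))%E).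
    rewrite le_eqVlt; apply/orP; left; apply/eqP; apply: eq_integral => k _ /=.
    by under eq_integral do rewrite normF EFinM; rewrite ge0_integralZl ?qE.
  rewrite ge0_integralZr//.
  by rewrite -(fineK (cintegrable_fin ic)) -EFinM ltry.
have sumE : cintegral cnt (fun m => cintegral cnt (fun k => F (m, k))) =
    E2%:C * cintegral cnt c.
  rewrite cintegral_fubini1// -cintegral_fubini2// mulrC -cintegralZr//.
  apply: eq_cintegral => k; rewrite /F/= cintegralZ.
    by rewrite cintegral_real qE.
  apply/cintegrableP; split=> //; under eq_integral do rewrite normc_real ger0_norm ?sqr_ge0//.
  by rewrite qE ltry.
have -> : E2 * normc (cintegral cnt (fun k => f k * (h k)^*)) = normc (E2%:C * cintegral cnt c).
  by rewrite normcM normc_real ger0_norm.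
rewrite -sumE; apply: le_trans (le_normc_cintegral (cintegrable_fubini1 iF)) _.
have mVV : cmeasurable (fun x => stftZ g f x * (stftZ g h x)^*).
  by apply: cmeasurableM; [|apply: cmeasurable_conj]; exact: cmeasurable_stftZ.
under [leRHS]eq_integral do rewrite -[normc (stftZ g h _)]normc_conj -normcM.
rewrite integral_muZT; last 2 first.
- exact: cmeasurable_normcE.
- by move=> x; rewrite lee_fin normc_ge0.
apply: ge0_le_integral => // m _; first by rewrite lee_fin normc_ge0.
have [ia _] := cintegrable_window m fB ig.
have [ib _] := cintegrable_window m h0 ig.
have -> : cintegral cnt (fun k => F (m, k)) =
    cintegral haarn (fun w => stftZ g f (m, w) * (stftZ g h (m, w))^*).
  under [RHS]eq_cintegral do rewrite !stftZ_fseries.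
  rewrite parseval//; apply: eq_cintegral => k.
  have gK : ((g (k - m))^*)^* = g (k - m).
    by apply: complex_eqP; rewrite ?(cRe_conj, cIm_conj) ?opprK.
  by rewrite /F /c /q/= -mul_conjc rmorphM/= gK; ring.
apply: le_normc_cintegral; under eq_fun do rewrite !stftZ_fseries.
apply: (@cintegrable_bounded _ _ _ _ _ (fine (\int[cnt]_k (normc (f k * (g (k - m))^*))%:E)%E *
   fine (\int[cnt]_k (normc (h k * (g (k - m))^*))%:E)%E)).
  by apply: cmeasurableM; [|apply: cmeasurable_conj]; exact: cmeasurable_fseries.
by move=> w; rewrite normcM normc_conj ler_pM ?normc_ge0 ?fseries_bounded.
Qed.

End inversion.

(** * Localization operators *)

Section localization.
Context (R : realType) (n : nat).
Local Notation ZT := (Zn n * Rn R n)%type.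
Implicit Types (w : Rn R n) (k l m : Zn n) (f h : Zn n -> R[i]) (x y z : ZT).
Local Notation cnt := (@countZ R n).
Local Notation mu := (@sfmuZT R n).

Lemma integral_sfmuZT (f : ZT -> \bar R) : (\int[mu]_x f x = \int[muZT R n]_x f x)%E.
Proof. exact: eq_measure_integral. Qed.

Lemma cmeasurable_tfshiftZ h k : cmeasurable (fun x : ZT => tfshiftZ x.1 x.2 h k).
Proof.
apply: cmeasurable_Zn_prod => m /=; under eq_fun do rewrite tfshiftZE.
by apply: cmeasurableM; [exact: cmeasurable_chi|exact: cmeasurable_cst].
Qed.

Lemma cintegrable_tfshiftZ m w h : cintegrable cnt h -> cintegrable cnt (tfshiftZ m w h).
Proof.
move=> ih; rewrite (_ : tfshiftZ m w h = fun k => h (k - m) * chi k w).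
  by apply: cintegrable_fseries; [exact: cintegrable_countZ_shift|move=> k; exact: normc_chi].
by apply/funext => k; rewrite tfshiftZE mulrC.
Qed.

Lemma normc_tfshiftZ m w h B k : (forall k, normc (h k) <= B) -> normc (tfshiftZ m w h k) <= B.
Proof. by move=> hB; rewrite tfshiftZE normcM normc_chi mul1r. Qed.

Variables (g : Zn n -> R[i]) (s : ZT -> R[i]) (g1 g2 f : Zn n -> R[i]) (B1 B2 Bf : R).
Hypotheses (ig : cintegrable cnt g) (is_ : cintegrable (muZT R n) s).
Hypotheses (ig1 : cintegrable cnt g1) (ig2 : cintegrable cnt g2).
Hypotheses (hB1 : forall k, normc (g1 k) <= B1) (hB2 : forall k, normc (g2 k) <= B2).
Hypothesis hBf : forall k, normc (f k) <= Bf.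
Let A := fine (\int[cnt]_k (normc (g k))%:E)%E.
Let A1 := fine (\int[cnt]_k (normc (g1 k))%:E)%E.
Let S := fine (\int[muZT R n]_x (normc (s x))%:E)%E.
Let SE : S%:E = (\int[muZT R n]_x (normc (s x))%:E)%E.
Proof. by rewrite fineK// cintegrable_fin. Qed.
Let ms : cmeasurable s. Proof. by have /cintegrableP[] := is_. Qed.

Let cintegrable_sV (psi : ZT -> R[i]) M : cmeasurable psi -> (forall x, normc (psi x) <= M) ->
  cintegrable (muZT R n) (fun x => s x * stftZ g1 f x * psi x) /\
  (\int[muZT R n]_x (normc (s x * stftZ g1 f x * psi x))%:E <= (S * (Bf * A1 * M))%:E)%E.
Proof.
move=> mpsi hM; under eq_fun do rewrite -mulrA.
under [X in (X <= _)%E]eq_integral do rewrite -mulrA.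
rewrite EFinM SE; apply: cintegrable_boundedM => //.
  by apply: cmeasurableM => //; exact: cmeasurable_stftZ.
move=> x; rewrite normcM ler_pM ?normc_ge0//.
exact: stftZ_bounded.
Qed.

Lemma locop_integrable k :
  cintegrable (muZT R n) (fun x => s x * stftZ g1 f x * tfshiftZ x.1 x.2 g2 k).
Proof.
have [] := cintegrable_sV (cmeasurable_tfshiftZ g2 k) (M := B2) => [x|//].
exact: normc_tfshiftZ.
Qed.

Lemma locop_bounded k : normc (locop s g1 g2 f k) <= S * (Bf * A1 * B2).
Proof.
have [i1 le1] := cintegrable_sV (cmeasurable_tfshiftZ g2 k) (fun x => normc_tfshiftZ x.1 x.2 k hB2).
by rewrite -lee_fin; exact: le_trans (le_normc_cintegral i1) le1.
Qed.

(** Fubini between the lattice sum of the transform and the phase-space integral of the operator,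
    justified by [s] and [g] being integrable and the other factors bounded. *)
Lemma stftZ_locop y : stftZ g (locop s g1 g2 f) y =
  cintegral (muZT R n) (fun x => s x * stftZ g1 f x * stftZ g (tfshiftZ x.1 x.2 g2) y).
Proof.
pose F (z : Zn n * ZT) := (tfshiftZ y.1 y.2 g z.1)^* *
  (s z.2 * stftZ g1 f z.2 * tfshiftZ z.2.1 z.2.2 g2 z.1).
have ic k := cintegrable_sV (cmeasurable_tfshiftZ g2 k) (fun x => normc_tfshiftZ x.1 x.2 k hB2).
have mF : cmeasurable F.
  apply: cmeasurable_Zn_prod => k; rewrite /F/=; apply: cmeasurableM.
    exact: cmeasurable_cst.
  by have [/cintegrableP[]] := ic k.
have iy := cintegrable_tfshiftZ y.1 y.2 ig.
have iF : cintegrable (cnt \x mu)%E F.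
  apply: cintegrable_prod => //.
  apply: (@le_lt_trans _ _ (\int[cnt]_k ((normc (tfshiftZ y.1 y.2 g k))%:E * (S * (Bf * A1 * B2))%:E))%E).
    apply: ge0_le_integral => // k _.
    - by apply: integral_ge0 => x _; rewrite lee_fin normc_ge0.
    - rewrite integral_sfmuZT /F.
      under eq_integral do rewrite normcM normc_conj EFinM /=.
      have [i1 le1] := ic k; rewrite ge0_integralZl//; last 3 first.
      + by apply: cmeasurable_normcE; have /cintegrableP[] := i1.
      + by move=> x _; rewrite lee_fin normc_ge0.
      + by rewrite lee_fin normc_ge0.
      by rewrite lee_wpmul2l ?lee_fin ?normc_ge0.
  have S0 : 0 <= S * (Bf * A1 * B2) by apply: le_trans (locop_bounded 0); exact: normc_ge0.
  rewrite ge0_integralZr//; last by move=> k _; rewrite lee_fin normc_ge0.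
  by rewrite -(fineK (cintegrable_fin iy)) -EFinM ltry.
transitivity (cintegral cnt (fun k => cintegral mu (fun x => F (k, x)))).
  apply: eq_cintegral => k; rewrite /F/= cintegralZ; last exact: locop_integrable.
  by rewrite mulrC.
rewrite cintegral_fubini1// -cintegral_fubini2//; apply: eq_cintegral => x.
have [i1 _] := cintegrable_window y.1 (fun k => normc_tfshiftZ x.1 x.2 k hB2) ig.
rewrite -cintegralZ.
  by apply: eq_cintegral => k; rewrite /F/=; ring.
under eq_fun do rewrite (tfshiftZE y.1) rmorphM/= chi_conj mulrCA mulrC.
by apply: cintegrable_fseries => // k; exact: normc_chi.
Qed.

(** By covariance this is the modulus of V_g h at [z.2 - z.1], so its integral in [z.2] does not
    depend on [z.1]. *)
Definition shift_stft h (z : ZT * ZT) : R := normc (stftZ g (tfshiftZ z.1.1 z.1.2 h) z.2).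

Lemma cmeasurable_shift_stft h :
  cmeasurable (fun z : ZT * ZT => stftZ g (tfshiftZ z.1.1 z.1.2 h) z.2).
Proof.
apply: (@cmeasurable_cintegral _ _ _ _ _ cnt (fun u : (ZT * ZT) * Zn n =>
  tfshiftZ u.1.1.1 u.1.1.2 h u.2 * (tfshiftZ u.1.2.1 u.1.2.2 g u.2)^*)).
apply: (@cmeasurable_comp _ _ _ _ _ (fun v : Zn n * (ZT * ZT) =>
  tfshiftZ v.2.1.1 v.2.1.2 h v.1 * (tfshiftZ v.2.2.1 v.2.2.2 g v.1)^*)
  (fun u : (ZT * ZT) * Zn n => (u.2, u.1))).
  by apply: measurable_fun_pair.
apply: cmeasurable_Zn_prod => k /=; apply: cmeasurableM.
  exact: (cmeasurable_comp _ (cmeasurable_tfshiftZ h k)).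
by apply: cmeasurable_conj; exact: (cmeasurable_comp _ (cmeasurable_tfshiftZ g k)).
Qed.

Lemma measurable_shift_stft h : measurable_fun setT (shift_stft h).
Proof. exact/cmeasurable_normc/cmeasurable_shift_stft. Qed.

Lemma shift_stft_ge0 h (z : ZT * ZT) : 0 <= shift_stft h z.
Proof. exact: normc_ge0. Qed.

Lemma shift_stft_le h B (z : ZT * ZT) : (forall k, normc (h k) <= B) -> shift_stft h z <= B * A.
Proof. by move=> hB; apply: stftZ_bounded => // k; exact: normc_tfshiftZ. Qed.

Lemma integral_shift_stft h B x : (forall k, normc (h k) <= B) ->
  (\int[mu]_y (shift_stft h (x, y))%:E = \int[muZT R n]_y (normc (stftZ g h y))%:E)%E.
Proof. by move=> hB; rewrite integral_sfmuZT (integral_stftZ_tfshift x hB ig). Qed.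

Let measurable_s_term h1 h2 : measurable_fun setT (fun u : ZT * (ZT * ZT) =>
  (normc (s u.1) * shift_stft h1 (u.1, u.2.1) * shift_stft h2 (u.1, u.2.2))%:E).
Proof.
apply/measurable_EFinP; apply: measurable_funM; [apply: measurable_funM|].
- exact: (measurableT_comp (cmeasurable_normc ms)).
- by apply: (measurableT_comp (measurable_shift_stft h1)); apply: measurable_fun_pair => //=;
    exact: measurableT_comp.
- by apply: (measurableT_comp (measurable_shift_stft h2)); apply: measurable_fun_pair => //=;
    exact: measurableT_comp.
Qed.

Let s_term_ge0 h1 h2 x y z :
  (0 <= (normc (s x) * shift_stft h1 (x, y) * shift_stft h2 (x, z))%:E)%E.
Proof. by rewrite lee_fin !mulr_ge0// ?shift_stft_ge0 ?normc_ge0. Qed.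

Lemma integral_kernel_le h1 h2 C1 C2 b y :
  (forall k, normc (h1 k) <= C1) -> (forall k, normc (h2 k) <= C2) ->
  (\int[muZT R n]_y (normc (stftZ g h2 y))%:E = b%:E)%E ->
  (\int[mu]_z \int[mu]_x (normc (s x) * shift_stft h1 (x, y) * shift_stft h2 (x, z))%:E <=
    (S * (C1 * A * b))%:E)%E.
Proof.
move=> hC1 hC2 hb.
have b0 : 0 <= b by rewrite -lee_fin -hb integral_ge0// => z _; rewrite lee_fin normc_ge0.
pose W (u : ZT * ZT) := (normc (s u.1) * shift_stft h1 (u.1, y) * shift_stft h2 (u.1, u.2))%:E.
have mW : measurable_fun setT W.
  have mu' : measurable_fun setT (fun u : ZT * ZT => (u.1, (y, u.2))).
    by apply: measurable_fun_pair => //=; apply: measurable_fun_pair => //=.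
  exact: (measurableT_comp (measurable_s_term h1 h2) mu').
rewrite -(@fubini_tonelli _ _ _ _ _ mu mu W mW (fun u => s_term_ge0 h1 h2 u.1 y u.2)).
rewrite EFinM SE -integral_sfmuZT -ge0_integralZr//; last 3 first.
- exact: cmeasurable_normcE.
- by move=> x _; rewrite lee_fin normc_ge0.
- rewrite lee_fin !mulr_ge0//; first exact: le_trans (normc_ge0 _) (hC1 0).
  by apply: fine_ge0; apply: integral_ge0 => k _; rewrite lee_fin normc_ge0.
apply: ge0_le_integral => //.
- by move=> x _; apply: integral_ge0 => z _; exact: s_term_ge0.
- exact: (@measurable_integral2 _ _ _ _ _ mu W mW (fun u => s_term_ge0 h1 h2 u.1 y u.2)).
- by apply: emeasurable_funM => //; exact: cmeasurable_normcE.
move=> x _; rewrite /W/=; under eq_integral do rewrite EFinM.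
rewrite ge0_integralZl//; last 3 first.
- apply/measurable_EFinP; apply: (measurableT_comp (measurable_shift_stft h2)).
  exact: measurable_pair1.
- by move=> z _; rewrite lee_fin shift_stft_ge0.
- by rewrite lee_fin mulr_ge0 ?normc_ge0 ?shift_stft_ge0.
rewrite (integral_shift_stft x hC2) hb -!EFinM lee_fin -!mulrA ler_wpM2l ?normc_ge0//.
by rewrite mulrA ler_wpM2r// shift_stft_le.
Qed.

Hypothesis g2oo : (\int[cnt]_k ((normc (g k)) ^+ 2)%:E < +oo)%E.
Let E2 := fine (\int[cnt]_k ((normc (g k)) ^+ 2)%:E)%E.
Hypothesis E20 : 0 < E2.

(** [z.1] is the output point, tied to the synthesis window [g2]; [z.2] is the input point, tied to
    the analysis window [g1]. *)
Definition loc_kernel (z : ZT * ZT) : \bar R := (\int[mu]_x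
  (normc (s x) * shift_stft g2 (x, z.1) * shift_stft g1 (x, z.2))%:E)%E.

Lemma measurable_loc_kernel : measurable_fun setT loc_kernel.
Proof.
exact: (@measurable_integral1 _ _ _ _ _ mu _ (measurable_s_term g2 g1)
  (fun u => s_term_ge0 g2 g1 u.1 u.2.1 u.2.2)).
Qed.

Lemma loc_kernel_ge0 (z : ZT * ZT) : (0 <= loc_kernel z)%E.
Proof. by apply: integral_ge0 => x _; exact: s_term_ge0. Qed.

(** The inversion inequality is inserted for V_{g1} f at every [x], with the shifted [g1] as the
    summable function, and Tonelli collects the integral over [x] into the kernel. *)
Lemma stftZ_locop_le y : ((E2 * normc (stftZ g (locop s g1 g2 f) y))%:E <=
  \int[mu]_z (loc_kernel (y, z) * (normc (stftZ g f z))%:E))%E.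
Proof.
have mF : measurable_fun setT (fun z => (normc (stftZ g f z))%:E).
  exact/cmeasurable_normcE/cmeasurable_stftZ.
have F0 z : (0 <= (normc (stftZ g f z))%:E)%E by rewrite lee_fin normc_ge0.
have ma2 : measurable_fun setT (fun x => shift_stft g2 (x, y)).
  by apply: (measurableT_comp (measurable_shift_stft g2)); exact: measurable_pair2.
have mca2 : cmeasurable (fun x => stftZ g (tfshiftZ x.1 x.2 g2) y).
  exact: (cmeasurable_pair2 y (cmeasurable_shift_stft g2)).
have [iy _] := cintegrable_sV mca2 (fun x => stftZ_bounded y (fun k => normc_tfshiftZ x.1 x.2 k hB2) ig).
pose W (u : ZT * ZT) : \bar R := ((normc (s u.1) * shift_stft g2 (u.1, y) * shift_stft g1 u)%:E *
  (normc (stftZ g f u.2))%:E)%E.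
have W0 u : (0 <= W u)%E by rewrite mule_ge0//; case: u => x z; exact: s_term_ge0.
have mu' : measurable_fun setT (fun u : ZT * ZT => (u.1, (y, u.2))).
  by apply: measurable_fun_pair => //=; apply: measurable_fun_pair => //=.
have mW0 : measurable_fun setT (fun u : ZT * ZT =>
    (normc (s u.1) * shift_stft g2 (u.1, y) * shift_stft g1 u)%:E).
  rewrite (_ : (fun u => _) = (fun u : ZT * ZT =>
    (normc (s u.1) * shift_stft g2 (u.1, y) * shift_stft g1 (u.1, u.2))%:E)).
    exact: (measurableT_comp (measurable_s_term g2 g1) mu').
  by apply/funext => -[].
have mW : measurable_fun setT W.
  by apply: emeasurable_funM => //; exact: (measurableT_comp mF).
have -> : (\int[mu]_z (loc_kernel (y, z) * (normc (stftZ g f z))%:E) =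
    \int[mu]_x \int[mu]_z W (x, z))%E.
  rewrite (@fubini_tonelli _ _ _ _ _ mu mu W mW W0).
  apply: eq_integral => z _; rewrite /W/= ge0_integralZr//.
  have mz : measurable_fun setT (fun x : ZT => (x, z)) by exact: measurable_pair2.
  exact: (measurableT_comp mW0 mz).
rewrite stftZ_locop EFinM.
apply: (@le_trans _ _ (E2%:E * \int[muZT R n]_x
    (normc (s x * stftZ g1 f x * stftZ g (tfshiftZ x.1 x.2 g2) y))%:E)%E).
  by rewrite lee_wpmul2l ?lee_fin ?(ltW E20)// le_normc_cintegral.
rewrite -integral_sfmuZT -ge0_integralZl//; last 3 first.
- by apply: cmeasurable_normcE; have /cintegrableP[] := iy.
- by move=> x _; rewrite lee_fin normc_ge0.
- by rewrite lee_fin ltW.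
apply: ge0_le_integral => //.
- by move=> x _; rewrite mule_ge0 ?lee_fin ?normc_ge0// ltW.
- by apply: measurable_funeM; apply: cmeasurable_normcE; have /cintegrableP[] := iy.
- exact: (@measurable_integral2 _ _ _ _ _ mu W mW W0).
move=> x _; rewrite -EFinM !normcM /W/=.
under eq_integral do rewrite EFinM -muleA.
rewrite ge0_integralZl//; last 3 first.
- apply: emeasurable_funM => //; apply/measurable_EFinP.
  by apply: (measurableT_comp (measurable_shift_stft g1)); exact: measurable_pair1.
- by move=> z _; rewrite mule_ge0// lee_fin shift_stft_ge0.
- by rewrite lee_fin mulr_ge0 ?normc_ge0 ?shift_stft_ge0.
rewrite (_ : E2 * _ = normc (s x) * shift_stft g2 (x, y) * (E2 * normc (stftZ g1 f x))); last first.
  by rewrite /shift_stft/=; ring.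
rewrite EFinM lee_wpmul2l ?lee_fin ?mulr_ge0 ?normc_ge0 ?shift_stft_ge0//.
have := stftZ_inversion_le ig g2oo hBf (cintegrable_tfshiftZ x.1 x.2 ig1).
move=> /le_trans; apply; rewrite integral_sfmuZT.
by under [leRHS]eq_integral do rewrite muleC.
Qed.

(** Schur's test for [loc_kernel] divided by [E2]. The constant [H] is any positive number above
    both marginals, because the optimal value may be zero. *)
Lemma locop_norm_le p H b1 b2 : (1 <= p)%E ->
  (\int[muZT R n]_y (normc (stftZ g g1 y))%:E = b1%:E)%E ->
  (\int[muZT R n]_y (normc (stftZ g g2 y))%:E = b2%:E)%E ->
  0 < H -> S * (B2 * A * b1) <= H * E2 -> S * (B1 * A * b2) <= H * E2 ->
  (normMZ g p (locop s g1 g2 f) <= H%:E * normMZ g p f)%E.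
Proof.
move=> p1 hb1 hb2 H0 H1 H2.
pose N (z : ZT * ZT) : \bar R := ((E2^-1)%:E * loc_kernel z)%E.
have Ei0 : (0 <= (E2^-1)%:E)%E by rewrite lee_fin invr_ge0 ltW.
have mN : measurable_fun setT N by apply: measurable_funeM; exact: measurable_loc_kernel.
have N0 (z : ZT * ZT) : (0 <= N z)%E by rewrite mule_ge0// loc_kernel_ge0.
have scale (I : \bar R) a : (I <= a%:E)%E -> a <= H * E2 -> ((E2^-1)%:E * I <= H%:E)%E.
  move=> Ia aH; apply: (@le_trans _ _ ((E2^-1)%:E * (H * E2)%:E)%E).
    by rewrite lee_wpmul2l// (le_trans Ia)// lee_fin.
  by rewrite -EFinM lee_fin mulrCA mulVf ?mulr1// gt_eqF.
have N1 y : (\int[mu]_z N (y, z) <= H%:E)%E.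
  rewrite /N ge0_integralZl//.
  - exact: scale (integral_kernel_le y hB2 hB1 hb1) H1.
  - by apply: (measurableT_comp measurable_loc_kernel); exact: measurable_pair1.
  - by move=> z _; exact: loc_kernel_ge0.
have N2 z : (\int[mu]_y N (y, z) <= H%:E)%E.
  rewrite /N ge0_integralZl//.
  - apply: scale H2; apply: le_trans (integral_kernel_le z hB1 hB2 hb2).
    rewrite le_eqVlt; apply/orP; left; apply/eqP; apply: eq_integral => y _.
    by apply: eq_integral => x _; rewrite mulrAC.
  - by apply: (measurableT_comp measurable_loc_kernel); exact: measurable_pair2.
  - by move=> y _; exact: loc_kernel_ge0.
have mV h : measurable_fun setT (fun y : ZT => normc (stftZ g h y)).
  exact/cmeasurable_normc/cmeasurable_stftZ.
have vN y : ((normc (stftZ g (locop s g1 g2 f) y))%:E <=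
    \int[mu]_z (N (y, z) * (normc (stftZ g f z))%:E))%E.
  rewrite /N; under eq_integral do rewrite -muleA.
  rewrite ge0_integralZl//; last 2 first.
  - apply: emeasurable_funM; last exact/measurable_EFinP.
    by apply: (measurableT_comp measurable_loc_kernel); exact: measurable_pair1.
  - by move=> z _; rewrite mule_ge0 ?loc_kernel_ge0// lee_fin normc_ge0.
  rewrite (_ : (normc _)%:E = (E2^-1)%:E * (E2 * normc (stftZ g (locop s g1 g2 f) y))%:E)%E.
    by rewrite lee_wpmul2l// stftZ_locop_le.
  by rewrite -EFinM mulrA mulVf ?mul1r// gt_eqF.
exact: (@schur_test _ _ _ mu N H mN N0 H0 N1 N2 _ _ (mV f) (mV _)
  (fun z => normc_ge0 _) (fun z => normc_ge0 _) vN p p1).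
Qed.

End localization.

(** * Temperedness, linearity and the main estimate *)

Section bounded_operators.
Context (R : realType) (n : nat).
Implicit Types (k : Zn n) (f g h : Zn n -> R[i]).
Local Notation cnt := (@countZ R n).

(** The weight of exponent [2 * n] is summable with sum at most 4^n, so the seminorm of that order
    controls the pairing. *)
Lemma bounded_temperedZ f B : (forall k, normc (f k) <= B) -> temperedZ f.
Proof.
move=> fB; exists (2 * n)%N, (B * 4 ^+ n) => phi hphi.
have B0 : 0 <= B by apply: le_trans (fB 0); exact: normc_ge0.
have h k : (((1 + zabs R k) ^+ (2 * n) * normc (phi k))%:E <= seminormZ (2 * n) phi)%E.
  by apply: ereal_sup_ubound; exists k.
have finM : seminormZ (2 * n) phi \is a fin_num.
  rewrite ge0_fin_numE ?hphi//; apply: le_trans (h 0); rewrite lee_fin.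
  by rewrite mulr_ge0 ?normc_ge0// exprn_ge0// ltW// zabs1_gt0.
set M := fine (seminormZ (2 * n) phi).
have decay k : (1 + zabs R k) ^+ (2 * n) * normc (f k * phi k) <= B * M.
  rewrite normcM mulrCA ler_pM ?normc_ge0 ?mulr_ge0 ?normc_ge0 ?exprn_ge0 ?(ltW (zabs1_gt0 _ _))//.
  by rewrite -lee_fin fineK.
have le1 := integrable_of_decay decay.
have i1 : cintegrable cnt (fun k => f k * phi k).
  by apply/cintegrableP; split=> //; apply: le_lt_trans le1 _; rewrite ltry.
split=> //; apply: le_trans (le_normc_cintegral i1) _; apply: (le_trans le1).
by rewrite -[X in (_ <= _ * X)%E]fineK// -EFinM lee_fin mulrAC.
Qed.

Lemma stftZ_integrable (g1 f : Zn n -> R[i]) B (x : Zn n * Rn R n) : (forall k, normc (f k) <= B) ->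
  cintegrable cnt g1 -> cintegrable cnt (fun k => f k * (tfshiftZ x.1 x.2 g1 k)^*).
Proof.
move=> fB i1; have [+ _] := cintegrable_window 0 fB (cintegrable_tfshiftZ x.1 x.2 i1).
by under eq_fun do rewrite subr0.
Qed.

Lemma locop_linear (s : Zn n * Rn R n -> R[i]) (g1 g2 : Zn n -> R[i]) B2 a f h Bf Bh :
  cintegrable (muZT R n) s -> cintegrable cnt g1 -> (forall k, normc (g2 k) <= B2) ->
  (forall k, normc (f k) <= Bf) -> (forall k, normc (h k) <= Bh) ->
  locop s g1 g2 (fun k => a * f k + h k) = (fun k => a * locop s g1 g2 f k + locop s g1 g2 h k).
Proof.
move=> is_ i1 b2 bf bh; apply/funext => k.
have If := locop_integrable is_ i1 b2 bf k; have Ih := locop_integrable is_ i1 b2 bh k.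
rewrite /locop -cintegralZ// -cintegralD//; last exact: cintegrableZ.
apply: eq_cintegral => x.
have -> : stftZ g1 (fun k => a * f k + h k) x = a * stftZ g1 f x + stftZ g1 h x.
  have jf := stftZ_integrable x bf i1; have jh := stftZ_integrable x bh i1.
  rewrite /stftZ -cintegralZ// -cintegralD//; last exact: cintegrableZ.
  by apply: eq_cintegral => l; ring.
ring.
Qed.

Lemma Lpnorm2_sqr d (T : measurableType d) (mu : {measure set T -> \bar R}) (F : T -> R[i]) :
  (\int[mu]_x ((normc (F x)) ^+ 2)%:E < +oo)%E ->
  (Lpnorm mu 2%:E F ^+ 2 = \int[mu]_x ((normc (F x)) ^+ 2)%:E)%E.
Proof.
move=> Foo; have I0 : (0 <= \int[mu]_x ((normc (F x)) ^+ 2)%:E)%E.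
  by apply: integral_ge0 => x _; rewrite lee_fin sqr_ge0.
rewrite /Lpnorm unlock.
under eq_integral do rewrite /= ger0_norm ?normc_ge0// powR_mulrn ?normc_ge0//.
rewrite -(@fineK _ (integral _ _ _)) ?ge0_fin_numE// poweR_EFin expe2 -EFinM.
by rewrite -expr2 -powR_mulrn ?powR_ge0// -powRrM mulVf// powRr1// fine_ge0.
Qed.

End bounded_operators.

(** [C] is chosen before the symbol, the windows [g1], [g2] and the exponent, so it depends on [g]
    and [G] only; [s] is chosen before [p], so one formula gives the operator on all M^p. *)
Theorem proposition4p11 (R : realType) (n : nat)
    (g : Zn n -> R[i]) (G : Zn n * Rn R n -> R[i])
    (hg : schwartzZ g) (g_neq0 : exists k, g k != 0)
    (hG : schwartzZT G) (G_neq0 : exists x, G x != 0) :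
  exists C : R,
    [/\ 0 < C,
        normalized_windows g G -> C = 1 &
        forall (u : (Zn n * Rn R n -> R[i]) -> R[i]) (g1 g2 : Zn n -> R[i]),
          modspaceZT G 1%E u ->
          modspaceZ g 1%E g1 -> in_Lp (@countZ R n) +oo%E g1 ->
          modspaceZ g 1%E g2 -> in_Lp (@countZ R n) +oo%E g2 ->
          exists s : Zn n * Rn R n -> R[i], represents s u /\
            forall p : \bar R, (1 <= p)%E ->
              [/\ forall f, modspaceZ g p f -> locop_converges s g1 g2 f,
                  bounded_linear_op g p (locop s g1 g2) &
                  (opnorm g p (locop s g1 g2) <=
                     C%:E *
                     (maxe (normMZ g 1%E g1 * Lpnorm (@countZ R n) +oo%E g2)
                           (Lpnorm (@countZ R n) +oo%E g1 * normMZ g 1%E g2) *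
                      normMZT G 1%E u))%E]].
Proof.
have [k0 gk0] := g_neq0; have [x0 Gx0] := G_neq0.
have ig := schwartzZ_integrable hg.
set A := fine (\int[@countZ R n]_k (normc (g k))%:E)%E.
have A0 : 0 <= A by apply: fine_ge0; apply: integral_ge0 => k _; rewrite lee_fin normc_ge0.
have AE : (Lpnorm (@countZ R n) 1 g = A%:E)%E by rewrite Lpnorm1E fineK// cintegrable_fin.
have sq0 k : (0 <= ((normc (g k)) ^+ 2)%:E)%E by rewrite lee_fin sqr_ge0.
have g2oo : (\int[@countZ R n]_k ((normc (g k)) ^+ 2)%:E < +oo)%E.
  have [M hM] := schwartzZ_bounded hg.
  have [_] := cintegrable_boundedM ig (psi := g) (cmeasurable_Zn _) hM.
  under eq_integral do rewrite normcM -expr2.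
  by move=> /le_lt_trans; apply; rewrite -(fineK (cintegrable_fin ig)) -EFinM ltry.
set E2 := fine (\int[@countZ R n]_k ((normc (g k)) ^+ 2)%:E)%E.
have E2E : (Lpnorm (@countZ R n) 2%:E g ^+ 2 = E2%:E)%E.
  by rewrite Lpnorm2_sqr// fineK// ge0_fin_numE// integral_ge0.
have E20 : 0 < E2.
  rewrite -lte_fin -E2E Lpnorm2_sqr//.
  apply: (@lt_le_trans _ _ ((normc (g k0)) ^+ 2)%:E).
    by rewrite lte_fin exprn_gt0// normc_gt0.
  exact: (@ge0_integral_countZ_ge _ _ (fun k => ((normc (g k)) ^+ 2)%:E)).
have c0 : 0 < normc (G x0) by rewrite normc_gt0.
(* The symbol satisfies |s|_1 * sup |G| <= |u|, which loses nothing against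
   normalized windows and a factor depending on g and G otherwise. *)
exists (if `[< normalized_windows g G >] then 1 else Num.max (A / (E2 * normc (G x0))) 1).
set C := (if _ then _ else _).
have C0 : 0 < C by rewrite /C; case: ifP => // _; rewrite lt_max ltr01 orbT.
split=> //; first by move=> nrm; rewrite /C asboolT.
move=> u g1 g2 hu m1 Lg1 m2 Lg2; exists (symb u).
have is_ := cintegrable_symb hG hu Gx0.
have srep := symb_represents hG hu Gx0; split=> [//|].
set S := fine (\int[muZT R n]_x (normc (symb u x))%:E)%E.
have SE : S%:E = (\int[muZT R n]_x (normc (symb u x))%:E)%E by rewrite fineK// cintegrable_fin.
have S0 : 0 <= S by apply: fine_ge0; apply: integral_ge0 => x _; rewrite lee_fin normc_ge0.
have Uoo : (normMZT G 1 u < +oo)%E by case: hu => _ [].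
have U0 : (0 <= normMZT G 1 u)%E by exact: Lnorm_ge0.
set U := fine (normMZT G 1 u).
have UE : normMZT G 1 u = U%:E by rewrite fineK// ge0_fin_numE.
have Ur0 : 0 <= U by exact: fine_ge0.
have SU z : normc (G z) * S <= U.
  by rewrite -lee_fin EFinM SE -UE (symb_norm_le hG hu Gx0).
(* The only inequality depending on the normalization: it bounds |s|_1 |g|_1 / |g|_2^2, the factor
   shared by both marginals, by [C] times the norm of the symbol. *)
have SAU : S * A <= C * U * E2.
  rewrite /C; case: asboolP => [nrm|_]; last first.
    apply: (@le_trans _ _ (A / (E2 * normc (G x0)) * U * E2)); last first.
      by rewrite ler_wpM2r ?(ltW E20)// ler_wpM2r// le_max lexx.
    rewrite (_ : _ * E2 = A * (U / normc (G x0))); last first.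
      by field; rewrite !gt_eqF.
    by rewrite mulrC ler_wpM2l// ler_pdivlMr// mulrC.
  (* For nonzero [S] the pointwise bounds |G(z)| <= U/S give sup|G| <= U/S, into which the
     normalization is substituted. *)
  have [->|Sn0] := eqVneq S 0; first by rewrite mul0r !mulr_ge0// ltW.
  have Sp : 0 < S by rewrite lt_def Sn0.
  have Goo : (Lpnorm (muZT R n) +oo G <= (U / S)%:E)%E.
    rewrite /Lpnorm unlock muZT_gt0; apply/ess_supP; apply: aeW => z /=.
    by rewrite lee_fin ger0_norm ?normc_ge0// ler_pdivlMr.
  have : (A%:E <= E2%:E * (U / S)%:E)%E.
    by rewrite -AE -E2E (le_trans nrm)// lee_wpmul2l// E2E lee_fin ltW.
  rewrite -EFinM lee_fin => AU; rewrite mul1r mulrC -ler_pdivlMr// (le_trans AU)//.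
  by rewrite mulrA [E2 * U]mulrC.
have fin1 h : modspaceZ g 1 h -> exists2 b, 0 <= b & normMZ g 1 h = b%:E.
  move=> [_ [_ _ hoo]]; exists (fine (normMZ g 1 h)); first exact/fine_ge0/Lnorm_ge0.
  by rewrite fineK// ge0_fin_numE//; exact: Lnorm_ge0.
have finoo h : in_Lp (@countZ R n) +oo%E h -> exists2 b, 0 <= b & Lpnorm (@countZ R n) +oo%E h = b%:E.
  move=> [_ _ hoo]; exists (fine (Lpnorm (@countZ R n) +oo%E h)); first exact/fine_ge0/Lnorm_ge0.
  by rewrite fineK// ge0_fin_numE//; exact: Lnorm_ge0.
have [b1 b10 b1E] := fin1 _ m1; have [b2 b20 b2E] := fin1 _ m2.
have [B1 B10 B1E] := finoo _ Lg1; have [B2 B20 B2E] := finoo _ Lg2.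
have hB1 k : normc (g1 k) <= B1 by rewrite -lee_fin -B1E le_Lpnormy_countZ.
have hB2 k : normc (g2 k) <= B2 by rewrite -lee_fin -B2E le_Lpnormy_countZ.
have ig1 := modspaceZ1_integrable hg gk0 m1; have ig2 := modspaceZ1_integrable hg gk0 m2.
set X := Num.max (b1 * B2) (B1 * b2).
have X0 : 0 <= X by rewrite le_max mulr_ge0.
rewrite b1E b2E B1E B2E UE -!EFinM -EFin_max -!EFinM -/X.
move=> p p1.
(* The slack [e] keeps the Schur constant positive when [C * (X * U)] vanishes. For boundedness
   [e = 1] is enough; for the operator norm [e] tends to 0. *)
have le_norm e f : 0 < e -> modspaceZ g p f ->
    (normMZ g p (locop (symb u) g1 g2 f) <= (C * (X * U) + e)%:E * normMZ g p f)%E.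
  move=> e0 mf; have [Bf _ hBf] := modspaceZ_bounded hg gk0 p1 mf.
  have bound Y : 0 <= Y -> Y <= X -> S * (Y * A) <= (C * (X * U) + e) * E2.
    move=> Y0 YX; apply: (@le_trans _ _ (C * (X * U) * E2)); last first.
      by rewrite ler_wpM2r ?(ltW E20)// lerDl ltW.
    rewrite mulrCA; apply: (le_trans (ler_pM Y0 _ YX SAU)); first exact: mulr_ge0.
    by rewrite le_eqVlt; apply/orP; left; apply/eqP; ring.
  have i1 : (\int[muZT R n]_y (normc (stftZ g g1 y))%:E = b1%:E)%E by rewrite -Lpnorm1E.
  have i2 : (\int[muZT R n]_y (normc (stftZ g g2 y))%:E = b2%:E)%E by rewrite -Lpnorm1E.
  have H0 : 0 < C * (X * U) + e by rewrite ltr_wpDl// !mulr_ge0// ltW.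
  have H1 : S * (B2 * A * b1) <= (C * (X * U) + e) * E2.
    by rewrite [B2 * A * b1]mulrAC bound ?mulr_ge0// le_max [B2 * _]mulrC lexx.
  have H2 : S * (B1 * A * b2) <= (C * (X * U) + e) * E2.
    by rewrite [B1 * A * b2]mulrAC bound ?mulr_ge0// le_max lexx orbT.
  exact: (locop_norm_le ig is_ ig1 hB1 hB2 hBf g2oo E20 p1 i1 i2 H0 H1 H2).
split.
- move=> f mf; have [Bf _ hBf] := modspaceZ_bounded hg gk0 p1 mf.
  split; first by move=> x; exact: stftZ_integrable hBf ig1.
  exact: locop_integrable hB2 hBf.
- split.
  + move=> f mf; have [Bf _ hBf] := modspaceZ_bounded hg gk0 p1 mf.
    split; first exact: bounded_temperedZ (locop_bounded is_ ig1 hB2 hBf).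
    have [mR mI] := @cmeasurable_stftZ R n g (locop (symb u) g1 g2 f); split=> //.
    apply: le_lt_trans (le_norm 1 f ltr01 mf) _.
    by apply: lte_mul_pinfty; rewrite ?lee_fin ?addr_ge0 ?mulr_ge0 ?(ltW C0)//; case: mf => _ [].
  + move=> a f h mf mh; have [Bf _ hBf] := modspaceZ_bounded hg gk0 p1 mf.
    by have [Bh _ hBh] := modspaceZ_bounded hg gk0 p1 mh; exact: locop_linear hB2 hBf hBh.
  + by exists (C * (X * U) + 1) => f; exact: le_norm.
- apply: ge_ereal_sup => _ [f [mf f1] <-]; apply/lee_addgt0Pr => e e0.
  apply: le_trans (le_norm e f e0 mf) _.
  rewrite -EFinD -[leRHS]mule1 lee_wpmul2l// lee_fin addr_ge0 ?(ltW e0)//.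
  by rewrite !mulr_ge0// ltW.
Qed.
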